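(* Suppose $a,b\in(1/4,1/2)$ and $a+2b>1$. Then there is a constant $C$ such that for any $g\in X_{b,1}$ and $h\in Y_{b,1}$, $$\|gh\|_{X_{-a,1}}\le C\|g\|_{X_{b,1}}\|h\|_{Y_{b,1}}.$$
   Context: For functions (distributions) on $\mathbb{R}_x\times\mathbb{R}_t$ with space-time Fourier transform $\hat f(\xi,\tau)$, the Bourgain norms are $\|f\|_{X_{b,s}}=\left(\int_{\mathbb{R}^2}(1+|\xi|)^{2s}(1+|\tau+\xi^2|)^{2b}|\hat f(\xi,\tau)|^2\,d\xi d\tau\right)^{1/2}$ and $\|g\|_{Y_{b,s}}=\left(\int_{\mathbb{R}^2}(1+|\xi|)^{2s}(1+|\tau-\xi^3|)^{2b}|\hat g(\xi,\tau)|^2\,d\xi d\tau\right)^{1/2}$. *)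

(* Defs.v *)
From mathcomp Require Import all_boot all_order all_algebra.
From mathcomp Require Import complex.
From mathcomp Require Import all_classical all_reals all_analysis.

Set Implicit Arguments.
Unset Strict Implicit.
Unset Printing Implicit Defensive.
Import Order.TTheory GRing.Theory Num.Theory.
Import numFieldNormedType.Exports.

Local Open Scope classical_set_scope.
Local Open Scope ring_scope.

(* Points are (x, t) on the physical side and (xi, tau) on the Fourier side. *)
Notation plane R := (measurableTypeR R * measurableTypeR R)%type.

Section Bourgain.
Variable R : realType.
Implicit Types (f g phi F : plane R -> R[i]) (u : plane R -> R) (p q : plane R).

Definition plane_measure : {measure set (plane R) -> \bar R} :=
  (@lebesgue_measure R \x @lebesgue_measure R)%E.

(* The measure-theory library integrates real-valued functions only, hence the
   componentwise definitions. *)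
Definition cmeasurable f : Prop :=
  measurable_fun setT (fun p => complex.Re (f p)) /\
  measurable_fun setT (fun p => complex.Im (f p)).

Definition cintegrable f : Prop :=
  plane_measure.-integrable setT (fun p => (complex.Re (f p))%:E) /\
  plane_measure.-integrable setT (fun p => (complex.Im (f p))%:E).

Definition cintegral f : R[i] :=
  Complex (\int[plane_measure]_p complex.Re (f p))
          (\int[plane_measure]_p complex.Im (f p)).

Definition cis (theta : R) : R[i] := Complex (cos theta) (sin theta).

(* No power of 2 pi is put in front: any other such normalization would only
   change the constants of norm estimates. *)
Definition fourier_integral phi : plane R -> R[i] := fun q =>
  cintegral (fun p => phi p * cis (- (p.1 * q.1 + p.2 * q.2))).

Definition slice (second : bool) u p : R -> R :=
  if second then (fun t => u (p.1, t)) else (fun x => u (x, p.2)).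

Definition coord (second : bool) p : R := if second then p.2 else p.1.

Definition partial (second : bool) u : plane R -> R :=
  fun p => derive1 (slice second u p) (coord second p).

Definition iter_partial (w : seq bool) u : plane R -> R := foldr partial u w.

(* Mixed partials are required in every order; as all of them are bounded, they
   are all Lipschitz, so u is indeed of class C^oo. *)
Definition rschwartz u : Prop := forall w : seq bool,
  (forall second p,
     derivable (slice second (iter_partial w u) p) (coord second p) 1) /\
  (forall k : nat, exists M : R, forall p,
     (1 + `|p.1| + `|p.2|) ^+ k * `|iter_partial w u p| <= M).

Definition schwartz phi : Prop :=
  rschwartz (fun p => complex.Re (phi p)) /\
  rschwartz (fun p => complex.Im (phi p)).

(* f defines a tempered distribution phi |-> \int f phi *)
Definition tempered f : Prop :=
  cmeasurable f /\
  forall phi, schwartz phi -> cintegrable (fun p => f p * phi p).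

(* The space-time Fourier transform of f, in the sense of tempered
   distributions, is the function F. *)
Definition is_fourier f F : Prop :=
  [/\ tempered f, tempered F &
      forall phi, schwartz phi ->
        cintegral (fun p => f p * fourier_integral phi p) =
        cintegral (fun q => F q * phi q)].

Definition weighted_norm (omega : plane R -> R) (b s : R) F : \bar R :=
  sqrte (\int[plane_measure]_q
    ((1 + `|q.1|) `^ (2 * s) * (1 + `|omega q|) `^ (2 * b)
      * complex.Re `|F q| ^+ 2)%:E)%E.

(* F is unique up to a null set, and weighted_norm does not see null sets, so
   this is the infimum of at most one value. It is +oo when the Fourier
   transform of f is not a function. *)
Definition bourgain_norm (omega : plane R -> R) (b s : R) f : \bar R :=
  ereal_inf [set weighted_norm omega b s F | F in is_fourier f].

Definition X_norm := bourgain_norm (fun q => q.2 + q.1 ^+ 2).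

Definition Y_norm := bourgain_norm (fun q => q.2 - q.1 ^+ 3).

Definition X_space (b s : R) : set (plane R -> R[i]) :=
  [set f | (X_norm b s f < +oo)%E].

Definition Y_space (b s : R) : set (plane R -> R[i]) :=
  [set f | (Y_norm b s f < +oo)%E].

End Bourgain.

(* Main.v *)
(* Let G and H be the Fourier transforms of g and h. They are in L^2, as the
   weights are at least 1. Testing the definition of the Fourier transform on
   modulated Gaussians writes the Gaussian mollifications of g as damped Fourier
   integrals of G. Those converge in L^2 by Plancherel's inequality, and the
   limit must be g. Hence g and h are L^2 limits of damped Fourier integrals,
   and gh has the Fourier transform F = (2 pi)^-2 G * H.
   Write (xi, tau) = (xi1, tau1) + (xi2, tau2), let s1 = tau1 + xi1^2 and
   s2 = tau2 - xi2^3, and <x> = 1 + |x|. By Cauchy-Schwarz, <xi>^2 |F|^2 is at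
   most a constant times the convolution of the weighted |G|^2 and |H|^2, times
     <xi>^2 \int <xi1>^-2 <xi2>^-2 <s1>^-2b <s2>^-2b.
   The latter is bounded in (xi, tau), because <xi>^2 <= 2 (<xi1>^2 + <xi2>^2),
   <s1>^-2b <s2>^-2b <= (<s1>^-4b + <s2>^-4b) / 2, and 4b > 1. The remaining
   factor <tau + xi^2>^-2a is at most 1. *)
From HB Require Import structures.
Require Import Defs.
From mathcomp Require Import all_boot all_order all_algebra.
From mathcomp Require Import complex.
From mathcomp Require Import all_classical all_reals all_analysis.
From mathcomp Require Import measurable_realfun lebesgue_integral_under ring lra.
Set Implicit Arguments.
Unset Strict Implicit.
Unset Printing Implicit Defensive.
Import Order.TTheory GRing.Theory Num.Theory.
Import numFieldNormedType.Exports.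
Local Open Scope classical_set_scope.
Local Open Scope ring_scope.

(** A priori [g] is only a measurable function with known pairings against the transforms of
    Schwartz functions; nothing says that it is square integrable. Gaussians bridge the gap: they
    are Schwartz functions with explicit transforms, and damping by them makes the double integrals
    behind Plancherel's inequality absolutely convergent. The damping is removed by Fatou's lemma or
    dominated convergence. Plancherel's inequality serves to show convergence, so its constant need
    not be sharp. The transform of the product is found by testing. For a Schwartz function u with
    transform U, the function a = g U is integrable and square integrable. As e^(i q.y) U(y) is the
    transform of u(. + q), the integral of a(y) e^(i q.y) equals that of G(p) u(p + q). Pairing a
    with the damped integrals of H, which tend to (2 pi)^2 h, hence produces the convolution of G
    and H. *)

Notation L1 m f := (m.-integrable setT (EFin \o f)).

(** * Integrable real-valued functions *)

Section integrable_functions.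
Context d (T : measurableType d) (R : realType) (m : {measure set T -> \bar R}).
Implicit Types f g : T -> R.

Lemma L1_measurable f : L1 m f -> measurable_fun setT f.
Proof. by move=> fi; apply/measurable_EFinP; exact: measurable_int fi. Qed.

Lemma L1Z (c : R) f : L1 m f -> L1 m (fun x => c * f x).
Proof. by move=> fi; have := integrableZl measurableT c fi. Qed.

Lemma L1D f g : L1 m f -> L1 m g -> L1 m (fun x => f x + g x).
Proof. by move=> fi gi; have := integrableD measurableT fi gi. Qed.

Lemma measurable_sqr f : measurable_fun setT f -> measurable_fun setT (fun x => (f x ^+ 2)%:E).
Proof. by move=> mf; apply/measurable_EFinP; exact: measurable_funX. Qed.

End integrable_functions.

(** * Fubini's theorem for real-valued integrals *)

Section fubini_real.
Context d1 d2 (T1 : measurableType d1) (T2 : measurableType d2) (R : realType).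
Variable m1 : {sigma_finite_measure set T1 -> \bar R}.
Variable m2 : {sigma_finite_measure set T2 -> \bar R}.

(** Also covers non-integrable sections: the positive and negative parts have measurable partial
    integrals by Tonelli, and both the extended difference and [fine] preserve measurability. *)
Lemma measurable_Rintegral_param (f : T1 * T2 -> R) :
  measurable_fun setT f ->
  measurable_fun setT (fun x => \int[m2]_y f (x, y)).
Proof.
move=> mf; have mEf : measurable_fun setT (EFin \o f) by exact/measurable_EFinP.
apply: measurableT_comp; first exact: fine_measurable.
have E x : (\int[m2]_y (f (x, y))%:E = \int[m2]_y ((EFin \o f)^\+ (x, y)) -
     \int[m2]_y ((EFin \o f)^\- (x, y)))%E.
  by rewrite integralE; congr (_ - _)%E; apply: eq_integral => y _;
    rewrite ?funeposE ?funenegE.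
under eq_fun do rewrite E.
have mp : measurable_fun setT (fun x => \int[m2]_y ((EFin \o f)^\+ (x, y)))%E.
  by apply: (measurable_fun_fubini_tonelli_F _ (measurable_funepos mEf)).
have mn : measurable_fun setT (fun x => \int[m2]_y ((EFin \o f)^\- (x, y)))%E.
  by apply: (measurable_fun_fubini_tonelli_F _ (measurable_funeneg mEf)).
exact: emeasurable_funB.
Qed.

(** The inner real integral is [fine] of an extended one, hence 0 where that one is infinite; this
    happens only on a null set, so the outer integral does not change. *)
Lemma Rfubini1 (f : T1 * T2 -> R) :
  L1 (m1 \x m2)%E f ->
  \int[m1]_x \int[m2]_y f (x, y) = \int[(m1 \x m2)%E]_z f z.
Proof.
move=> fi; rewrite /Rintegral -(integral12_prod_meas1 fi); congr fine.
have Fi := integrable_fubini_F fi.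
apply: ae_eq_integral => //.
- apply/measurable_EFinP; apply: measurable_Rintegral_param.
  exact: L1_measurable fi.
- exact: measurable_int Fi.
- have := integrable_ae measurableT Fi.
  by apply: filterS => x h _; rewrite /= fineK//; exact: h.
Qed.

Lemma Rfubini2 (f : T1 * T2 -> R) :
  L1 (m1 \x m2)%E f ->
  \int[m2]_y \int[m1]_x f (x, y) = \int[(m1 \x m2)%E]_z f z.
Proof.
move=> fi; rewrite /Rintegral -(integral21_prod_meas1 fi); congr fine.
have Gi : m2.-integrable setT (fubini_G m1 (EFin \o f)).
  have mf := measurable_int _ fi.
  apply/integrableP; split; first exact: (measurable_fubini_G fi).
  have /integrable21ltyP := fi => /(_ mf); apply: le_lt_trans.
  apply: ge0_le_integral => //.
  - by apply: measurableT_comp => //; exact: (measurable_fubini_G fi).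
  - apply: (measurable_fun_fubini_tonelli_G (abse \o (EFin \o f))) => //.
      exact: measurableT_comp.
    by move=> x; exact: abse_ge0.
  - move=> y _; rewrite /fubini_G; apply: le_abse_integral => //.
    exact: (measurable_fun_pair1 y mf).
apply: ae_eq_integral => //.
- apply/measurable_EFinP; apply: measurableT_comp; first exact: fine_measurable.
  exact: measurable_int Gi.
- exact: measurable_int Gi.
- have := integrable_ae measurableT Gi.
  by apply: filterS => x h _; rewrite /= fineK//; exact: h.
Qed.

Lemma Rfubini (f : T1 * T2 -> R) :
  L1 (m1 \x m2)%E f ->
  \int[m1]_x \int[m2]_y f (x, y) = \int[m2]_y \int[m1]_x f (x, y).
Proof. by move=> fi; rewrite Rfubini1// Rfubini2. Qed.

(** Tonelli bounds the double integral of [|f|] by the product of two finite integrals. This is the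
    integrability criterion behind most uses of Fubini's theorem below. *)
Lemma integrable_tensor (A : T1 -> R) (B : T2 -> R) (f : T1 * T2 -> R) :
  L1 m1 A -> L1 m2 B ->
  measurable_fun setT f ->
  (forall x y, `|f (x, y)| <= `|A x| * `|B y|) ->
  L1 (m1 \x m2)%E f.
Proof.
move=> Ai Bi mf fAB.
have mEf : measurable_fun setT (EFin \o f) by exact/measurable_EFinP.
apply/integrable12ltyP => //.
have mB : measurable_fun setT (abse \o (EFin \o B)).
  by apply: measurableT_comp => //; exact: measurable_int Bi.
have mA : measurable_fun setT (abse \o (EFin \o A)).
  by apply: measurableT_comp => //; exact: measurable_int Ai.
apply: (@le_lt_trans _ _ (\int[m1]_x (`|(A x)%:E| * \int[m2]_y `|(B y)%:E|))%E).
  apply: ge0_le_integral => //.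
  - by move=> x _; exact: integral_ge0.
  - apply: (measurable_fun_fubini_tonelli_F (abse \o (EFin \o f))) => //.
      exact: measurableT_comp.
    by move=> x; exact: abse_ge0.
  - by apply: emeasurable_funM => //; exact: measurable_cst.
  - move=> x _; rewrite -ge0_integralZl//.
    apply: ge0_le_integral => //.
    + by apply: measurableT_comp => //; exact: measurable_fun_pair2.
    + by apply: emeasurable_funM => //; exact: measurable_cst.
    + by move=> y _; rewrite /= lee_fin.
rewrite ge0_integralZr//; last exact: integral_ge0.
have /integrableP[_ /= ] := Ai; have /integrableP[_ /= ] := Bi => Bl Al.
by rewrite lte_mul_pinfty// ?integral_ge0// ge0_fin_numE ?integral_ge0.
Qed.

End fubini_real.

(** * Cauchy-Schwarz, Fatou's lemma and completeness of L^2 *)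

Section L2.
Context d (T : measurableType d) (R : realType).
Variable m : {measure set T -> \bar R}.
Implicit Types f g : T -> R.

(** Hölder's inequality with both exponents 2, then squared, so that no root of an integral appears;
    the integrals may be infinite. *)
Lemma cauchy_schwarz f g : measurable_fun setT f -> measurable_fun setT g ->
  ((\int[m]_x (`|f x * g x|)%:E) ^+ 2 <=
   (\int[m]_x ((f x ^+ 2)%:E)) * \int[m]_x ((g x ^+ 2)%:E))%E.
Proof.
move=> mf mg.
have h2 : (0 < 2 :> R) by [].
have h1 : 2^-1 + 2^-1 = 1 :> R by rewrite [RHS]splitr mul1r.
have := hoelder m mf mg h2 h2 h1.
have E h : ('N[m]_2%:E[EFin \o h] `^ 2 = \int[m]_x ((h x ^+ 2)%:E))%E.
  rewrite poweR_Lnorm//; apply: eq_integral => x _ /=.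
  by rewrite powR_mulrn// real_normK// num_real.
rewrite Lnorm1 => H.
have /= := @gt0_ler_poweR R 2 (ltW h2) _ _ _ _ H.
rewrite !in_itv/= !leey !andbT integral_ge0 ?mule_ge0 ?Lnorm_ge0// => /(_ isT isT).
rewrite poweRM ?Lnorm_ge0// !E => /(le_trans _); apply.
have : (0 <= \int[m]_x `|f x * g x|%:E)%E by exact: integral_ge0.
case: (\int[m]_x `|f x * g x|%:E)%E => [r r0| _|//].
- by rewrite poweR_EFin powR_mulrn// -EFin_expe.
- by rewrite poweRyr ?leey.
Qed.

Lemma fatou_bound (f : nat -> T -> R) g (M : \bar R) :
  (forall n, measurable_fun setT (f n)) -> measurable_fun setT g ->
  (forall n x, 0 <= f n x) ->
  {ae m, forall x, f n x @[n --> \oo] --> g x} ->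
  (forall n, \int[m]_x (f n x)%:E <= M)%E -> (\int[m]_x (g x)%:E <= M)%E.
Proof.
move=> mf mg f0 fg fM.
(* Almost everywhere the limit is the lower limit, to which Fatou's lemma applies; lower limits are
   measurable as opposites of upper limits. *)
have E : (\int[m]_x (g x)%:E = \int[m]_x limn_einf (fun n => (f n x)%:E))%E.
  apply: ae_eq_integral => //; first exact/measurable_EFinP.
    have eE x : limn_einf (fun n => (f n x)%:E) = (- limn_esup (fun n => (- f n x)%:E))%E.
      rewrite -limn_einfN; congr limn_einf; apply/funext => n /=.
      by rewrite opprK.
    under eq_fun do rewrite eE.
    apply: measurableT_comp => //; apply: measurable_fun_limn_esup => n.
    by apply/measurable_EFinP; exact: measurableT_comp.
  apply: filterS fg => x fgx _ /=.
  have : (f n x)%:E @[n --> \oo] --> (g x)%:E by apply: cvg_EFin => //; exact: nearW.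
  by move=> /cvg_limn_einf_sup[->].
rewrite E; apply: le_trans.
  apply: fatou => // [n|n x _]; first exact/measurable_EFinP.
  by rewrite lee_fin.
rewrite limn_einf_lim; apply: lime_le; first exact: is_cvg_einfs.
apply: nearW => n; apply: (le_trans _ (fM n)).
by apply: ereal_inf_lbound; exists n => //=.
Qed.

(** The Riesz-Fischer argument: a rapidly convergent subsequence converges almost everywhere, and
    Fatou's lemma transfers the Cauchy rate [e] to the limit. *)
Lemma L2_complete (f : nat -> T -> R) (e : nat -> R) :
  (forall n, measurable_fun setT (f n)) ->
  (forall n k, (n <= k)%N -> (\int[m]_x ((f n x - f k x) ^+ 2)%:E <= (e n)%:E)%E) ->
  e n @[n --> \oo] --> 0 ->
  exists g : T -> R, measurable_fun setT g /\
    forall n, (\int[m]_x ((f n x - g x) ^+ 2)%:E <= (e n)%:E)%E.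
Proof.
move=> mf fe e0.
have /choice[N HN] : forall j : nat, exists N, forall n, (N <= n)%N -> e n <= 8^-1 ^+ j.
  move=> j; have p8 : 0 < (8^-1 : R) ^+ j by rewrite exprn_gt0.
  have /cvgrPdist_le /(_ _ p8)[N _ H] := e0.
  exists N => n Nn; have := H n Nn; rewrite sub0r normrN; apply: le_trans; exact: ler_norm.
(* Summing the successors of the [N i] makes [k] increasing, with [k j] at least both [N j] and
   [j]. *)
pose k j := (\sum_(i < j.+1) (N i).+1)%N.
have kS j : k j.+1 = (k j + (N j.+1).+1)%N by rewrite /k big_ord_recr.
have kN j : (N j <= k j)%N.
  by rewrite /k big_ord_recr /= (leq_trans _ (leq_addl _ _)).
have jk j : (j <= k j)%N.
  by elim: j => // j IH; rewrite kS addnS ltnS (leq_trans IH) ?leq_addr.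
pose dd j x := f (k j.+1) x - f (k j) x.
have md j : measurable_fun setT (dd j) by exact: measurable_funB.
have d8 j : (\int[m]_x ((dd j x) ^+ 2)%:E <= (8^-1 ^+ j)%:E)%E.
  have -> : (\int[m]_x ((dd j x) ^+ 2)%:E =
             \int[m]_x ((f (k j) x - f (k j.+1) x) ^+ 2)%:E)%E.
    by apply: eq_integral => x _; rewrite /dd -sqrrN opprB.
  by rewrite (le_trans (fe _ (k j.+1) _)) ?lee_fin ?HN ?kN// kS leq_addr.
(* The increments have squared norm at most 8^-j. The weight 4^j leaves the convergent series of the
   2^-j, and where [S] is finite it forces increments of size at most [sqrt (S x)] times 2^-j, so
   their series converges. *)
pose S x := (\sum_(0 <= j <oo) (4 ^+ j * dd j x ^+ 2)%:E)%E.
have t0 j x : (0 <= (4 ^+ j * dd j x ^+ 2)%:E)%E.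
  by rewrite lee_fin mulr_ge0 ?sqr_ge0 ?exprn_ge0.
have mt j : measurable_fun setT (fun x => (4 ^+ j * dd j x ^+ 2)%:E).
  by apply/measurable_EFinP; apply: measurable_funM => //; apply: measurable_funX.
have mS : measurable_fun setT S by apply: ge0_emeasurable_sum.
have Soo : (\int[m]_x S x < +oo)%E.
  rewrite /S integral_nneseries//.
  apply: (@le_lt_trans _ _ (\sum_(0 <= j <oo) (geometric 1 2^-1 j)%:E)%E).
    apply: lee_nneseries => [j _ _|j _]; first exact: integral_ge0.
    under eq_integral do rewrite EFinM.
    rewrite ge0_integralZl//; last 2 first.
    - exact: measurable_sqr.
    - by move=> x _; rewrite lee_fin sqr_ge0.
    apply: (@le_trans _ _ ((4 ^+ j)%:E * (8^-1 ^+ j)%:E)%E).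
      by rewrite lee_pmul2l ?lte_fin ?exprn_gt0.
    rewrite -EFinM lee_fin -exprMn /geometric /= mul1r.
    by rewrite (_ : 4 * 8^-1 = 2^-1 :> R)//; lra.
  have h1 : `|2^-1 : R| < 1 by rewrite ger0_norm; lra.
  rewrite (_ : (\sum_(0 <= j <oo) (geometric 1 2^-1 j)%:E)%E = (1 / (1 - 2^-1))%:E); first exact: ltry.
  apply/cvg_lim => //.
  have h := @cvg_geometric_series R 1 2^-1 h1.
  rewrite (_ : (fun _ => _) = EFin \o series (geometric 1 2^-1)); last first.
    by apply/funext => n /=; rewrite sumEFin.
  by apply: cvg_EFin => //; exact: nearW.
have Sae : {ae m, forall x, S x \is a fin_num}.
  have Si : m.-integrable setT S.
    apply/integrableP; split => //.
    under eq_integral => x _ do rewrite gee0_abs ?nneseries_ge0//.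
    exact: Soo.
  by have := integrable_ae measurableT Si; apply: filterS => x; exact.
have cvgf x : S x \is a fin_num -> cvgn (fun j => f (k j) x).
  move=> Sx.
  have bd j : `|dd j x| <= geometric (Num.sqrt (fine (S x))) 2^-1 j.
    have h : 4 ^+ j * dd j x ^+ 2 <= fine (S x).
      rewrite -lee_fin fineK//.
      apply: le_trans; last exact: (nneseries_lim_ge j.+1).
      rewrite big_nat_recr//= leeDr//; exact: sume_ge0.
    rewrite /geometric /= -(@ger0_norm _ (Num.sqrt _ * _)); last first.
      by rewrite mulr_ge0 ?sqrtr_ge0 ?exprn_ge0.
    rewrite -(@ler_pXn2r _ 2%N) ?nnegrE// !real_normK ?num_real//.
    rewrite exprMn sqr_sqrtr; last first.
      by apply: le_trans h; rewrite mulr_ge0 ?sqr_ge0 ?exprn_ge0.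
    rewrite -exprM mulnC exprM (_ : (2^-1) ^+ 2 = 4^-1 :> R); last by lra.
    by rewrite exprVn ler_pdivlMr ?exprn_gt0// mulrC.
  have cs : cvgn (series (fun j => dd j x)).
    apply: normed_cvg.
    apply: (series_le_cvg _ _ bd) => // [j|]; first by rewrite (le_trans _ (bd j)).
    by apply: is_cvg_geometric_series; rewrite ger0_norm; lra.
  rewrite (_ : (fun j => f (k j) x) =
    (fun j => f (k 0%N) x + series (fun j => dd j x) j)); last first.
    apply/funext => j; exact: (eq_sum_telescope (fun j => f (k j) x)).
  apply: is_cvgD => //; exact: is_cvg_cst.
(* The upper limit is measurable everywhere and agrees with the limit where the latter exists. *)
pose g x := fine (limn_esup (fun j => (f (k j) x)%:E)).
have mg : measurable_fun setT g.
  apply: measurableT_comp; first exact: fine_measurable.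
  by apply: measurable_fun_limn_esup => n; exact/measurable_EFinP.
exists g; split => // n.
(* The subsequence is started at [n], so that [n <= k (n + j)] and the Cauchy bound with rate [e n]
   applies to every term. *)
apply: (@fatou_bound (fun j x => (f n x - f (k (n + j)%N) x) ^+ 2)).
- by move=> j; apply: measurable_funX; exact: measurable_funB.
- by apply: measurable_funX; exact: measurable_funB.
- by move=> j x; exact: sqr_ge0.
- apply: filterS Sae => x /cvgf cx.
  have gx : f (k j) x @[j --> \oo] --> g x.
    rewrite /g (_ : limn_esup _ = (limn (fun j => f (k j) x))%:E)//.
    have : (f (k j) x)%:E @[j --> \oo] --> (limn (fun j => f (k j) x))%:E.
      by apply: cvg_EFin => //; exact: nearW.
    by move=> /cvg_limn_einf_sup[_ ->].
  have gx' : f (k (n + j)%N) x @[j --> \oo] --> g x.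
    move: gx; rewrite -(cvg_shiftn n) => h.
    by under eq_fun do rewrite addnC.
  rewrite expr2; under eq_fun do rewrite expr2.
  by apply: cvgM; (apply: cvgB; [exact: cvg_cst|exact: gx']).
- by move=> j; apply: fe; rewrite (leq_trans _ (jk _))// leq_addr.
Qed.

End L2.

(** * Dominated convergence for real-valued integrals *)

Section dominated.
Context d (T : measurableType d) (R : realType).
Variable m : {measure set T -> \bar R}.
Variables (f_ : nat -> T -> R) (f g : T -> R).
Hypothesis mf_ : forall n, measurable_fun setT (f_ n).
Hypothesis mf : measurable_fun setT f.
Hypothesis ff : {ae m, forall x, f_ n x @[n --> \oo] --> f x}.
Hypothesis gi : L1 m g.
Hypothesis fg : forall n x, `|f_ n x| <= g x.

Let dct : [/\ L1 m f,
  (\int[m]_x `|(f_ n x)%:E - (f x)%:E|)%E @[n --> \oo] --> 0%E &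
  (\int[m]_x (f_ n x)%:E)%E @[n --> \oo] --> (\int[m]_x (f x)%:E)%E ].
Proof.
apply: (@dominated_convergence _ _ _ m setT measurableT (fun n x => (f_ n x)%:E)
  (EFin \o f) (EFin \o g)) => //.
- by move=> n; exact/measurable_EFinP.
- exact/measurable_EFinP.
- apply: filterS ff => x fx _.
  by apply: cvg_EFin => //; exact: nearW.
- by apply: aeW => x n _ /=; rewrite lee_fin.
Qed.

Lemma dominated_cvg_Rintegral : \int[m]_x f_ n x @[n --> \oo] --> \int[m]_x f x.
Proof.
have [fi _ H] := dct; apply: fine_cvg.
by rewrite fineK//; exact: integrable_fin_num.
Qed.

End dominated.

(** * Affine changes of variable on the line *)

Section affine.
Context (R : realType).
Local Notation L := (@lebesgue_measure R).
Variables (a c : R) (a0 : a != 0).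
Let phi : measurableTypeR R -> measurableTypeR R := fun x => a * x + c.
Let mphi : measurable_fun setT phi.
Proof.
apply: measurable_funD; last exact: measurable_cst.
by apply: measurable_funM; [exact: measurable_cst|exact: measurable_id].
Qed.
Let nu : {measure set (measurableTypeR R) -> \bar R} :=
  measure_function_pushforward__canonical__measure_function_Measure L mphi.

Let na : {nonneg R} := NngNum (normr_ge0 a).

(** Uniqueness of Lebesgue measure: the pushforward under [phi], scaled by [|a|], gives every
    half-open interval its length. *)
Let lebesgue_affine A : measurable A ->
  L A = mscale na nu A.
Proof.
apply: lebesgue_measure_unique => _ [[u v] _ <-] /=.
rewrite /mscale/= /pushforward/=.
have [a_gt0|a_le0] := ltP 0 a.
- rewrite (_ : phi @^-1` _ = `](u - c) / a, (v - c) / a]%classic); last first.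
    apply/seteqP; split => x /=; rewrite !in_itv/= /phi ltr_pdivrMr// ler_pdivlMr//;
      rewrite ltrBlDr lerBrDr mulrC//.
  rewrite !lebesgue_measure_itv/= !lte_fin.
  rewrite ltr_pM2r ?invr_gt0// ltrD2r; case: ifPn => _; last by rewrite mule0.
  rewrite -!EFinD -EFinM gtr0_norm//; congr EFin; by field.
(* A negative slope reverses the interval, so the preimage is closed at the other end; its length is
   unaffected. *)
- have a_lt0 : a < 0 by rewrite lt_neqAle a0.
  rewrite (_ : phi @^-1` _ = `[(v - c) / a, (u - c) / a[%classic); last first.
    apply/seteqP; split => x /=; rewrite !in_itv/= /phi ltr_ndivlMr// ler_ndivrMr//;
      rewrite ltrBlDr lerBrDr andbC mulrC//.
  rewrite !lebesgue_measure_itv/= !lte_fin.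
  rewrite ltr_nM2r ?invr_lt0// ltrD2r; case: ifPn => _; last by rewrite mule0.
  rewrite -!EFinD -EFinM ltr0_norm//; congr EFin; by field.
Qed.

Lemma ge0_integral_affine (f : R -> \bar R) :
  measurable_fun setT f -> (forall x, 0 <= f x)%E ->
  (\int[L]_x f x = `|a|%:E * \int[L]_x f (a * x + c)%R)%E.
Proof.
move=> mf f0; transitivity (\int[mscale na nu]_x f x)%E.
  by apply: eq_measure_integral => A mA _; exact: lebesgue_affine.
rewrite ge0_integral_mscale//; congr (_ * _)%E.
by rewrite (ge0_integral_pushforward mphi).
Qed.

End affine.

(** [plane_measure] under a name of its own, which carries the sigma-finite structure that Fubini's
    theorem asks for. *)
Definition pm (R : realType) : set (plane R) -> \bar R := plane_measure R.
HB.instance Definition _ (R : realType) := Measure.on (@pm R).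

Lemma pm_sigma_finite (R : realType) : sigma_finite setT (@pm R).
Proof.
have /sigma_finiteP[F [TF ndF Foo]] := sigma_finiteT (@lebesgue_measure R).
(* The exhaustion is nondecreasing, so a point lies in the square given by the larger of the indices
   of its coordinates. *)
exists (fun n => F n `*` F n).
  rewrite -setXTT TF predeqE => -[x y]; split.
    move=> [/= [n _ Fnx] [k _ Gky]]; exists (maxn n k) => //; split.
    - by move: x Fnx; exact/subsetPset/ndF/leq_maxl.
    - by move: y Gky; exact/subsetPset/ndF/leq_maxr.
  by move=> [n _ []/= ? ?]; split; exists n.
move=> k; have [? ?] := Foo k.
split; first exact: measurableX.
rewrite /pm /plane_measure /= product_measure1E// lte_mul_pinfty// ge0_fin_numE//.
Qed.

HB.instance Definition _ (R : realType) :=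
  Measure_isSigmaFinite.Build _ _ _ (@pm R) (@pm_sigma_finite R).

(** * Invariance of the plane measure under translations and reflections *)

Section plane.
Context (R : realType).
Local Notation L := (@lebesgue_measure R).
Local Notation mu := (@pm R).
Implicit Types (f : plane R -> \bar R) (p c : plane R).

Lemma plane_measureE : plane_measure R = mu :> {measure set (plane R) -> \bar R}.
Proof. by []. Qed.

Lemma measurable_plane_affine (s : R) c :
  measurable_fun setT (fun p : plane R => (s * p.1 + c.1, s * p.2 + c.2) : plane R).
Proof.
by apply/measurable_fun_pairP; split; apply: measurable_funD => //;
  apply: measurable_funM.
Qed.

(** The signs [s = 1] and [s = -1] give the translations and the point reflections, the two
    substitutions that convolutions need. *)
Let ge0_integral_plane_affine (s : R) c f : `|s| = 1 ->
  measurable_fun setT f -> (forall p, 0 <= f p)%E ->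
  (\int[mu]_p f (s * p.1 + c.1, s * p.2 + c.2)%R = \int[mu]_p f p)%E.
Proof.
move=> s1 mf f0; have s0 : s != 0 by rewrite -normr_gt0 s1.
have mfs : measurable_fun setT (fun p : plane R => f (s * p.1 + c.1, s * p.2 + c.2)).
  exact: (measurableT_comp mf (measurable_plane_affine s c)).
change (\int[(L \x L)%E]_p f (s * p.1 + c.1, s * p.2 + c.2)%R = \int[(L \x L)%E]_p f p)%E.
rewrite (fubini_tonelli1 f)// [LHS](fubini_tonelli1 _ mfs)//.
rewrite /fubini_F /= [RHS](ge0_integral_affine c.1 s0)//; last 2 first.
- exact: measurable_fun_fubini_tonelli_F.
- by move=> x; exact: integral_ge0.
rewrite s1 mul1e; apply: eq_integral => x _.
rewrite [RHS](ge0_integral_affine c.2 s0)//; last exact: measurable_fun_pair2.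
by rewrite s1 mul1e.
Qed.

Lemma ge0_integral_shift c f :
  measurable_fun setT f -> (forall p, 0 <= f p)%E ->
  (\int[mu]_p f (p + c)%R = \int[mu]_p f p)%E.
Proof.
move=> mf f0; rewrite -(ge0_integral_plane_affine c (normr1 R) mf f0).
by apply: eq_integral => p _; rewrite !mul1r.
Qed.

Lemma ge0_integral_refl c f :
  measurable_fun setT f -> (forall p, 0 <= f p)%E ->
  (\int[mu]_p f (c - p)%R = \int[mu]_p f p)%E.
Proof.
move=> mf f0.
rewrite -(ge0_integral_plane_affine c (etrans (normrN 1) (normr1 R)) mf f0).
by apply: eq_integral => p _; rewrite !mulN1r ![- _ + _]addrC.
Qed.

Lemma measurable_shift c : measurable_fun setT (fun p => p + c).
Proof.
have := measurable_plane_affine 1 c.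
by congr measurable_fun; apply/funext => p; rewrite !mul1r.
Qed.

Lemma measurable_refl c : measurable_fun setT (fun p => c - p).
Proof.
have := measurable_plane_affine (-1) c.
by congr measurable_fun; apply/funext => p; rewrite !mulN1r ![- _ + _]addrC.
Qed.

Lemma Rintegral_shift c (f : plane R -> R) : measurable_fun setT f ->
  \int[mu]_p f (p + c) = \int[mu]_p f p.
Proof.
move=> mf; have mEf : measurable_fun setT (EFin \o f) by exact/measurable_EFinP.
rewrite /Rintegral; congr fine; rewrite [RHS]integralE [LHS]integralE.
rewrite -(ge0_integral_shift c (measurable_funepos mEf))//.
rewrite -(ge0_integral_shift c (measurable_funeneg mEf))//.
by congr (_ - _)%E; apply: eq_integral => p _; rewrite ?funeposE ?funenegE.
Qed.

End plane.

(** * Gaussians on the line: derivatives, integrals, bounds *)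

Section gaussian.
Context (R : realType).
Local Notation L := (@lebesgue_measure R).
Implicit Types (e x xi : R).

(** With the factor 1/2 in the exponent, the Fourier transform inverts the parameter: [gauss e]
    becomes a multiple of [gauss e^-1]. *)
Definition gauss e x := expR (- (e / 2 * x ^+ 2)).

Lemma gauss_ge0 e x : 0 <= gauss e x. Proof. exact: expR_ge0. Qed.

Lemma gauss_le1 e x : 0 <= e -> gauss e x <= 1.
Proof.
by move=> e0; rewrite -expR0 ler_expR oppr_le0 mulr_ge0 ?sqr_ge0 ?divr_ge0.
Qed.

Lemma gaussN e x : gauss e (- x) = gauss e x. Proof. by rewrite /gauss sqrrN. Qed.

Lemma gauss0 e : gauss e 0 = 1. Proof. by rewrite /gauss expr0n mulr0 oppr0 expR0. Qed.

Lemma measurable_gauss e : measurable_fun setT (gauss e).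
Proof.
apply: (measurableT_comp (@measurable_expR R)); apply: measurableT_comp => //.
by apply: measurable_funM => //; apply: measurable_funX.
Qed.

Lemma is_derive_gauss e x : is_derive x 1 (gauss e) (- (e * x) * gauss e x).
Proof.
have h : is_derive x 1 ((- (e / 2)) \*: (id ^+ 2)) (- (e * x)).
  by apply: is_derive_eq; rewrite /GRing.scale /= expr1; field.
have E y : ((- (e / 2)) \*: (id ^+ 2) : R -> R) y = - (e / 2 * y ^+ 2) by exact: mulNr.
have := is_derive1_comp (is_derive_expR _) h.
rewrite E [X in is_derive _ _ _ X]mulrC (_ : expR \o _ = gauss e)//.
by apply/funext => y; exact: (congr1 expR (E y)).
Qed.

Lemma is_derive_cosM xi x : is_derive x 1 (fun y => cos (xi * y)) (- xi * sin (xi * x)).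
Proof.
have h : is_derive x 1 (xi \*: id) xi.
  by apply: is_derive_eq; rewrite /GRing.scale /= mulr1.
have := is_derive1_comp (is_derive_cos _) h.
by rewrite mulNr mulrC -mulNr mulrC.
Qed.

Lemma is_derive_sinM xi x : is_derive x 1 (fun y => sin (xi * y)) (xi * cos (xi * x)).
Proof.
have h : is_derive x 1 (xi \*: id) xi.
  by apply: is_derive_eq; rewrite /GRing.scale /= mulr1.
have := is_derive1_comp (is_derive_sin _) h.
by rewrite mulrC.
Qed.

Lemma normal_pdf_gauss e x : 0 < e ->
  normal_pdf 0 (Num.sqrt e^-1) x = (Num.sqrt (2 * pi / e))^-1 * gauss e x.
Proof.
move=> e0; rewrite normal_pdfE ?gt_eqF ?sqrtr_gt0 ?invr_gt0//.
rewrite /normal_peak /normal_fun subr0 sqr_sqrtr ?invr_ge0 ?ltW//.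
congr (_^-1 * expR _).
  by congr Num.sqrt; rewrite -mulr_natl; field; rewrite gt_eqF.
by rewrite -[_ *+ 2]mulr_natl; field; rewrite gt_eqF.
Qed.

Lemma integrable_gauss e : 0 < e -> L1 L (gauss e).
Proof.
move=> e0; have c0 : Num.sqrt (2 * pi / e) != 0.
  by rewrite gt_eqF// sqrtr_gt0 divr_gt0 ?mulr_gt0 ?pi_gt0.
rewrite (_ : EFin \o gauss e = (fun x => (Num.sqrt (2 * pi / e))%:E *
    (normal_pdf 0 (Num.sqrt e^-1) x)%:E)%E); last first.
  by apply/funext => x; rewrite normal_pdf_gauss// -EFinM mulrA divff ?mul1r.
by apply: integrableZl => //; exact: integrable_normal_pdf.
Qed.

Lemma integral_gauss e : 0 < e -> \int[L]_x gauss e x = Num.sqrt (2 * pi / e).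
Proof.
move=> e0; have c0 : Num.sqrt (2 * pi / e) != 0.
  by rewrite gt_eqF// sqrtr_gt0 divr_gt0 ?mulr_gt0 ?pi_gt0.
have := integral_normal_pdf (0 : R) (Num.sqrt e^-1).
under eq_integral do rewrite normal_pdf_gauss// EFinM.
rewrite integralZl//; last exact: integrable_gauss.
rewrite /Rintegral.
have : (\int[L]_x (gauss e x)%:E \is a fin_num)%E.
  by have := integrable_gauss e0; exact: integrable_fin_num.
case: (\int[L]_x (gauss e x)%:E)%E => // r _ /=; rewrite -EFinM => -[] H.
by apply: (mulfI (invr_neq0 c0)); rewrite H mulVf.
Qed.

(** Half of the exponent absorbs [|x|]. Since [expR u >= 1 + u], the constant is chosen so that
    [(1 + 4 / e) * (1 + e / 4 * x ^+ 2)] is at least [1 + x ^+ 2], which is at least [|x|]. *)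
Lemma ler_norm_gauss e x : 0 < e -> `|x| * gauss e x <= (1 + 4 / e) * gauss (e / 2) x.
Proof.
move=> e0.
have -> : gauss e x = gauss (e / 2) x * gauss (e / 2) x.
  by rewrite /gauss -expRD; congr expR; field.
rewrite mulrA ler_wpM2r ?gauss_ge0//.
rewrite {1}/gauss expRN ler_pdivrMr ?expR_gt0//.
have h : 1 + e / 2 / 2 * x ^+ 2 <= expR (e / 2 / 2 * x ^+ 2) by exact: expR_ge1Dx.
apply: le_trans (_ : (1 + 4 / e) * (1 + e / 2 / 2 * x ^+ 2) <= _); last first.
  by rewrite ler_wpM2l// addr_ge0// divr_ge0// ltW.
have -> : (1 + 4 / e) * (1 + e / 2 / 2 * x ^+ 2) =
    1 + x ^+ 2 + (4 / e + e / 2 / 2 * x ^+ 2) by field; rewrite gt_eqF.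
have h1 : 0 <= 4 / e + e / 2 / 2 * x ^+ 2.
  have e0' := ltW e0.
  by apply: addr_ge0; [apply: divr_ge0|apply: mulr_ge0;
    [apply: divr_ge0 => //; apply: divr_ge0|exact: sqr_ge0]].
have h2 : `|x| <= 1 + x ^+ 2.
  rewrite -(real_normK (num_real x)); have := normr_ge0 x.
  by move: `|x| => y y0; nra.
by rewrite (le_trans h2) ?lerDl.
Qed.

Lemma integrable_gauss_bounded e (f : R -> R) : 0 < e -> measurable_fun setT f ->
  (forall x, `|f x| <= 1) -> L1 L (fun x => gauss e x * f x).
Proof.
move=> e0 mf f1; apply: (le_integrable _ _ _ (integrable_gauss e0)) => //.
  by apply/measurable_EFinP; apply: measurable_funM => //; exact: measurable_gauss.
move=> x _ /=; rewrite lee_fin normrM ger0_norm ?gauss_ge0//.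
by rewrite ler_piMr ?gauss_ge0.
Qed.

Lemma integrable_xgauss_bounded e (f : R -> R) : 0 < e -> measurable_fun setT f ->
  (forall x, `|f x| <= 1) -> L1 L (fun x => x * gauss e x * f x).
Proof.
move=> e0 mf f1; have e20 : 0 < e / 2 by rewrite divr_gt0.
have := integrableZl measurableT (1 + 4 / e) (integrable_gauss e20).
apply: le_integrable => //.
  apply/measurable_EFinP; apply: measurable_funM => //.
  by apply: measurable_funM => //; exact: measurable_gauss.
move=> x _ /=; rewrite lee_fin 2!normrM (ger0_norm (gauss_ge0 _ _)).
rewrite [leRHS]ger0_norm; last first.
  by rewrite mulr_ge0 ?gauss_ge0// addr_ge0// divr_ge0// ltW.
rewrite (le_trans _ (ler_norm_gauss x e0))// ler_piMr ?mulr_ge0 ?gauss_ge0//.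
Qed.

Lemma measurable_cosM xi : measurable_fun setT (fun x => cos (xi * x)).
Proof.
apply: (measurableT_comp (continuous_measurable_fun (@continuous_cos R))).
exact: measurable_funM.
Qed.

Lemma measurable_sinM xi : measurable_fun setT (fun x => sin (xi * x)).
Proof.
apply: (measurableT_comp (continuous_measurable_fun (@continuous_sin R))).
exact: measurable_funM.
Qed.

Lemma norm_cos_le1 x : `|cos x| <= 1.
Proof. by rewrite ler_norml cos_geN1 cos_le1. Qed.

Lemma norm_sin_le1 x : `|sin x| <= 1.
Proof. by rewrite ler_norml sin_geN1 sin_le1. Qed.

Lemma integrable_gauss_cos e xi : 0 < e -> L1 L (fun x => gauss e x * cos (xi * x)).
Proof.
move=> e0; apply: integrable_gauss_bounded => // [|x];
  [exact: measurable_cosM|exact: norm_cos_le1].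
Qed.

Lemma integrable_gauss_sin e xi : 0 < e -> L1 L (fun x => gauss e x * sin (xi * x)).
Proof.
move=> e0; apply: integrable_gauss_bounded => // [|x];
  [exact: measurable_sinM|exact: norm_sin_le1].
Qed.

Lemma integrable_xgauss_sin e xi : 0 < e -> L1 L (fun x => x * gauss e x * sin (xi * x)).
Proof.
move=> e0; apply: integrable_xgauss_bounded => // [|x];
  [exact: measurable_sinM|exact: norm_sin_le1].
Qed.

End gaussian.

Lemma cvgMl0 (R : realType) (c : R) (u : nat -> R) : u n @[n --> \oo] --> (0 : R) -> c * u n @[n --> \oo] --> (0 : R).
Proof.
move=> h; rewrite -[(0 : R)](mulr0 c).
by apply: cvgM => //; exact: cvg_cst.
Qed.

(** * The Fourier transform of a Gaussian *)

Section gaussian_fourier.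
Context (R : realType).
Local Notation L := (@lebesgue_measure R).
Implicit Types (e x xi : R).

Let cgauss e xi : R := \int[L]_x (gauss e x * cos (xi * x)).

(** Carries the fundamental theorem of calculus from compact intervals to the whole line. *)
Let bigint (f : R -> R) : L1 L f ->
  (\int[L]_(x in `[(- n%:R)%R, n%:R]) f x) @[n --> \oo] --> \int[L]_x f x.
Proof.
move=> fi.
have mf := L1_measurable fi.
rewrite (_ : (fun n => _) = (fun n => \int[L]_x (f \_ `[(- n%:R)%R, n%:R]) x)); last first.
  by apply/funext => n; rewrite Rintegral_mkcond.
apply: (@dominated_cvg_Rintegral _ (measurableTypeR R) R L
  (fun n => f \_ `[(- n%:R)%R, n%:R]) f (fun x => `|f x|)).
- move=> n; have mI : measurable (`[(- n%:R)%R, n%:R]%classic : set (measurableTypeR R)).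
    exact: measurable_itv.
  by apply: (proj1 (measurable_restrictT f mI)); exact: measurable_funTS.
- exact: mf.
- apply: aeW => x; apply: cvg_near_cst.
  exists (Num.trunc `|x|).+1 => // n /= xn.
  rewrite patchE mem_set//= in_itv/= -ler_norml.
  by apply: le_trans (ltW (truncnS_gt _)) _; rewrite ler_nat.
- exact: (integrable_abse fi).
- by move=> n x; rewrite patchE; case: ifP; rewrite ?normr0.
Qed.

(** Reflection exchanges the positive and the negative part. If both have infinite integral, [fine]
    of their infinite difference is 0 as well. *)
Lemma Rintegral_odd (f : R -> R) : measurable_fun setT f ->
  (forall x, f (- x) = - f x) -> \int[L]_x f x = 0.
Proof.
move=> mf fN.
have mEf : measurable_fun setT (EFin \o f) by exact/measurable_EFinP.
rewrite /Rintegral integralE.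
have N1 : (-1 : R) != 0 by rewrite oppr_eq0.
have -> : (\int[L]_x (EFin \o f)^\+ x = \int[L]_x (EFin \o f)^\- x)%E.
  rewrite (@ge0_integral_affine R (-1) 0 N1 (EFin \o f)^\+%E)//; last exact: measurable_funepos.
  rewrite normrN1 mul1e; apply: eq_integral => x _.
  by rewrite mulN1r addr0 funeposE funenegE /= fN EFinN.
by case: (\int[L]_x _)%E => [r| |] //=; rewrite subrr.
Qed.

Let d_cgauss e xi : 0 < e -> is_derive xi 1 (cgauss e) (- \int[L]_x (x * gauss e x * sin (xi * x))).
Proof.
move=> e0.
have e20 : 0 < e / 2 by rewrite divr_gt0.
have D1 (y x : R) : is_derive y 1 (fun y : R => gauss e x * cos (y * x)) (- (x * gauss e x * sin (y * x))).
  have h := is_derive_cosM x y.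
  have h2 : is_derive y 1 ((gauss e x) \*: (fun z => cos (x * z))) (gauss e x *: (- x * sin (x * y))).
    exact: is_deriveZ.
  rewrite (_ : (fun y => _) = (gauss e x) \*: (fun z => cos (x * z))); last first.
    by apply/funext => z /=; rewrite [z * x]mulrC.
  by move: h2; rewrite (_ : _ *: _ = - (x * gauss e x * sin (y * x)))// /GRing.scale /= [y * x]mulrC; ring.
have Ixi : (`]xi - 1, xi + 1[%classic : set R) xi by rewrite /= in_itv/=; lra.
have H y : (`]xi - 1, xi + 1[%classic : set R) y ->
   L1 L (fun x => gauss e x * cos (y * x)).
  move=> _; exact: integrable_gauss_cos.
have dE y x : partial1of2 (fun y x => gauss e x * cos (y * x)) y x = - (x * gauss e x * sin (y * x)).
  by rewrite partial1of2E; have [_ ->] := D1 y x.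
(* A majorant of the derivative in [y], uniform in [y]: the sine is at most 1 in absolute value, and
   half of the Gaussian absorbs the factor [x]. *)
pose G x := (1 + 4 / e) * gauss (e / 2) x.
have G0 x : 0 <= G x.
  by rewrite mulr_ge0 ?gauss_ge0// addr_ge0// divr_ge0// ltW.
have Gi : L1 L G.
  by apply: L1Z; exact: integrable_gauss.
have GB y x : (`]xi - 1, xi + 1[%classic : set R) y -> setT x ->
    `|partial1of2 (fun y x => gauss e x * cos (y * x)) y x| <= G x.
  move=> _ _; rewrite dE normrN 2!normrM (ger0_norm (gauss_ge0 _ _)).
  by rewrite (le_trans _ (ler_norm_gauss x e0))// ler_piMr ?mulr_ge0 ?gauss_ge0// norm_sin_le1.
have DD y x : (`]xi - 1, xi + 1[%classic : set R) y -> setT x ->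
    derivable (fun y : R => gauss e x * cos (y * x)) y 1.
  by move=> _ _; have [] := D1 y x.
apply: DeriveDef.
  exact: (@derivable_under_integral R _ _ L _ setT measurableT xi _ _ Ixi H DD G G0 Gi GB).
rewrite -derive1E (@differentiation_under_integral R _ _ L _ setT measurableT xi _ _ Ixi H DD G G0 Gi GB).
rewrite -mulN1r -RintegralZl//; last first.
  exact: integrable_xgauss_sin.
by apply: eq_Rintegral => x _; rewrite dE mulN1r.
Qed.

(** Integration by parts: [D] is the derivative of [F], which vanishes at infinity, so [D] has
    integral 0. *)
Let ibp e xi : 0 < e ->
  e * \int[L]_x (x * gauss e x * sin (xi * x)) = xi * cgauss e xi.
Proof.
move=> e0.
pose F x := gauss e x * sin (xi * x).
pose D x := - (e * x) * gauss e x * sin (xi * x) + gauss e x * (xi * cos (xi * x)).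
have dF (x : R) : is_derive x 1 F (D x).
  have h := is_deriveM (is_derive_gauss e x) (is_derive_sinM xi x).
  rewrite (_ : F = gauss e * (fun y => sin (xi * y)))//; apply: is_derive_eq.
  by rewrite /D /GRing.scale /=; ring.
have i1 : L1 L (fun x => x * gauss e x * sin (xi * x)).
  exact: integrable_xgauss_sin.
have i2 : L1 L (fun x => gauss e x * cos (xi * x)).
  exact: integrable_gauss_cos.
have i1' : L1 L (fun x => - e * (x * gauss e x * sin (xi * x))).
  by apply: L1Z.
have i2' : L1 L (fun x => xi * (gauss e x * cos (xi * x))).
  by apply: L1Z.
have DE : D = fun x => - e * (x * gauss e x * sin (xi * x)) + xi * (gauss e x * cos (xi * x)).
  by apply/funext => x; rewrite /D; ring.
have Di : L1 L D.
  by rewrite DE; exact: L1D.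
have cgs : continuous (gauss e).
  by move=> x; apply: differentiable_continuous; apply/derivable1_diffP;
    have [] := is_derive_gauss e x.
have ccos : continuous (fun x => cos (xi * x)).
  by move=> x; apply: differentiable_continuous; apply/derivable1_diffP;
    have [] := is_derive_cosM xi x.
have csin : continuous (fun x => sin (xi * x)).
  by move=> x; apply: differentiable_continuous; apply/derivable1_diffP;
    have [] := is_derive_sinM xi x.
have cD : continuous D.
  move=> x; apply: cvgD.
    apply: cvgM; last exact: csin.
    apply: cvgM; last exact: cgs.
    by apply: cvgN; apply: cvgM; [exact: cvg_cst|exact: cvg_id].
  by apply: cvgM; [exact: cgs|apply: cvgM; [exact: cvg_cst|exact: ccos]].
have cF : continuous F by move=> x; apply: cvgM; [exact: cgs|exact: csin].
have ID0 : \int[L]_x D x = 0.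
  have C1 := bigint Di.
  suff C2 : \int[L]_(x in `[(- n%:R)%R, n%:R]) D x @[n --> \oo] --> (0 : R).
    by rewrite -(cvg_lim _ C1)// (cvg_lim _ C2).
  rewrite -(cvg_shiftn 1%N).
  (* [F] is odd, so the boundary values combine to twice the value at [n.+1]; the index is shifted
     because the interval must not be degenerate. *)
  rewrite (_ : (fun n => _) = (fun n => 2 * (gauss e n.+1%:R * sin (xi * n.+1%:R)))).
    suff H : gauss e n.+1%:R * sin (xi * n.+1%:R) @[n --> \oo] --> (0 : R).
      exact: cvgMl0.
    apply/norm_cvg0P.
    (* From [expR u >= u], the Gaussian at m = [n.+1] is at most (2 / e) / m^2, hence at most (2 /
       e) / m. *)
    apply: (@squeeze_cvgr _ _ _ _ (cst 0) (fun n => 2 / e * n.+1%:R^-1)).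
    - apply: nearW => n; rewrite normr_ge0 /= normrM ger0_norm ?gauss_ge0//.
      rewrite (@le_trans _ _ (gauss e n.+1%:R))//.
        by rewrite ler_piMr ?gauss_ge0// norm_sin_le1.
      rewrite /gauss expRN -[leRHS]invrK lef_pV2 ?posrE ?expR_gt0 ?invr_gt0 ?mulr_gt0 ?invr_gt0 ?divr_gt0//.
      apply: le_trans (expR_ge1Dx _); rewrite invfM invf_div invrK.
      rewrite ler_wpDl// ler_wpM2l ?divr_ge0 ?(ltW e0)//.
      by rewrite expr2 ler_peMl// ler1n.
    - exact: cvg_cst.
    - apply: cvgMl0; exact: cvg_harmonic.
  apply/funext => n; rewrite addn1.
  have nn : - n.+1%:R < n.+1%:R :> R by rewrite -subr_gt0 opprK addr_gt0.
  rewrite /Rintegral (@continuous_FTC2 _ D F)//=.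
  - by rewrite /F gaussN mulrN sinN mulrN opprK mulr2n mulrDl !mul1r.
  - exact: continuous_subspaceT.
  - split.
    + by move=> x _; have [] := dF x.
    + by apply: cvg_at_right_filter; exact: cF.
    + by apply: cvg_at_left_filter; exact: cF.
  - by move=> x _; rewrite derive1E; have [_ ->] := dF x.
move: ID0; rewrite DE RintegralD// RintegralZl// RintegralZl// mulNr.
by rewrite addrC => /eqP; rewrite subr_eq0 => /eqP <-.
Qed.

(** By [d_cgauss] and [ibp], the transform y solves y' = -(xi / e) y. Its product with
    [gauss (- e^-1)], the reciprocal of the expected Gaussian, therefore has derivative 0, and the
    value at 0 is the Gaussian integral. *)
Lemma gauss_cos e xi : 0 < e ->
  \int[L]_x (gauss e x * cos (xi * x)) = Num.sqrt (2 * pi / e) * gauss e^-1 xi.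
Proof.
move=> e0; have eN0 : e != 0 by rewrite gt_eqF.
pose H (z : R) := cgauss e z * gauss (- e^-1) z.
have dH (z : R) : is_derive z 1 H 0.
  have h := is_deriveM (d_cgauss z e0) (is_derive_gauss (- e^-1) z).
  rewrite (_ : H = cgauss e * gauss (- e^-1))//; apply: is_derive_eq.
  have -> : \int[L]_x (x * gauss e x * sin (z * x)) = e^-1 * (z * cgauss e z).
    by rewrite -ibp// mulrA mulVf ?mul1r.
  by rewrite /GRing.scale /=; field.
have := is_derive_0_is_cst xi 0 dH.
rewrite /H gauss0 mulr1 => E.
have -> : \int[L]_x (gauss e x * cos (xi * x)) = cgauss e xi * gauss (- e^-1) xi * gauss e^-1 xi.
  by rewrite -mulrA /gauss -expRD mulNr mulNr opprK subrr expR0 mulr1.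
rewrite E; congr (_ * _).
rewrite /cgauss -integral_gauss//; apply: eq_Rintegral => x _.
by rewrite mul0r cos0 mulr1.
Qed.

Lemma gauss_sin e xi : 0 < e -> \int[L]_x (gauss e x * sin (xi * x)) = 0.
Proof.
move=> e0; apply: Rintegral_odd => [|x].
  by apply: measurable_funM; [exact: measurable_gauss|exact: measurable_sinM].
by rewrite gaussN mulrN sinN mulrN.
Qed.

End gaussian_fourier.

(** * Gaussians on the plane and their Fourier transforms *)

Section plane_gaussian.
Context (R : realType).
Local Notation L := (@lebesgue_measure R).
Local Notation mu := (@pm R).
Implicit Types (e : R) (p q z : plane R).

Definition dot p q : R := p.1 * q.1 + p.2 * q.2.

Lemma dotC p q : dot p q = dot q p.
Proof. by rewrite /dot mulrC [p.2 * _]mulrC. Qed.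

Lemma dotDr p q z : dot p (q + z) = dot p q + dot p z.
Proof. by rewrite /dot /=; ring. Qed.

Lemma dotBr p q z : dot p (q - z) = dot p q - dot p z.
Proof. by rewrite /dot /=; ring. Qed.

Definition g2 e p : R := gauss e p.1 * gauss e p.2.

Lemma g2_ge0 e p : 0 <= g2 e p.
Proof. by rewrite mulr_ge0 ?gauss_ge0. Qed.

Lemma g2_le1 e p : 0 <= e -> g2 e p <= 1.
Proof. by move=> e0; rewrite mulr_ile1 ?gauss_ge0 ?gauss_le1. Qed.

Lemma measurable_g2 e : measurable_fun setT (g2 e).
Proof.
by apply: measurable_funM; apply: (measurableT_comp (measurable_gauss e)).
Qed.

Lemma measurable_dot : measurable_fun setT (fun z : plane R * plane R => dot z.1 z.2).
Proof.
apply: measurable_funD; apply: measurable_funM; apply: measurableT_comp => //.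
Qed.

Lemma measurable_dotr p : measurable_fun setT (dot p).
Proof. by apply: measurable_funD; apply: measurable_funM. Qed.

Lemma measurable_cos : measurable_fun setT (@cos R).
Proof. exact: continuous_measurable_fun (@continuous_cos R). Qed.

Lemma measurable_sin : measurable_fun setT (@sin R).
Proof. exact: continuous_measurable_fun (@continuous_sin R). Qed.

Lemma pm_integrable_prod (f h : R -> R) :
  L1 L f -> L1 L h ->
  L1 mu (fun p : plane R => f p.1 * h p.2).
Proof.
move=> fi hi; apply: (integrable_tensor fi hi) => [|x y /=]; last by rewrite normrM.
have mf := L1_measurable fi.
have mh := L1_measurable hi.
by apply: measurable_funM; [exact: (measurableT_comp mf)|exact: (measurableT_comp mh)].
Qed.

Lemma pm_Rintegral_prod (f h : R -> R) :
  L1 L f -> L1 L h ->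
  \int[mu]_p (f p.1 * h p.2) = (\int[L]_x f x) * \int[L]_x h x.
Proof.
move=> fi hi; have := pm_integrable_prod fi hi => i.
have := @Rfubini1 _ _ (measurableTypeR R) (measurableTypeR R) R L L _ i.
move=> /= <-; under eq_Rintegral do rewrite RintegralZl//.
by rewrite RintegralZr.
Qed.

Lemma integrable_g2 e : 0 < e -> L1 mu (g2 e).
Proof. by move=> e0; apply: pm_integrable_prod; exact: integrable_gauss. Qed.

Lemma Rintegral_g2 e : 0 < e -> \int[mu]_p g2 e p = 2 * pi / e.
Proof.
move=> e0; rewrite pm_Rintegral_prod ?integrable_gauss// integral_gauss//.
by rewrite -expr2 sqr_sqrtr// divr_ge0 ?mulr_ge0 ?pi_ge0// ltW.
Qed.

Lemma integrable_mul_bounded (f h : plane R -> R) :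
  L1 mu f -> measurable_fun setT h ->
  (forall p, `|h p| <= 1) -> L1 mu (fun p => f p * h p).
Proof.
move=> fi mh h1.
have mf := L1_measurable fi.
apply: (le_integrable _ _ _ fi) => //.
  by apply/measurable_EFinP; apply: measurable_funM.
by move=> x _ /=; rewrite lee_fin normrM ler_piMr.
Qed.

Lemma g2_cos e z : 0 < e ->
  \int[mu]_q (g2 e q * cos (dot z q)) = 2 * pi / e * g2 e^-1 z.
Proof.
move=> e0.
have ic y := integrable_gauss_cos y e0; have js y := integrable_gauss_sin y e0.
transitivity (\int[mu]_q ((gauss e q.1 * cos (z.1 * q.1)) * (gauss e q.2 * cos (z.2 * q.2))
    - (gauss e q.1 * sin (z.1 * q.1)) * (gauss e q.2 * sin (z.2 * q.2)))).
  by apply: eq_Rintegral => q _; rewrite /dot cosD /g2; ring.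
rewrite RintegralB//; last 2 first.
- exact: (pm_integrable_prod (ic _) (ic _)).
- exact: (pm_integrable_prod (js _) (js _)).
rewrite (pm_Rintegral_prod (ic _) (ic _)) (pm_Rintegral_prod (js _) (js _)) !gauss_cos// !gauss_sin//.
rewrite mulr0 subr0 /g2 mulrACA -expr2 sqr_sqrtr// divr_ge0 ?mulr_ge0 ?pi_ge0// ltW//.
Qed.

Lemma g2_sin e z : 0 < e -> \int[mu]_q (g2 e q * sin (dot z q)) = 0.
Proof.
move=> e0.
have ic y := integrable_gauss_cos y e0; have js y := integrable_gauss_sin y e0.
transitivity (\int[mu]_q ((gauss e q.1 * sin (z.1 * q.1)) * (gauss e q.2 * cos (z.2 * q.2))
    + (gauss e q.1 * cos (z.1 * q.1)) * (gauss e q.2 * sin (z.2 * q.2)))).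
  by apply: eq_Rintegral => q _; rewrite /dot sinD /g2; ring.
rewrite RintegralD//; last 2 first.
- exact: (pm_integrable_prod (js _) (ic _)).
- exact: (pm_integrable_prod (ic _) (js _)).
rewrite (pm_Rintegral_prod (js _) (ic _)) (pm_Rintegral_prod (ic _) (js _)) !gauss_sin//.
by rewrite mul0r mulr0 addr0.
Qed.

End plane_gaussian.

Lemma ge0_integralZ_EFin d (T : measurableType d) (R : realType)
    (m : {measure set T -> \bar R}) (f : T -> R) (k : R) :
  measurable_fun setT f -> (forall x, 0 <= f x) -> 0 <= k ->
  (\int[m]_x (k * f x)%:E = k%:E * \int[m]_x (f x)%:E)%E.
Proof.
move=> mf f0 k0; under eq_integral do rewrite EFinM.
by apply: ge0_integralZl => //; [exact/measurable_EFinP|move=> x _; rewrite lee_fin].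
Qed.

(** * Schur's test *)

Section schur.
Context d1 d2 (T1 : measurableType d1) (T2 : measurableType d2) (R : realType).
Variable m1 : {sigma_finite_measure set T1 -> \bar R}.
Variable m2 : {sigma_finite_measure set T2 -> \bar R}.

(** [|A x * B y|] is at most [A x ^+ 2 + B y ^+ 2], and each square is integrated against the kernel
    in the other variable first. *)
Lemma schur (K : T1 * T2 -> R) (A : T1 -> R) (B : T2 -> R) (M : R) :
  measurable_fun setT K -> (forall z, 0 <= K z) ->
  measurable_fun setT A -> measurable_fun setT B ->
  (forall x, \int[m2]_y (K (x, y))%:E <= M%:E)%E ->
  (forall y, \int[m1]_x (K (x, y))%:E <= M%:E)%E ->
  (\int[m1]_x \int[m2]_y (`|A x * B y * K (x, y)|)%:E <=
   M%:E * (\int[m1]_x (A x ^+ 2)%:E + \int[m2]_y (B y ^+ 2)%:E))%E.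
Proof.
move=> mK K0 mA mB K1 K2.
pose f1 (z : T1 * T2) := (A z.1 ^+ 2 * K z)%:E.
pose f2 (z : T1 * T2) := (B z.2 ^+ 2 * K z)%:E.
pose f0 (z : T1 * T2) := (`|A z.1 * B z.2 * K z|)%:E.
have mA1 : measurable_fun setT (fun z : T1 * T2 => A z.1) by exact: (measurableT_comp mA).
have mB2 : measurable_fun setT (fun z : T1 * T2 => B z.2) by exact: (measurableT_comp mB).
have mf1 : measurable_fun setT f1.
  by apply/measurable_EFinP; apply: measurable_funM => //; apply: measurable_funX.
have mf2 : measurable_fun setT f2.
  by apply/measurable_EFinP; apply: measurable_funM => //; apply: measurable_funX.
have mf0 : measurable_fun setT f0.
  apply/measurable_EFinP; apply: measurableT_comp => //.
  by apply: measurable_funM => //; apply: measurable_funM.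
have f10 z : (0 <= f1 z)%E by rewrite lee_fin mulr_ge0 ?sqr_ge0.
have f20 z : (0 <= f2 z)%E by rewrite lee_fin mulr_ge0 ?sqr_ge0.
have f00 z : (0 <= f0 z)%E by rewrite lee_fin.
have M0 : (0 <= M%:E)%E.
  by apply: le_trans (K1 point); apply: integral_ge0 => y _; rewrite lee_fin.
apply: (@le_trans _ _ (\int[m1]_x \int[m2]_y (f1 (x, y) + f2 (x, y)))%E).
  apply: ge0_le_integral => //.
  - by move=> x _; exact: integral_ge0.
  - exact: (measurable_fun_fubini_tonelli_F f0).
  - apply: (measurable_fun_fubini_tonelli_F (f1 \+ f2)%E).
      exact: emeasurable_funD.
    by move=> z; rewrite adde_ge0.
  - move=> x _; apply: ge0_le_integral => //.
    + exact: (measurable_fun_pair2 x mf0).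
    + by apply: emeasurable_funD; exact: measurable_fun_pair2.
    + move=> y _; rewrite /f1 /f2 -EFinD lee_fin /= -mulrDl normrM (ger0_norm (K0 _)).
      rewrite ler_wpM2r//; set u := A x; set v := B y; rewrite ler_norml.
      by apply/andP; split; nra.
have -> : (\int[m1]_x \int[m2]_y (f1 (x, y) + f2 (x, y)) =
    \int[m1]_x \int[m2]_y f1 (x, y) + \int[m1]_x \int[m2]_y f2 (x, y))%E.
  rewrite -ge0_integralD//; last 4 first.
  - by move=> x _; exact: integral_ge0.
  - exact: (measurable_fun_fubini_tonelli_F f1).
  - by move=> x _; exact: integral_ge0.
  - exact: (measurable_fun_fubini_tonelli_F f2).
  by apply: eq_integral => x _; rewrite ge0_integralD//; exact: measurable_fun_pair2.
rewrite ge0_muleDr ?integral_ge0//; last 2 first.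
- by move=> x _; rewrite lee_fin sqr_ge0.
- by move=> x _; rewrite lee_fin sqr_ge0.
apply: leeD.
- rewrite -ge0_integralZl//; last 2 first.
  + exact: measurable_sqr.
  + by move=> x _; rewrite lee_fin sqr_ge0.
  apply: ge0_le_integral => //.
  + by move=> x _; exact: integral_ge0.
  + exact: (measurable_fun_fubini_tonelli_F f1).
  + by apply/measurable_EFinP; apply: measurable_funM => //; apply: measurable_funX.
  + move=> x _; rewrite /f1 /=.
    rewrite (ge0_integralZ_EFin m2 (measurable_fun_pair2 x mK) (fun y => K0 (x, y)) (sqr_ge0 _)).
    by rewrite muleC lee_wpmul2r// lee_fin sqr_ge0.
- have E := etrans (esym (fubini_tonelli1 f2 mf2 f20)) (fubini_tonelli2 f2 mf2 f20).
  rewrite [X in (X <= _)%E]E.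
  rewrite -ge0_integralZl//; last 2 first.
  + exact: measurable_sqr.
  + by move=> x _; rewrite lee_fin sqr_ge0.
  apply: ge0_le_integral => //.
  + by move=> x _; exact: integral_ge0.
  + exact: (measurable_fun_fubini_tonelli_G f2).
  + by apply/measurable_EFinP; apply: measurable_funM => //; apply: measurable_funX.
  + move=> y _; rewrite /fubini_G /f2 /=.
    rewrite (ge0_integralZ_EFin m1 (measurable_fun_pair1 y mK) (fun x => K0 (x, y)) (sqr_ge0 _)).
    by rewrite muleC lee_wpmul2r// lee_fin sqr_ge0.
Qed.

End schur.

(** * Cosine and sine transforms of integrable functions *)

Section plancherel.
Context (R : realType).
Local Notation mu := (@pm R).
Implicit Types (p q y : plane R).

(** With [sin_tr], the real and imaginary parts of the integral of A(q) e^(i y.q) for a real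
    function [A]. *)
Definition cos_tr (A : plane R -> R) y : R := \int[mu]_q (A q * cos (dot y q)).
Definition sin_tr (A : plane R -> R) y : R := \int[mu]_q (A q * sin (dot y q)).

Definition normL1 (A : plane R -> R) : R := \int[mu]_q `|A q|.

Variable A : plane R -> R.
Hypothesis Ai : L1 mu A.

Let mA : measurable_fun setT A.
Proof. exact: L1_measurable Ai. Qed.

Lemma measurable_cdot y : measurable_fun setT (fun q => cos (dot y q)).
Proof. exact: measurableT_comp (@measurable_cos R) (measurable_dotr y). Qed.

Lemma measurable_sdot y : measurable_fun setT (fun q => sin (dot y q)).
Proof. exact: measurableT_comp (@measurable_sin R) (measurable_dotr y). Qed.

Lemma measurable_cdot2 :
  measurable_fun setT (fun z : plane R * plane R => cos (dot z.1 z.2)).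
Proof. exact: measurableT_comp (@measurable_cos R) (@measurable_dot R). Qed.

Lemma measurable_sdot2 :
  measurable_fun setT (fun z : plane R * plane R => sin (dot z.1 z.2)).
Proof. exact: measurableT_comp (@measurable_sin R) (@measurable_dot R). Qed.

Lemma integrable_cdot y : L1 mu (fun q => A q * cos (dot y q)).
Proof.
by apply: integrable_mul_bounded => // [|q]; [exact: measurable_cdot|exact: norm_cos_le1].
Qed.

Lemma integrable_sdot y : L1 mu (fun q => A q * sin (dot y q)).
Proof.
by apply: integrable_mul_bounded => // [|q]; [exact: measurable_sdot|exact: norm_sin_le1].
Qed.

Lemma measurable_cos_tr : measurable_fun setT (cos_tr A).
Proof.
apply: (measurable_Rintegral_param mu
  (f := fun z : plane R * plane R => A z.2 * cos (dot z.1 z.2))).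
by apply: measurable_funM; [exact: (measurableT_comp mA)|exact: measurable_cdot2].
Qed.

Lemma measurable_sin_tr : measurable_fun setT (sin_tr A).
Proof.
apply: (measurable_Rintegral_param mu
  (f := fun z : plane R * plane R => A z.2 * sin (dot z.1 z.2))).
by apply: measurable_funM; [exact: (measurableT_comp mA)|exact: measurable_sdot2].
Qed.

Lemma norm_cos_tr y : `|cos_tr A y| <= normL1 A.
Proof.
have iy := integrable_cdot y.
apply: (le_trans (le_normr_Rintegral measurableT iy)).
apply: le_Rintegral => //; [exact: (integrable_abse iy)|exact: (integrable_abse Ai)|].
by move=> q _; rewrite normrM ler_piMr// norm_cos_le1.
Qed.

Lemma norm_sin_tr y : `|sin_tr A y| <= normL1 A.
Proof.
have iy := integrable_sdot y.
apply: (le_trans (le_normr_Rintegral measurableT iy)).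
apply: le_Rintegral => //; [exact: (integrable_abse iy)|exact: (integrable_abse Ai)|].
by move=> q _; rewrite normrM ler_piMr// norm_sin_le1.
Qed.

End plancherel.

(** * Plancherel's inequality *)

Section plancherel_inequality.
Context (R : realType).
Local Notation mu := (@pm R).
Implicit Types (p q y : plane R).
Variable A : plane R -> R.
Hypothesis Ai : L1 mu A.

Let mA : measurable_fun setT A.
Proof. exact: L1_measurable Ai. Qed.

(** The transform of the damping factor [g2 d], by [g2_cos]: a Gaussian kernel of total mass (2
    pi)^2, whatever [d] is. *)
Let kk d (q : plane R) : R := 2 * pi / d * g2 d^-1 q.

Let kk_ge0 d q : 0 < d -> 0 <= kk d q.
Proof. by move=> d0; rewrite mulr_ge0 ?g2_ge0// divr_ge0 ?mulr_ge0 ?pi_ge0// ltW. Qed.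

Let kk_le d q : 0 < d -> `|kk d q| <= `|2 * pi / d|.
Proof.
move=> d0; rewrite /kk normrM ler_piMr// ger0_norm ?g2_ge0// g2_le1// invr_ge0 ltW//.
Qed.

Let measurable_kk d : measurable_fun setT (kk d).
Proof. by apply: measurable_funM => //; exact: measurable_g2. Qed.

Let integral_kk d : 0 < d -> (\int[mu]_q (kk d q)%:E = ((2 * pi) ^+ 2)%:E)%E.
Proof.
move=> d0; have dN0 : 0 < d^-1 by rewrite invr_gt0.
rewrite ge0_integralZ_EFin//; [|exact: measurable_g2|by move=> q; exact: g2_ge0
  |by rewrite divr_ge0 ?mulr_ge0 ?pi_ge0// ltW].
have := Rintegral_g2 dN0; rewrite /Rintegral.
have := integrable_fin_num measurableT (integrable_g2 dN0).
case: (\int[mu]_q (g2 d^-1 q)%:E)%E => // r _ /= ->.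
by rewrite -EFinM invrK; congr EFin; field; rewrite gt_eqF.
Qed.

Let C := cos_tr A.
Let S := sin_tr A.
Let N := normL1 A.

Let N0 : 0 <= N. Proof. by apply: Rintegral_ge0. Qed.

Let CS_expand y : C y ^+ 2 + S y ^+ 2 =
  \int[mu]_q (A q * (cos (dot y q) * C y + sin (dot y q) * S y)).
Proof.
transitivity (\int[mu]_q (C y * (A q * cos (dot y q)) + S y * (A q * sin (dot y q)))).
  have i1 := integrable_cdot Ai y; have i2 := integrable_sdot Ai y.
  have i1' : L1 mu (fun q => C y * (A q * cos (dot y q))).
    by apply: L1Z.
  have i2' : L1 mu (fun q => S y * (A q * sin (dot y q))).
    by apply: L1Z.
  by rewrite RintegralD// !RintegralZl// !expr2.
by apply: eq_Rintegral => q _; ring.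
Qed.

Let norm_CS y q : `|cos (dot y q) * C y + sin (dot y q) * S y| <= 2 * N.
Proof.
rewrite (le_trans (ler_normD _ _))// mulr_natl mulr2n lerD// normrM.
  by rewrite -[leRHS]mul1r ler_pM// ?norm_cos_le1// norm_cos_tr.
by rewrite -[leRHS]mul1r ler_pM// ?norm_sin_le1// norm_sin_tr.
Qed.

Let mC : measurable_fun setT C. Proof. exact: measurable_cos_tr. Qed.
Let mS : measurable_fun setT S. Proof. exact: measurable_sin_tr. Qed.

(** The real part of the damped inverse Fourier integral, at [q], of the transform [C + i S] of
    [A]. *)
Let B d q := \int[mu]_y (g2 d y * (cos (dot y q) * C y + sin (dot y q) * S y)).

(** Thanks to the damping the double integral converges absolutely, and integrating in [y] first
    turns [g2 d] into its transform [kk d]. *)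
Let B_conv d q : 0 < d -> B d q = \int[mu]_q' (A q' * kk d (q - q')).
Proof.
move=> d0.
pose f (z : plane R * plane R) := g2 d z.1 * A z.2 * cos (dot z.1 (q - z.2)).
have mf : measurable_fun setT f.
  apply: measurable_funM.
    by apply: measurable_funM; [exact: (measurableT_comp (measurable_g2 d))|
      exact: (measurableT_comp mA)].
  apply: (measurableT_comp (@measurable_cos R)).
  rewrite (_ : (fun _ => _) = (fun z : plane R * plane R => dot q z.1 - dot z.1 z.2)).
    apply: measurable_funB; last exact: measurable_dot.
    exact: (measurableT_comp (measurable_dotr q)).
  by apply/funext => z; rewrite dotBr dotC.
have fi : L1 (mu \x mu)%E f.
  apply: (integrable_tensor (integrable_g2 d0) Ai mf) => x y /=.
  by rewrite 2!normrM ler_piMr ?norm_cos_le1// mulr_ge0.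
transitivity (\int[mu]_y \int[mu]_q' f (y, q')).
  apply: eq_Rintegral => y _; rewrite /f /=.
  transitivity (\int[mu]_q' (g2 d y * cos (dot y q) * (A q' * cos (dot y q')) +
     g2 d y * sin (dot y q) * (A q' * sin (dot y q')))).
    have i1 := integrable_cdot Ai y; have i2 := integrable_sdot Ai y.
    rewrite RintegralD//; last 2 first.
    - by apply: L1Z.
    - by apply: L1Z.
    by rewrite (RintegralZl _ measurableT i1) (RintegralZl _ measurableT i2) mulrDr !mulrA.
  by apply: eq_Rintegral => q' _; rewrite dotBr cosB; ring.
rewrite (Rfubini fi); apply: eq_Rintegral => q' _; rewrite /f /=.
transitivity (\int[mu]_y (A q' * (g2 d y * cos (dot (q - q') y)))).
  by apply: eq_Rintegral => y _; rewrite dotC; ring.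
rewrite RintegralZl//; last exact: (integrable_cdot (integrable_g2 d0)).
by rewrite g2_cos.
Qed.

Let J d := \int[mu]_y (g2 d y * (C y ^+ 2 + S y ^+ 2)).

Let J_conv d : 0 < d -> J d = \int[mu]_q (A q * B d q).
Proof.
move=> d0.
pose f (z : plane R * plane R) :=
  g2 d z.1 * A z.2 * (cos (dot z.1 z.2) * C z.1 + sin (dot z.1 z.2) * S z.1).
have mC1 : measurable_fun setT (fun z : plane R * plane R => C z.1) by exact: (measurableT_comp mC).
have mS1 : measurable_fun setT (fun z : plane R * plane R => S z.1) by exact: (measurableT_comp mS).
have mf : measurable_fun setT f.
  apply: measurable_funM.
    by apply: measurable_funM; [exact: (measurableT_comp (measurable_g2 d))|
      exact: (measurableT_comp mA)].
  apply: measurable_funD; apply: measurable_funM => //;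
    [exact: measurable_cdot2|exact: measurable_sdot2].
have gi : L1 mu (fun y => 2 * N * g2 d y).
  by apply: L1Z; exact: integrable_g2.
have fi : L1 (mu \x mu)%E f.
  apply: (integrable_tensor gi Ai mf) => y q /=.
  rewrite 2!normrM [in leRHS]normrM mulrC [in leRHS]mulrAC -[leRHS]mulrA [`|2 * N|]ger0_norm ?mulr_ge0//.
  by rewrite [`|A q| * _]mulrC ler_wpM2r ?mulr_ge0.
transitivity (\int[mu]_y \int[mu]_q f (y, q)).
  apply: eq_Rintegral => y _; rewrite CS_expand -RintegralZl//.
    by apply: eq_Rintegral => q _; rewrite /f /= mulrA.
  have i1 := integrable_cdot Ai y; have i2 := integrable_sdot Ai y.
  rewrite (_ : _ \o _ = fun x => (C y)%:E * (A x * cos (dot y x))%:E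
     + (S y)%:E * (A x * sin (dot y x))%:E)%E.
    by apply: integrableD => //; apply: integrableZl.
  by apply/funext => x /=; rewrite -!EFinM -EFinD; congr EFin; ring.
rewrite (Rfubini fi); apply: eq_Rintegral => q _; rewrite -RintegralZl//.
  by apply: eq_Rintegral => y _; rewrite /f /=; ring.
have := gi; apply: le_integrable => //.
  apply/measurable_EFinP; apply: measurable_funM; first exact: measurable_g2.
  apply: measurable_funD; apply: measurable_funM => //.
    apply: (measurableT_comp (@measurable_cos R)).
    by rewrite (_ : (fun _ => _) = dot q); [exact: measurable_dotr|apply/funext => y; exact: dotC].
  apply: (measurableT_comp (@measurable_sin R)).
  by rewrite (_ : (fun _ => _) = dot q); [exact: measurable_dotr|apply/funext => y; exact: dotC].
move=> y _ /=; rewrite lee_fin normrM [leRHS]normrM mulrC (ger0_norm (_ : 0 <= 2 * N)) ?mulr_ge0//.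
by rewrite ler_wpM2r.
Qed.

(** [J d] is the quadratic form of [A] with kernel [kk d (q - q')]. The integral of this kernel in
    either variable is (2 pi)^2, so Schur's test gives a bound uniform in [d]. *)
Let J_le d : 0 < d ->
  ((J d)%:E <= ((2 * pi) ^+ 2)%:E * (\int[mu]_q (A q ^+ 2)%:E + \int[mu]_q (A q ^+ 2)%:E))%E.
Proof.
move=> d0.
pose K (z : plane R * plane R) := kk d (z.1 - z.2).
have mK : measurable_fun setT K.
  apply: (measurableT_comp (measurable_kk d)).
  by apply/measurable_fun_pairP; split; apply: measurable_funB; apply: measurableT_comp.
have K1 q : (\int[mu]_q' (K (q, q'))%:E <= ((2 * pi) ^+ 2)%:E)%E.
  rewrite /K /= (ge0_integral_refl q (f := fun p => (kk d p)%:E)) ?integral_kk//.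
    by apply/measurable_EFinP.
  by move=> p; rewrite lee_fin kk_ge0.
have K2 q' : (\int[mu]_q (K (q, q'))%:E <= ((2 * pi) ^+ 2)%:E)%E.
  rewrite /K /= (ge0_integral_shift (- q') (f := fun p => (kk d p)%:E)) ?integral_kk//.
    by apply/measurable_EFinP.
  by move=> p; rewrite lee_fin kk_ge0.
have K0 z : 0 <= K z by exact: kk_ge0.
apply: le_trans (schur mK K0 mA mA K1 K2).
have AAi : L1 (mu \x mu)%E (fun z : plane R * plane R => A z.1 * A z.2 * K z).
  have Ai' : L1 mu (fun q => 2 * pi / d * A q).
    by apply: L1Z.
  apply: (integrable_tensor Ai' Ai).
    by apply: measurable_funM => //; apply: measurable_funM; exact: (measurableT_comp mA).
  have aux (a b k c : R) : `|k| <= `|c| -> `|a * b * k| <= `|c * a| * `|b|.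
    by move=> kc; rewrite !normrM mulrC mulrA ler_wpM2r// ler_wpM2r.
  move=> q q' /=; apply: aux.
  exact: kk_le.
rewrite J_conv//.
have -> : \int[mu]_q (A q * B d q) = \int[mu]_q \int[mu]_q' (A q * A q' * K (q, q')).
  apply: eq_Rintegral => q _; rewrite B_conv// -RintegralZl//.
    by apply: eq_Rintegral => q' _; rewrite /K /= mulrA.
  have : L1 mu (fun q' => 2 * pi / d * A q').
    by apply: L1Z.
  apply: le_integrable => //.
    apply/measurable_EFinP; apply: measurable_funM => //.
    exact: (measurable_fun_pair2 q mK).
  move=> q' _ /=; rewrite lee_fin normrM [leRHS]normrM mulrC ler_wpM2r//.
  exact: kk_le.
rewrite (Rfubini1 AAi).
have -> : (\int[mu]_x \int[mu]_y (`|A x * A y * K (x, y)|)%:E =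
    \int[(mu \x mu)%E]_z (`|A z.1 * A z.2 * K z|)%:E)%E.
  rewrite (fubini_tonelli1 (fun z : plane R * plane R => (`|A z.1 * A z.2 * K z|)%:E))//.
  have := measurable_int _ AAi; move=> /measurable_EFinP h.
  by apply/measurable_EFinP; exact: measurableT_comp.
rewrite (le_trans (_ : _ <= (`|\int[(mu \x mu)%E]_z (A z.1 * A z.2 * K z)|)%:E)%E) ?lee_fin ?ler_norm//.
rewrite EFin_normr_Rintegral//; apply: le_abse_integral => //.
exact: measurable_int AAi.
Qed.

(** [J_le] bounds the damped integrals uniformly, and Fatou's lemma removes the damping as its
    parameter tends to 0. The factor 2 is the loss in [schur], where both squares appear. *)
Lemma plancherel_le :
  (\int[mu]_y (cos_tr A y ^+ 2 + sin_tr A y ^+ 2)%:E <=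
   (2 * (2 * pi) ^+ 2)%:E * \int[mu]_q (A q ^+ 2)%:E)%E.
Proof.
pose dd n : R := n.+1%:R^-1.
have dd0 n : 0 < dd n by rewrite invr_gt0.
apply: (@fatou_bound _ _ _ mu (fun n y => g2 (dd n) y * (C y ^+ 2 + S y ^+ 2))).
- move=> n; apply: measurable_funM; first exact: measurable_g2.
  by apply: measurable_funD; apply: measurable_funX.
- by apply: measurable_funD; apply: measurable_funX.
- by move=> n y; rewrite mulr_ge0 ?g2_ge0// addr_ge0 ?sqr_ge0.
- apply: aeW => y; rewrite -[X in _ --> X]mul1r.
  apply: cvgM; last exact: cvg_cst.
  have h (x : R) : gauss (dd n) x @[n --> \oo] --> (1 : R).
    rewrite -expR0; apply: continuous_cvg; first exact: continuous_expR.
    rewrite -oppr0; apply: cvgN.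
    rewrite (_ : (fun n => _) = (fun n => (2^-1 * x ^+ 2) * dd n)).
      by apply: cvgMl0; exact: cvg_harmonic.
    by apply/funext => n; ring.
  by rewrite -[X in _ --> X]mul1r; apply: cvgM; exact: h.
- move=> n; have := J_le (dd0 n); rewrite -mule2n -mule_natl muleA -EFinM mulrC => JM.
  apply: le_trans JM.
  have i : L1 mu (fun y => g2 (dd n) y * (C y ^+ 2 + S y ^+ 2)).
    have : L1 mu (fun y => 2 * N ^+ 2 * g2 (dd n) y).
      by apply: L1Z; exact: integrable_g2.
    apply: le_integrable => //.
      apply/measurable_EFinP; apply: measurable_funM; first exact: measurable_g2.
      by apply: measurable_funD; apply: measurable_funX.
    move=> y _ /=; rewrite lee_fin normrM [leRHS]normrM mulrC ler_wpM2r//.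
    rewrite ger0_norm ?addr_ge0 ?sqr_ge0// ger0_norm ?mulr_ge0 ?sqr_ge0//.
    rewrite mulr_natl mulr2n lerD// -[leLHS]real_normK ?num_real// ler_sqr ?nnegrE//.
      exact: norm_cos_tr.
    exact: norm_sin_tr.
  by rewrite /J /Rintegral fineK//; exact: integrable_fin_num.
Qed.

End plancherel_inequality.

(** * Dynkin systems and functions with vanishing integrals *)

Section dynkin.
Context d d' (T : measurableType d) (T' : measurableType d') (R : realType).
Variable m : {measure set T -> \bar R}.

(** The sets whose preimage carries integral 0 form a Dynkin system. The map [pi] will be a
    coordinate projection, to vary one side of a rectangle, or the identity. *)
Lemma integral_preimage_eq0 (G : set (set T')) (pi : T -> T') (D : set T) (f : T -> \bar R) :
  measurable_fun setT pi -> measurable D -> m.-integrable D f ->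
  @measurable _ T' = <<s G >> -> setI_closed G ->
  (\int[m]_(x in D) f x = 0)%E ->
  (forall S, G S -> \int[m]_(x in pi @^-1` S `&` D) f x = 0)%E ->
  forall S, measurable S -> (\int[m]_(x in pi @^-1` S `&` D) f x = 0)%E.
Proof.
move=> mpi mD fi mG GI D0 G0.
have mpre S : measurable S -> measurable (pi @^-1` S `&` D).
  by move=> mS; apply: measurableI => //; rewrite -[X in measurable X]setTI; exact: mpi.
have fS A : measurable A -> A `<=` D -> m.-integrable A f.
  by move=> mA AD; exact: integrableS fi.
suff H : forall S, <<s G >> S -> (\int[m]_(x in pi @^-1` S `&` D) f x = 0)%E.
  by move=> S; rewrite mG; exact: H.
apply: (dynkin_induction mG) => //.
- by rewrite preimage_setT setTI.
- move=> S mS S0; have mSC := mpre _ (measurableC mS).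
  have := D0; have DE : D = (pi @^-1` S `&` D) `|` (pi @^-1` (~` S) `&` D).
    by rewrite -setIUl -preimage_setU setUv preimage_setT setTI.
  rewrite [in X in X -> _]DE integral_setU//; last 3 first.
  - exact: mpre.
  - by rewrite -DE; exact: measurable_int fi.
  - apply/disj_setPS => x [[/= Sx _] [/= nSx _]]; exact: nSx.
  by rewrite S0 add0e.
- move=> F mF tF F0; rewrite preimage_bigcup setI_bigcupl integral_bigcup//.
  + by rewrite eseries0// => i _ _; exact: F0.
  + apply/trivIsetP => i j _ _ ij; move/trivIsetP : tF => /(_ i j I I ij) FF.
    by rewrite setIACA -preimage_setI FF preimage_set0 set0I.
  + by move=> k; exact: mpre.
  + apply: fS; first by apply: bigcup_measurable => k _; exact: mpre.
    by move=> x [k _ []].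
Qed.

End dynkin.

(** * Functions whose integrals over rectangles vanish *)

Section rectangles.
Context (R : realType).
Local Notation mu := (@pm R).

Let box (N : nat) : set (measurableTypeR R) := `](- N%:R)%R, N%:R]%classic.

(** The work is done inside a bounded box, where [f] is integrable. There the integrals over all
    measurable sets vanish, so [f] is 0 almost everywhere in the box, and countably many boxes cover
    the plane. *)
Lemma ae_eq0_rectangles (f : plane R -> R) :
  measurable_fun setT f ->
  (forall X Y, ocitv X -> ocitv Y ->
    mu.-integrable (X `*` Y) (EFin \o f) /\
    \int[mu]_(p in X `*` Y) (f p)%:E = 0)%E ->
  {ae mu, forall p, f p = 0}.
Proof.
move=> mf f0.
have ob N : ocitv (box N) by exact: is_ocitv.
have mo (X : set (measurableTypeR R)) : ocitv X -> measurable X.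
  by move=> oX; apply: sub_sigma_algebra.
have mXY (X Y : set (measurableTypeR R)) : measurable X -> measurable Y ->
  measurable (X `*` Y : set (plane R)) by exact: measurableX.
(* The first side is freed from being an interval, then the second one in [stepB], then the product
   shape in [stepC]. *)
have stepA N (A Y : set (measurableTypeR R)) : measurable A -> ocitv Y ->
    (\int[mu]_(p in (A `&` box N) `*` (Y `&` box N)) (f p)%:E = 0)%E.
  move=> mA oY.
  have oYN : ocitv (Y `&` box N) by exact: ocitvI.
  have [i1 e1] := f0 _ _ (ob N) oYN.
  have := @integral_preimage_eq0 _ _ (plane R) (measurableTypeR R) R mu (@ocitv R) fst
    (box N `*` (Y `&` box N)) (EFin \o f) measurable_fst
    (mXY _ _ (mo _ (ob N)) (mo _ oYN)) i1 erefl (@ocitvI R) e1.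
  rewrite (_ : (A `&` box N) `*` (Y `&` box N) = fst @^-1` A `&` (box N `*` (Y `&` box N))).
    apply => // X oX.
    have -> : fst @^-1` X `&` (box N `*` (Y `&` box N)) = (X `&` box N) `*` (Y `&` box N).
      by apply/seteqP; split => -[x y] /=; tauto.
    have oXN : ocitv (X `&` box N) by exact: ocitvI.
    by have [_ ->] := f0 _ _ oXN oYN.
  by apply/seteqP; split => -[x y] /=; tauto.
have stepB N (A B : set (measurableTypeR R)) : measurable A -> measurable B ->
    (\int[mu]_(p in (A `&` box N) `*` (B `&` box N)) (f p)%:E = 0)%E.
  move=> mA mB.
  have mAN : measurable (A `&` box N) by apply: measurableI => //; exact: mo.
  have [i1 e1] := f0 _ _ (ob N) (ob N).
  have i2 : mu.-integrable ((A `&` box N) `*` box N) (EFin \o f).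
    apply: integrableS i1; [by apply: mXY; exact: mo|by apply: mXY => //; exact: mo|].
    by move=> -[x y] /=; tauto.
  have e2 : (\int[mu]_(p in (A `&` box N) `*` box N) (f p)%:E = 0)%E.
    by have := stepA N A _ mA (ob N); rewrite setIid.
  have := @integral_preimage_eq0 _ _ (plane R) (measurableTypeR R) R mu (@ocitv R) snd
    ((A `&` box N) `*` box N) (EFin \o f) measurable_snd
    (mXY _ _ mAN (mo _ (ob N))) i2 erefl (@ocitvI R) e2.
  rewrite (_ : (A `&` box N) `*` (B `&` box N) = snd @^-1` B `&` ((A `&` box N) `*` box N)).
    apply => // X oX.
    have -> : snd @^-1` X `&` ((A `&` box N) `*` box N) = (A `&` box N) `*` (X `&` box N).
      by apply/seteqP; split => -[x y] /=; tauto.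
    exact: stepA.
  by apply/seteqP; split => -[x y] /=; tauto.
have stepC N (E : set (plane R)) : measurable E ->
    (\int[mu]_(p in E `&` (box N `*` box N)) (f p)%:E = 0)%E.
  move=> mE.
  have [i1 e1] := f0 _ _ (ob N) (ob N).
  have := @integral_preimage_eq0 _ _ (plane R) (plane R) R mu
    [set A `*` B | A in measurable & B in measurable] id
    (box N `*` box N) (EFin \o f) (@measurable_id _ _ _)
    (mXY _ _ (mo _ (ob N)) (mo _ (ob N))) i1.
  apply => //.
  - exact: measurable_prod_measurableType.
  - move=> _ _ [A mA [B mB <-]] [A' mA' [B' mB' <-]].
    exists (A `&` A'); first exact: measurableI.
    by exists (B `&` B'); [exact: measurableI|rewrite setXI].
  - move=> _ [A mA [B mB <-]].
    rewrite preimage_id -setXI; exact: stepB.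
have boxae N : {ae mu, forall p, (box N `*` box N) p -> f p = 0}.
  have [i1 e1] := f0 _ _ (ob N) (ob N).
  have mB := mXY _ _ (mo _ (ob N)) (mo _ (ob N)).
  have : ae_eq mu (box N `*` box N) (EFin \o f) (cst 0%E).
    apply: integral_ae_eq => // E EB mE.
    by rewrite integral_cst// mul0e -(stepC N E mE) (setIidl EB).
  by apply: filterS => p /= h bp; have [] := h bp.
have := ae_foralln boxae.
apply: filterS => -[x y] h.
pose N := (Num.trunc (`|x| + `|y|)).+1.
apply: (h N); split; rewrite /box /= in_itv/=.
  have : `|x| < N%:R by apply: le_lt_trans (truncnS_gt _); rewrite lerDl.
  by rewrite ltr_norml => /andP[-> /ltW].
have : `|y| < N%:R by apply: le_lt_trans (truncnS_gt _); rewrite lerDr.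
by rewrite ltr_norml => /andP[-> /ltW].
Qed.

End rectangles.

(** * Square integrable functions *)

Section square_integrable.
Context d (T : measurableType d) (R : realType).
Variable m : {measure set T -> \bar R}.
Implicit Types f g : T -> R.

Definition L2 f : Prop :=
  measurable_fun setT f /\ (\int[m]_x (f x ^+ 2)%:E < +oo)%E.

Lemma sqr_integral_ge0 f : (0 <= \int[m]_x (f x ^+ 2)%:E)%E.
Proof. by apply: integral_ge0 => x _; rewrite lee_fin sqr_ge0. Qed.

Lemma L2_fin f : L2 f -> (\int[m]_x (f x ^+ 2)%:E)%E \is a fin_num.
Proof. by case=> _ f2; rewrite ge0_fin_numE// sqr_integral_ge0. Qed.

Lemma L2_sqr_integrable f : L2 f -> L1 m (fun x => f x ^+ 2).
Proof.
case=> mf f2; apply/integrableP; split.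
  exact: measurable_sqr.
by under eq_integral => x _ do rewrite /= ger0_norm ?sqr_ge0//.
Qed.

Lemma L2_le f g (c : R) : measurable_fun setT f -> L2 g ->
  (forall x, f x ^+ 2 <= c * g x ^+ 2) -> L2 f.
Proof.
move=> mf g2 fg; split => //; have [mg _] := g2.
have gi : L1 m (fun x => c * g x ^+ 2).
  by apply: L1Z; exact: L2_sqr_integrable.
apply: le_lt_trans (integrable_lty measurableT gi).
apply: ge0_le_integral => //.
- by move=> x _; rewrite lee_fin sqr_ge0.
- exact: measurable_sqr.
- exact: measurable_int gi.
- by move=> x _; rewrite lee_fin.
Qed.

Lemma L2D f g : L2 f -> L2 g -> L2 (fun x => f x + g x).
Proof.
move=> f2 g2; have [mf _] := f2; have [mg _] := g2.
have mfg : measurable_fun setT (fun x => f x + g x) by exact: measurable_funD.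
split => //.
have gi : L1 m (fun x => 2 * (f x ^+ 2) + 2 * (g x ^+ 2)).
  by apply: L1D; apply: L1Z; exact: L2_sqr_integrable.
apply: le_lt_trans (integrable_lty measurableT gi).
apply: ge0_le_integral => //.
- by move=> x _; rewrite lee_fin sqr_ge0.
- exact: measurable_sqr.
- exact: measurable_int gi.
- by move=> x _; rewrite lee_fin /=; have := sqr_ge0 (f x - g x); lra.
Qed.

Lemma L2Mb f g (c : R) : L2 f -> measurable_fun setT g ->
  (forall x, `|g x| <= c) -> L2 (fun x => f x * g x).
Proof.
move=> f2 mg gc; have [mf _] := f2.
apply: (L2_le (c := c ^+ 2) _ f2); first exact: measurable_funM.
move=> x; rewrite exprMn mulrC ler_wpM2r ?sqr_ge0//.
by rewrite -[leLHS]real_normK ?num_real// ler_sqr ?nnegrE// (le_trans _ (gc x)).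
Qed.

Lemma L2Z f (c : R) : L2 f -> L2 (fun x => c * f x).
Proof.
move=> f2; have [mf _] := f2; apply: (L2_le (c := c ^+ 2) _ f2).
  exact: measurable_funM.
by move=> x; rewrite exprMn.
Qed.

Lemma L2N f : L2 f -> L2 (fun x => - f x).
Proof.
move=> f2; have := L2Z (-1) f2.
by congr L2; apply/funext => x; rewrite mulN1r.
Qed.

Lemma L2M_integrable f g : L2 f -> L2 g ->
  L1 m (fun x => f x * g x).
Proof.
move=> f2 g2; have [mf _] := f2; have [mg _] := g2.
have gi : L1 m (fun x => f x ^+ 2 + g x ^+ 2).
  by apply: L1D; exact: L2_sqr_integrable.
apply: le_integrable gi => //.
  by apply/measurable_EFinP; exact: measurable_funM.
move=> x _ /=; rewrite lee_fin [leRHS]ger0_norm ?addr_ge0 ?sqr_ge0// ler_norml.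
by set u := f x; set v := g x; apply/andP; split; nra.
Qed.

Lemma L2_ae f g : L2 f -> measurable_fun setT g -> {ae m, forall x, f x = g x} -> L2 g.
Proof.
move=> [mf f2] mg fg; split => //.
rewrite (_ : (\int[m]_x (g x ^+ 2)%:E = \int[m]_x (f x ^+ 2)%:E)%E)//.
apply: ae_eq_integral => //; [exact: measurable_sqr..|].
by apply: filterS fg => x fx _; rewrite fx.
Qed.

(* AM-GM with weight l: this form avoids square roots of integrals. *)
Lemma norm_RintegralM_le f g (l a b : R) : 0 < l -> L2 f -> L2 g ->
  (\int[m]_x (f x ^+ 2)%:E <= a%:E)%E -> (\int[m]_x (g x ^+ 2)%:E <= b%:E)%E ->
  `|\int[m]_x (f x * g x)| <= l * a + l^-1 * b.
Proof.
move=> l0 f2 g2 fa gb; have i := L2M_integrable f2 g2.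
have [mf _] := f2; have [mg _] := g2.
apply: (le_trans (le_normr_Rintegral measurableT i)).
have if2 : L1 m (fun x => l * f x ^+ 2).
  by apply: L1Z; exact: L2_sqr_integrable.
have ig2 : L1 m (fun x => l^-1 * g x ^+ 2).
  by apply: L1Z; exact: L2_sqr_integrable.
apply: (@le_trans _ _ (\int[m]_x (l * f x ^+ 2 + l^-1 * g x ^+ 2))).
  apply: le_Rintegral => //; first exact: (integrable_abse i).
    exact: L1D.
  move=> x _; set u := f x; set v := g x.
  have h1 : 0 <= (l * u - v) ^+ 2 / l by rewrite divr_ge0 ?sqr_ge0 ?ltW.
  have h2 : 0 <= (l * u + v) ^+ 2 / l by rewrite divr_ge0 ?sqr_ge0 ?ltW.
  have e1 : (l * u - v) ^+ 2 / l = l * u ^+ 2 - 2 * (u * v) + l^-1 * v ^+ 2.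
    by field; rewrite gt_eqF.
  have e2 : (l * u + v) ^+ 2 / l = l * u ^+ 2 + 2 * (u * v) + l^-1 * v ^+ 2.
    by field; rewrite gt_eqF.
  have h3 : 0 <= l * u ^+ 2 by rewrite mulr_ge0 ?sqr_ge0 ?ltW.
  have h4 : 0 <= l^-1 * v ^+ 2 by rewrite mulr_ge0 ?sqr_ge0 ?invr_ge0 ?ltW.
  rewrite e1 in h1; rewrite e2 in h2; rewrite ler_norml.
  by apply/andP; split; lra.
rewrite RintegralD// RintegralZl ?L2_sqr_integrable// RintegralZl ?L2_sqr_integrable//.
apply: lerD; rewrite ler_wpM2l ?invr_ge0 ?(ltW l0)// -lee_fin /Rintegral fineK//; exact: L2_fin.
Qed.

End square_integrable.

Lemma cvg_sqr0 (R : realType) (u : nat -> R) :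
  u n @[n --> \oo] --> (0 : R) -> u n ^+ 2 @[n --> \oo] --> (0 : R).
Proof.
move=> h; have H : u n * u n @[n --> \oo] --> (0 * 0 : R) by apply: cvgM.
by under eq_fun do rewrite expr2; rewrite mulr0 in H.
Qed.

(** * Damped Fourier integrals of square integrable functions *)

Section fourier_L2.
Context (R : realType).
Local Notation mu := (@pm R).
Implicit Types (p q y : plane R) (G A : plane R -> R).

Lemma L2_g2 e : 0 < e -> L2 mu (g2 e).
Proof.
move=> e0; split; first exact: measurable_g2.
apply: le_lt_trans (integrable_lty measurableT (integrable_g2 e0)).
apply: ge0_le_integral => //.
- by move=> x _; rewrite lee_fin sqr_ge0.
- by apply: measurable_sqr; exact: measurable_g2.
- by apply/measurable_EFinP; exact: measurable_g2.
- move=> x _; rewrite lee_fin expr2 ler_piMr ?g2_ge0//.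
  by rewrite g2_le1// ltW.
Qed.

(** The constant of [plancherel_le]. *)
Definition pconst : R := 2 * (2 * pi) ^+ 2.

(** The function under the square is the real part of the integral of (A1 + i A2)(q) e^(i y.q). One
    factor 2 comes from splitting the square of a difference, the rest from [plancherel_le]. *)
Lemma tr_sqr_le A1 A2 (a1 a2 : R) :
  L1 mu A1 -> L1 mu A2 ->
  (\int[mu]_q (A1 q ^+ 2)%:E <= a1%:E)%E -> (\int[mu]_q (A2 q ^+ 2)%:E <= a2%:E)%E ->
  (\int[mu]_y ((cos_tr A1 y - sin_tr A2 y) ^+ 2)%:E <= (2 * pconst * (a1 + a2))%:E)%E.
Proof.
move=> i1 i2 h1 h2.
have m1 := measurable_cos_tr i1; have m1' := measurable_sin_tr i1.
have m2 := measurable_cos_tr i2; have m2' := measurable_sin_tr i2.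
have K0 : 0 <= pconst by rewrite mulr_ge0// sqr_ge0.
have p1 : (\int[mu]_y (cos_tr A1 y ^+ 2 + sin_tr A1 y ^+ 2)%:E <= (pconst * a1)%:E)%E.
  by apply: (le_trans (plancherel_le i1)); rewrite [leRHS]EFinM; apply: lee_wpmul2l.
have p2 : (\int[mu]_y (cos_tr A2 y ^+ 2 + sin_tr A2 y ^+ 2)%:E <= (pconst * a2)%:E)%E.
  by apply: (le_trans (plancherel_le i2)); rewrite [leRHS]EFinM; apply: lee_wpmul2l.
pose U1 y : R := cos_tr A1 y ^+ 2 + sin_tr A1 y ^+ 2.
pose U2 y : R := cos_tr A2 y ^+ 2 + sin_tr A2 y ^+ 2.
have mU1 : measurable_fun setT U1 by apply: measurable_funD; apply: measurable_funX.
have mU2 : measurable_fun setT U2 by apply: measurable_funD; apply: measurable_funX.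
have U10 y : 0 <= U1 y by rewrite addr_ge0 ?sqr_ge0.
have U20 y : 0 <= U2 y by rewrite addr_ge0 ?sqr_ge0.
apply: (@le_trans _ _ (\int[mu]_y ((2 * U1 y)%:E + (2 * U2 y)%:E))%E).
  apply: ge0_le_integral => //.
  - by move=> x _; rewrite lee_fin sqr_ge0.
  - by apply: measurable_sqr; exact: measurable_funB.
  - by apply: emeasurable_funD; apply/measurable_EFinP; apply: measurable_funM.
  - move=> y _; rewrite -EFinD lee_fin /U1 /U2.
    have := sqr_ge0 (cos_tr A1 y + sin_tr A2 y); have := sqr_ge0 (sin_tr A1 y); have := sqr_ge0 (cos_tr A2 y).
    lra.
rewrite ge0_integralD//; last 4 first.
- by move=> x _; rewrite lee_fin mulr_ge0.
- by apply/measurable_EFinP; apply: measurable_funM.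
- by move=> x _; rewrite lee_fin mulr_ge0.
- by apply/measurable_EFinP; apply: measurable_funM.
rewrite !ge0_integralZ_EFin//.
have -> : (2 * pconst * (a1 + a2))%:E = (2%:E * (pconst * a1)%:E + 2%:E * (pconst * a2)%:E)%E.
  by rewrite -!EFinM -EFinD; congr EFin; ring.
by apply: leeD; apply: lee_wpmul2l.
Qed.

Definition damp (n : nat) : R := n.+1%:R^-1.

Lemma damp_gt0 n : 0 < damp n. Proof. by rewrite invr_gt0. Qed.

Lemma damp_le1 n : damp n <= 1. Proof. by rewrite invf_le1// ler1n. Qed.

Lemma cvg_damp : damp n @[n --> \oo] --> (0 : R). Proof. exact: cvg_harmonic. Qed.

Lemma cvg_gauss_damp (x : R) : gauss (damp n) x @[n --> \oo] --> (1 : R).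
Proof.
rewrite -expR0; apply: continuous_cvg; first exact: continuous_expR.
rewrite -oppr0; apply: cvgN.
rewrite (_ : (fun n => _) = (fun n => (2^-1 * x ^+ 2) * damp n)).
  by apply: cvgMl0; exact: cvg_damp.
by apply/funext => n; ring.
Qed.

Lemma cvg_g2_damp q : g2 (damp n) q @[n --> \oo] --> (1 : R).
Proof. by rewrite -[X in _ --> X]mul1r; apply: cvgM; exact: cvg_gauss_damp. Qed.

Lemma le_gauss (e e' x : R) : e <= e' -> gauss e' x <= gauss e x.
Proof. by move=> ee; rewrite ler_expR lerN2 ler_wpM2r ?sqr_ge0// ler_wpM2r. Qed.

Lemma le_g2 (e e' : R) q : e <= e' -> g2 e' q <= g2 e q.
Proof. by move=> ee; rewrite ler_pM ?gauss_ge0 ?le_gauss. Qed.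

(* Real part of the inverse Fourier integral of the damped G1 + i G2. The
   imaginary part is [ifour G2 (- G1)]. *)
Definition ifour G1 G2 n y : R :=
  cos_tr (fun q => G1 q * g2 (damp n) q) y - sin_tr (fun q => G2 q * g2 (damp n) q) y.

Variables G1 G2 : plane R -> R.
Hypotheses (G1L : L2 mu G1) (G2L : L2 mu G2).

Let mG1 : measurable_fun setT G1. Proof. by case: G1L. Qed.
Let mG2 : measurable_fun setT G2. Proof. by case: G2L. Qed.

Lemma integrable_damped G n : L2 mu G ->
  L1 mu (fun q => G q * g2 (damp n) q).
Proof. by move=> GL; apply: L2M_integrable => //; exact: L2_g2 (damp_gt0 n). Qed.

Lemma L2_damped G n : L2 mu G -> L2 mu (fun q => G q * g2 (damp n) q).
Proof.
move=> GL; apply: (L2Mb (c := 1) GL (measurable_g2 _)) => q.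
by rewrite ger0_norm ?g2_ge0// g2_le1// ltW// damp_gt0.
Qed.

Lemma measurable_ifour n : measurable_fun setT (ifour G1 G2 n).
Proof.
by apply: measurable_funB; [apply: measurable_cos_tr|apply: measurable_sin_tr];
  exact: integrable_damped.
Qed.

Lemma L2_ifour n : L2 mu (ifour G1 G2 n).
Proof.
split; first exact: measurable_ifour.
have f1 := L2_fin (L2_damped n G1L); have f2 := L2_fin (L2_damped n G2L).
apply: le_lt_trans (ltry _).
apply: tr_sqr_le; [exact: integrable_damped|exact: integrable_damped| |].
- by rewrite -(fineK f1); exact: lexx.
- by rewrite -(fineK f2); exact: lexx.
Qed.

(** The squared L^2 distance from [G] to its damped version, which governs the rate of
    convergence. *)
Let e1 G n : R := \int[mu]_q ((G q * (1 - g2 (damp n) q)) ^+ 2).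
Let e n := 2 * pconst * (e1 G1 n + e1 G2 n).

Let one_sub_g2 n q : 0 <= 1 - g2 (damp n) q <= 1.
Proof.
have := g2_ge0 (damp n) q; have := g2_le1 q (ltW (damp_gt0 n)); lra.
Qed.

Let e1_L2 G n : L2 mu G -> L2 mu (fun q => G q * (1 - g2 (damp n) q)).
Proof.
move=> GL; apply: (L2Mb (c := 1) GL).
  by apply: measurable_funB => //; exact: measurable_g2.
by move=> x; rewrite ger0_norm; have /andP[] := one_sub_g2 n x.
Qed.

Let cvg_e1 G : L2 mu G -> e1 G n @[n --> \oo] --> (0 : R).
Proof.
move=> GL; have [mG _] := GL.
have := @dominated_cvg_Rintegral _ _ R mu
  (fun n q => (G q * (1 - g2 (damp n) q)) ^+ 2) (cst 0) (fun q => G q ^+ 2).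
rewrite /cst Rintegral_cst// mul0r; apply.
- by move=> n; apply: measurable_funX; have [] := e1_L2 n GL.
- exact: measurable_cst.
- apply: aeW => q.
  have h : G q * (1 - g2 (damp n) q) @[n --> \oo] --> (0 : R).
    apply: cvgMl0; rewrite -(subrr (1 : R)).
    by apply: cvgB; [exact: cvg_cst|exact: cvg_g2_damp].
  exact: cvg_sqr0.
- exact: L2_sqr_integrable.
- move=> n q; rewrite ger0_norm ?sqr_ge0// exprMn ler_piMr ?sqr_ge0//.
  by have /andP[a0 a1] := one_sub_g2 n q; rewrite expr_le1.
Qed.

(** The damped functions converge in L^2 by dominated convergence; [tr_sqr_le] makes their
    transforms a Cauchy sequence, and [L2_complete] supplies the limit with the same rate. *)
Lemma fourier_L2_limit : exists (w : plane R -> R) (e : nat -> R),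
  [/\ L2 mu w, e n @[n --> \oo] --> (0 : R) &
    forall n, (\int[mu]_y ((ifour G1 G2 n y - w y) ^+ 2)%:E <= (e n)%:E)%E].
Proof.
have ce : e n @[n --> \oo] --> (0 : R).
  have H : e1 G1 n + e1 G2 n @[n --> \oo] --> (0 + 0 : R).
    by apply: cvgD; exact: cvg_e1.
  rewrite addr0 in H.
  exact: (cvgMl0 _ H).
have [|w [mw we]] := @L2_complete _ _ R mu (ifour G1 G2) e measurable_ifour _ ce.
  move=> n k nk.
  pose D G q : R := G q * (g2 (damp n) q - g2 (damp k) q).
  have iD G : L2 mu G -> L1 mu (D G).
    move=> GL; rewrite (_ : _ \o _ =
      fun q => (G q * g2 (damp n) q)%:E - (G q * g2 (damp k) q)%:E)%E.
      by apply: integrableB => //; exact: integrable_damped.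
    by apply/funext => q /=; rewrite -EFinB /D mulrBr.
  have E y : ifour G1 G2 n y - ifour G1 G2 k y = cos_tr (D G1) y - sin_tr (D G2) y.
    have -> : cos_tr (D G1) y = cos_tr (fun q => G1 q * g2 (damp n) q) y -
        cos_tr (fun q => G1 q * g2 (damp k) q) y.
      rewrite /cos_tr -RintegralB//; last 2 first.
      - exact: (integrable_cdot (integrable_damped n G1L)).
      - exact: (integrable_cdot (integrable_damped k G1L)).
      by apply: eq_Rintegral => q _; rewrite /D; ring.
    have -> : sin_tr (D G2) y = sin_tr (fun q => G2 q * g2 (damp n) q) y -
        sin_tr (fun q => G2 q * g2 (damp k) q) y.
      rewrite /sin_tr -RintegralB//; last 2 first.
      - exact: (integrable_sdot (integrable_damped n G2L)).
      - exact: (integrable_sdot (integrable_damped k G2L)).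
      by apply: eq_Rintegral => q _; rewrite /D; ring.
    have aux (a b c d : R) : a - b - (c - d) = a - c - (b - d) by ring.
    exact: aux.
  under eq_integral do rewrite E.
  have De G : L2 mu G -> (\int[mu]_q (D G q ^+ 2)%:E <= (e1 G n)%:E)%E.
    move=> GL; rewrite /e1 /Rintegral fineK; last exact: L2_fin (e1_L2 n GL).
    apply: ge0_le_integral => //.
    - by move=> x _; rewrite lee_fin sqr_ge0.
    - by apply/measurable_EFinP; apply: measurable_funX; apply/measurable_EFinP; exact: measurable_int (iD _ GL).
    - by apply/measurable_EFinP; apply: measurable_funX; have [] := e1_L2 n GL.
    - move=> q _; rewrite lee_fin /D !exprMn ler_wpM2l ?sqr_ge0//.
      (* The damping weakens along the sequence, so for [n <= k] the two factors differ by at most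
         [1 - g2 (damp n) q]; the rate thus depends on [n] alone. *)
      have h1 : g2 (damp n) q <= g2 (damp k) q.
        by apply: le_g2; rewrite lef_pV2 ?posrE// ler_nat ltnS.
      have h2 := g2_le1 q (ltW (damp_gt0 k)).
      have h3 := g2_ge0 (damp n) q.
      by rewrite -sqrrN opprB ler_sqr ?nnegrE ?subr_ge0// ?(le_trans h1)// lerB.
  by apply: tr_sqr_le; [exact: iD|exact: iD|exact: De|exact: De].
exists w, e; split => //.
(* [w] differs from the square integrable function [ifour G1 G2 0] by a function of finite squared
   norm, at most [e 0]. *)
have dL : L2 mu (fun y => ifour G1 G2 0%N y - w y).
  split; first by apply: measurable_funB => //; exact: measurable_ifour.
  exact: le_lt_trans (we 0%N) (ltry _).
have := L2D (L2_ifour 0%N) (L2N dL).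
by congr L2; apply/funext => y; ring.
Qed.

End fourier_L2.

Lemma cvg_RintegralM_L2 d (T : measurableType d) (R : realType)
    (m : {measure set T -> \bar R}) (f g : T -> R) (f_ : nat -> T -> R) (e : nat -> R) :
  L2 m f -> L2 m g -> (forall n, L2 m (f_ n)) ->
  (forall n, \int[m]_x ((f_ n x - g x) ^+ 2)%:E <= (e n)%:E)%E ->
  e n @[n --> \oo] --> (0 : R) ->
  \int[m]_x (f x * f_ n x) @[n --> \oo] --> \int[m]_x (f x * g x).
Proof.
move=> fL gL f_L fge e0.
pose a := fine (\int[m]_x (f x ^+ 2)%:E)%E.
have aE : (\int[m]_x (f x ^+ 2)%:E = a%:E)%E by rewrite fineK// L2_fin.
have a0 : 0 <= a by rewrite fine_ge0// sqr_integral_ge0.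
apply/cvgrPdist_le => eps eps0.
have a1 : 0 < a + 1 by rewrite ltr_wpDl.
(* Then [l * a <= eps / 2], where [+ 1] covers the case [a = 0], and [l^-1 * e n <= eps / 2] once
   [e n] is small. *)
pose l := eps / 2 / (a + 1).
have l0 : 0 < l by rewrite !divr_gt0.
have e20 : 0 < l * (eps / 2) by rewrite mulr_gt0// divr_gt0.
have /cvgrPdist_le /(_ _ e20)[N _ HN] := e0.
exists N => // n /= Nn.
have dL : L2 m (fun x => g x - f_ n x) by exact: L2D gL (L2N (f_L n)).
have en : e n <= l * (eps / 2).
  by have := HN n Nn; rewrite sub0r normrN; apply: le_trans; exact: ler_norm.
rewrite -RintegralB//; last 2 first.
- exact: L2M_integrable.
- exact: L2M_integrable.
under eq_Rintegral do rewrite -mulrBr.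
apply: (le_trans (norm_RintegralM_le (a := a) (b := e n) l0 fL dL _ _)).
- by rewrite aE.
- apply: le_trans (fge n); rewrite le_eqVlt; apply/orP; left; apply/eqP.
  by apply: eq_integral => x _; rewrite -sqrrN opprB.
apply: (@le_trans _ _ (eps / 2 + eps / 2)); last by rewrite -splitr.
apply: lerD; last by rewrite ler_pdivrMl.
by rewrite /l mulrAC ler_pdivrMr// ler_wpM2l ?lerDl// ltW// divr_gt0.
Qed.

(** * Gaussian mollification of indicators of intervals *)

Section mollifier.
Context (R : realType).
Local Notation L := (@lebesgue_measure R).
Implicit Types (X Y : set (measurableTypeR R)).

Lemma ocitv_measurable X : ocitv X -> measurable X.
Proof. by move=> oX; exact: sub_sigma_algebra. Qed.

Lemma ocitv_bounded X : ocitv X ->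
  exists2 N : R, 0 <= N & forall x, X x -> `|x| <= N.
Proof.
move=> [[a b] _ <-] /=; exists (`|a| + `|b|) => // x /=; rewrite in_itv/= => /andP[ax xb].
rewrite ler_norml; apply/andP; split.
  by move: ax; have := ler_norm (- a); rewrite normrN; have := normr_ge0 b; lra.
by move: xb; have := ler_norm b; have := normr_ge0 a; lra.
Qed.

Let measurable_indic_affine X (s x : R) : measurable X ->
  measurable_fun setT (fun z : measurableTypeR R => \1_X (x - s * z) : R).
Proof.
move=> mX.
have mg : measurable_fun setT (fun z : measurableTypeR R => (x - s * z : measurableTypeR R)).
  by apply: measurable_funB => //; exact: measurable_funM.
have mI : measurable_fun setT (\1_X : measurableTypeR R -> R) by exact: measurable_indic.
exact: (measurableT_comp mI mg).
Qed.

(** The transform of [gauss d], by [gauss_cos]: a Gaussian kernel of mass 2 pi that concentrates at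
    0 as [d] tends to 0. *)
Definition k1 (d x : R) : R := Num.sqrt (2 * pi / d) * gauss d^-1 x.

Lemma k1_ge0 d x : 0 <= k1 d x.
Proof. by rewrite mulr_ge0 ?sqrtr_ge0 ?gauss_ge0. Qed.

Lemma measurable_k1 d : measurable_fun setT (k1 d).
Proof. by apply: measurable_funM => //; exact: measurable_gauss. Qed.

Definition moll X (d x : R) : R := \int[L]_y (\1_X y * k1 d (x - y)).

(** The substitution y = x - sqrt(d) z moves the parameter from the kernel into the indicator, so
    that one fixed Gaussian dominates the integrand for all [d]. *)
Lemma moll_subst X d x : 0 < d -> measurable X ->
  moll X d x = Num.sqrt (2 * pi) * \int[L]_z (\1_X (x - Num.sqrt d * z) * gauss 1 z).
Proof.
move=> d0 mX.
have s0 : - Num.sqrt d != 0 by rewrite oppr_eq0 gt_eqF ?sqrtr_gt0.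
have mf : measurable_fun setT (fun y => (\1_X y * k1 d (x - y))%:E).
  apply/measurable_EFinP; apply: measurable_funM; first exact: measurable_indic.
  by apply: (measurableT_comp (measurable_k1 d)); exact: measurable_funB.
have mX' : measurable_fun setT (fun z : measurableTypeR R => \1_X (x - Num.sqrt d * z) : R).
  exact: measurable_indic_affine.
have i : L1 L (fun z => \1_X (x - Num.sqrt d * z) * gauss 1 z).
  rewrite (_ : (fun z => _) = (fun z => gauss 1 z * \1_X (x - Num.sqrt d * z))); last first.
    by apply/funext => z; exact: mulrC.
  apply: integrable_gauss_bounded => // z.
  by rewrite indicE; case: (_ \in _); rewrite ?normr1 ?normr0.
rewrite /moll /Rintegral (ge0_integral_affine x s0 mf); last first.
  by move=> y; rewrite lee_fin mulr_ge0 ?k1_ge0.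
have E z : ((\1_X (- Num.sqrt d * z + x) * k1 d (x - (- Num.sqrt d * z + x)))%:E =
    (Num.sqrt (2 * pi / d))%:E * (\1_X (x - Num.sqrt d * z) * gauss 1 z)%:E)%E.
  rewrite -EFinM; congr EFin; rewrite mulNr [- _ + x]addrC subKr.
  rewrite /k1 mulrCA; congr (_ * (_ * _)); rewrite /gauss; congr expR.
  by rewrite exprMn sqr_sqrtr ?(ltW d0)//; field; rewrite gt_eqF.
have -> : (\int[L]_z (\1_X (- Num.sqrt d * z + x) * k1 d (x - (- Num.sqrt d * z + x)))%:E =
    (Num.sqrt (2 * pi / d))%:E * \int[L]_z (\1_X (x - Num.sqrt d * z) * gauss 1 z)%:E)%E.
  have mi : measurable_fun setT (fun z : measurableTypeR R => \1_X (x - Num.sqrt d * z) * gauss 1 z).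
    exact: L1_measurable i.
  have i0 (z : measurableTypeR R) : 0 <= \1_X (x - Num.sqrt d * z) * gauss 1 z.
    by rewrite mulr_ge0 ?gauss_ge0.
  have := ge0_integralZ_EFin L mi i0 (sqrtr_ge0 (2 * pi / d)); move=> <-.
  by apply: eq_integral => z _; rewrite E -EFinM.
rewrite muleA -EFinM normrN (ger0_norm (sqrtr_ge0 _)).
have -> : Num.sqrt d * Num.sqrt (2 * pi / d) = Num.sqrt (2 * pi).
  by rewrite -sqrtrM ?(ltW d0)//; congr Num.sqrt; field; rewrite gt_eqF.
have := integrable_fin_num measurableT i.
by case: (\int[L]_z _)%E.
Qed.

(** A Gaussian bound uniform in [d]: it will dominate products with a function known to be
    integrable only against Gaussians. *)
Lemma moll_le X : ocitv X -> exists2 C : R, 0 <= C &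
  forall d x, 0 < d <= 1 -> 0 <= moll X d x <= C * gauss 4^-1 x.
Proof.
move=> oX; have mX := ocitv_measurable oX; have [N N0 XN] := ocitv_bounded oX.
(* Where the indicator is 1, x is within sqrt(d) |z| + N of 0, so x^2 <= 2 N^2 + 2 z^2 for d <= 1.
   Hence [gauss 1 z] is at most [expR (N ^+ 2 / 4)] times a Gaussian in [x] and one in [z]; the
   integral of the latter is the last factor. *)
exists (Num.sqrt (2 * pi) * (expR (N ^+ 2 / 4) * Num.sqrt (2 * pi / 2^-1))).
  by rewrite !mulr_ge0 ?sqrtr_ge0 ?expR_ge0.
move=> d x /andP[d0 d1].
apply/andP; split.
  by apply: Rintegral_ge0 => y _; rewrite mulr_ge0 ?k1_ge0.
rewrite moll_subst// -[leRHS]mulrA ler_wpM2l ?sqrtr_ge0//.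
have h2 : (0 : R) < 2^-1 by [].
have i2 := integrable_gauss h2.
have i3 : L1 L (fun z => expR (N ^+ 2 / 4) * gauss 4^-1 x * gauss 2^-1 z).
  exact: L1Z.
apply: (@le_trans _ _ (\int[L]_z (expR (N ^+ 2 / 4) * gauss 4^-1 x * gauss 2^-1 z))); last first.
  by rewrite RintegralZl// integral_gauss// mulrAC.
apply: le_Rintegral => //.
  rewrite (_ : (fun z => _) = (fun z => gauss 1 z * \1_X (x - Num.sqrt d * z))); last first.
    by apply/funext => z; exact: mulrC.
  apply: integrable_gauss_bounded => // [|z].
    exact: measurable_indic_affine.
  by rewrite indicE; case: (_ \in _); rewrite ?normr1 ?normr0.
move=> z _; rewrite indicE; case: (boolP (_ \in X)) => [|_]; last first.
  by rewrite mul0r !mulr_ge0 ?expR_ge0 ?gauss_ge0.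
rewrite inE => /XN wN; rewrite mul1r /gauss -!expRD ler_expR.
have w2 : (x - Num.sqrt d * z) ^+ 2 <= N ^+ 2.
  by rewrite -[leLHS]real_normK ?num_real// ler_sqr ?nnegrE.
have z2 : (Num.sqrt d * z) ^+ 2 <= z ^+ 2.
  by rewrite exprMn sqr_sqrtr ?(ltW d0)// ler_piMl ?sqr_ge0.
have := sqr_ge0 (x - Num.sqrt d * z - Num.sqrt d * z).
by move: w2 z2; set v := Num.sqrt d * z; nra.
Qed.

(** Away from the end points the indicator is constant near [x], so the integrand of [moll_subst]
    converges pointwise. The factor [2 * pi] is the mass of [k1]. *)
Lemma cvg_moll X : ocitv X -> exists a b : R, forall x, x != a -> x != b ->
  moll X (damp R n) x @[n --> \oo] --> 2 * pi * \1_X x.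
Proof.
move=> oX; have mX := ocitv_measurable oX.
have [[a b] _ XE] := oX; exists a, b => x xa xb.
have nX : \forall y \near x, \1_X y = \1_X x :> R.
  have [xla|axl] := ltP x a.
    near=> y; have ya : y < a by near: y; exact: lt_nbhsl.
    by rewrite !indicE !memNset// -XE /= in_itv/= ?[a < x]ltNge ?(ltW xla)// ltNge (ltW ya).
  have {}axl : a < x by rewrite lt_neqAle eq_sym xa.
  have [bx|xlb] := ltP b x.
    near=> y; have yb : b < y by near: y; exact: lt_nbhsr.
    by rewrite !indicE !memNset// -XE /= in_itv/= leNgt ?yb ?bx andbF.
  have {}xlb : x < b by rewrite lt_neqAle xb.
  near=> y; have ya : a < y by near: y; exact: lt_nbhsr.
  have yb : y < b by near: y; exact: lt_nbhsl.
  by rewrite !indicE !mem_set// -XE /= in_itv/= ?axl ?ya/= ltW.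
under eq_fun do rewrite moll_subst ?damp_gt0//.
have -> : 2 * pi * \1_X x = Num.sqrt (2 * pi) * \int[L]_z (\1_X x * gauss 1 z) :> R.
  rewrite RintegralZl//; last exact: integrable_gauss.
  by rewrite integral_gauss// divr1 mulrCA -expr2 sqr_sqrtr ?mulr_ge0 ?pi_ge0// mulrC.
apply: cvgM; first exact: cvg_cst.
apply: (@dominated_cvg_Rintegral _ (measurableTypeR R) R L
  (fun n z => \1_X (x - Num.sqrt (damp R n) * z) * gauss 1 z) (fun z => \1_X x * gauss 1 z) (gauss 1)).
- move=> n; apply: measurable_funM; last exact: measurable_gauss.
  exact: measurable_indic_affine.
- by apply: measurable_funM => //; exact: measurable_gauss.
- apply: aeW => z; apply: cvgM; last exact: cvg_cst.
  apply: cvg_near_cst.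
  have h : x - Num.sqrt (damp R n) * z @[n --> \oo] --> x.
    have h0 : Num.sqrt (damp R n) @[n --> \oo] --> (0 : R).
      by rewrite -(@sqrtr0 R); apply: continuous_cvg; [exact: sqrt_continuous|exact: cvg_damp].
    have : x - z * Num.sqrt (damp R n) @[n --> \oo] --> x - 0.
      by apply: cvgB; [exact: cvg_cst|exact: cvgMl0].
    by rewrite subr0; under eq_fun do rewrite mulrC.
  exact: h nX.
- exact: integrable_gauss.
- move=> n z; rewrite normrM (ger0_norm (gauss_ge0 _ _)) ler_piMl ?gauss_ge0//.
  by rewrite indicE; case: (_ \in _); rewrite ?normr1 ?normr0.
Unshelve. all: by end_near. Qed.

Lemma measurable_moll X d : measurable X -> measurable_fun setT (moll X d).
Proof.
move=> mX; apply: (@measurable_Rintegral_param _ _ (measurableTypeR R) (measurableTypeR R) R L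
  (fun z => \1_X z.2 * k1 d (z.1 - z.2))).
have mI : measurable_fun setT (\1_X : measurableTypeR R -> R) by exact: measurable_indic.
apply: measurable_funM; first exact: (measurableT_comp mI).
by apply: (measurableT_comp (measurable_k1 d)); exact: measurable_funB.
Qed.

End mollifier.

(** * Identifying a function from its Gaussian mollifications *)

Section identification.
Context (R : realType).
Local Notation L := (@lebesgue_measure R).
Local Notation mu := (@pm R).
Implicit Types (X Y : set (measurableTypeR R)) (p y : plane R).

Let rect X Y p : R := \1_X p.1 * \1_Y p.2.

Let rect01 X Y p : rect X Y p = \1_(X `*` Y) p.
Proof. by rewrite /rect !indicE in_setX; case: (_ \in _) => /=; rewrite ?mul1r ?mul0r. Qed.

Let rect_ge0 X Y p : 0 <= rect X Y p.
Proof. by rewrite mulr_ge0. Qed.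

Let rect_le1 X Y p : rect X Y p <= 1.
Proof. by rewrite rect01 indicE; case: (_ \in _). Qed.

Let measurable_rect X Y : measurable X -> measurable Y -> measurable_fun setT (rect X Y).
Proof.
move=> mX mY.
have mI1 : measurable_fun setT (\1_X : measurableTypeR R -> R) by exact: measurable_indic.
have mI2 : measurable_fun setT (\1_Y : measurableTypeR R -> R) by exact: measurable_indic.
by apply: measurable_funM; [exact: (measurableT_comp mI1)|exact: (measurableT_comp mI2)].
Qed.

Let rect_le X Y : ocitv X -> ocitv Y ->
  exists2 N : R, 0 <= N & forall p, rect X Y p != 0 -> `|p.1| <= N /\ `|p.2| <= N.
Proof.
move=> oX oY; have [N N0 XN] := ocitv_bounded oX; have [M M0 YM] := ocitv_bounded oY.
exists (N + M); first by rewrite addr_ge0.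
move=> p; rewrite /rect !indicE.
case: (boolP (p.1 \in X)) => [|_]; last by rewrite mul0r eqxx.
case: (boolP (p.2 \in Y)) => [|_]; last by rewrite mulr0 eqxx.
rewrite !inE => /YM h2 /XN h1 _.
by rewrite (le_trans h1) ?lerDl// (le_trans h2) ?lerDr.
Qed.

Let rect_le_g2 X Y : ocitv X -> ocitv Y ->
  exists2 C : R, 0 <= C & forall p, rect X Y p <= C * g2 1 p.
Proof.
move=> oX oY; have [N N0 XN] := rect_le oX oY.
exists (expR (N ^+ 2)); first exact: expR_ge0.
move=> p; have [->|/XN[h1 h2]] := eqVneq (rect X Y p) 0.
  by rewrite mulr_ge0 ?expR_ge0 ?g2_ge0.
apply: (le_trans (rect_le1 _ _ _)).
rewrite /g2 /gauss -!expRD -[leLHS]expR0 ler_expR.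
have e1 : p.1 ^+ 2 <= N ^+ 2 by rewrite -[leLHS]real_normK ?num_real// ler_sqr ?nnegrE.
have e2 : p.2 ^+ 2 <= N ^+ 2 by rewrite -[leLHS]real_normK ?num_real// ler_sqr ?nnegrE.
by lra.
Qed.

Let rect_L2 X Y : ocitv X -> ocitv Y -> L2 mu (rect X Y).
Proof.
move=> oX oY; have [C C0 HC] := rect_le_g2 oX oY.
have gL : L2 mu (g2 (1 : R)) by exact: L2_g2.
apply: (L2_le (c := C ^+ 2) _ gL).
  by apply: measurable_rect; exact: ocitv_measurable.
by move=> p; rewrite -exprMn ler_sqr ?nnegrE ?rect_ge0 ?(mulr_ge0 C0 (g2_ge0 _ _)).
Qed.

(** The transform of [g2 d], by [g2_cos]. Pairing [u] with its translates mollifies [u], up to the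
    mass (2 pi)^2. *)
Definition pk (d : R) p : R := 2 * pi / d * g2 d^-1 p.

Let pkE d p : 0 < d -> pk d p = k1 d p.1 * k1 d p.2.
Proof.
move=> d0; rewrite /pk /k1 [RHS]mulrACA -expr2 sqr_sqrtr//.
by rewrite divr_ge0 ?mulr_ge0 ?pi_ge0// ltW.
Qed.

(** A Gaussian moved by a bounded amount lies below a multiple of a wider centred one, because
    [2 * (x - y) ^+ 2 - x ^+ 2 + 2 * y ^+ 2] is the square of [x - 2 * y]. *)
Let k1_le d N (x y : R) : 0 < d -> `|y| <= N ->
  k1 d (x - y) <= Num.sqrt (2 * pi / d) * expR (d^-1 * N ^+ 2) * gauss (d^-1 / 2) x.
Proof.
move=> d0 yN; rewrite /k1 -[leRHS]mulrA ler_wpM2l ?sqrtr_ge0// /gauss -expRD ler_expR.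
have d1 : 0 < d^-1 by rewrite invr_gt0.
have e1 : y ^+ 2 <= N ^+ 2.
  by rewrite -[leLHS]real_normK ?num_real// ler_sqr ?nnegrE// (le_trans _ yN).
have e2 : d^-1 * y ^+ 2 <= d^-1 * N ^+ 2 by rewrite ler_wpM2l// ltW.
have e3 : 0 <= d^-1 * (x - 2 * y) ^+ 2 by rewrite mulr_ge0 ?sqr_ge0 ?ltW.
have e4 : 0 <= d^-1 * N ^+ 2 by rewrite mulr_ge0 ?sqr_ge0 ?ltW.
have e5 : d^-1 * (x - 2 * y) ^+ 2 =
  2 * (d^-1 * (x - y) ^+ 2) - d^-1 * x ^+ 2 + 2 * (d^-1 * y ^+ 2) by ring.
rewrite e5 in e3.
have -> : d^-1 / 2 * (x - y) ^+ 2 = 2^-1 * (d^-1 * (x - y) ^+ 2) by ring.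
have -> : d^-1 / 2 / 2 * x ^+ 2 = 4^-1 * (d^-1 * x ^+ 2) by field; rewrite gt_eqF.
by lra.
Qed.

Let rect_pk X Y d p : ocitv X -> ocitv Y -> 0 < d ->
  \int[mu]_y (rect X Y y * pk d (p - y)) = moll X d p.1 * moll Y d p.2.
Proof.
move=> oX oY d0; rewrite /moll.
have i Z (x : R) : measurable Z -> L1 L (fun y : R => \1_Z y * k1 d (x - y)).
  move=> mZ; have mI : measurable_fun setT (\1_Z : measurableTypeR R -> R) by exact: measurable_indic.
  have ki : L1 L (fun y : R => k1 d (x - y)).
    apply/integrableP; split.
      by apply/measurable_EFinP; apply: (measurableT_comp (measurable_k1 d)); exact: measurable_funB.
    have N1 : (-1 : R) != 0 by rewrite oppr_eq0.
    have ki : L1 L (k1 d).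
      by apply: L1Z; apply: integrable_gauss; rewrite invr_gt0.
    have /integrableP[mki] := ki.
    rewrite (ge0_integral_affine x N1)//; last exact: measurableT_comp.
    rewrite normrN1 mul1e => h; apply: le_lt_trans h.
    rewrite le_eqVlt; apply/orP; left; apply/eqP; apply: eq_integral => y _ /=.
    by rewrite mulN1r addrC.
  apply: le_integrable ki => //.
    apply/measurable_EFinP; apply: measurable_funM => //.
    by apply: (measurableT_comp (measurable_k1 d)); exact: measurable_funB.
  move=> y _ /=; rewrite lee_fin normrM ler_piMl//.
  by rewrite indicE; case: (_ \in _); rewrite ?normr1 ?normr0.
rewrite -(pm_Rintegral_prod (i _ p.1 (ocitv_measurable oX)) (i _ p.2 (ocitv_measurable oY))).
by apply: eq_Rintegral => y _; rewrite pkE//= /rect mulrACA.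
Qed.

Variables (u : plane R -> R) (W : nat -> plane R -> R) (w : plane R -> R) (e : nat -> R).
Hypothesis mu_ : measurable_fun setT u.
Hypothesis ug : forall a : R, 0 < a -> L1 mu (fun p => u p * g2 a p).
Hypothesis uW : forall n y, \int[mu]_p (u p * pk (damp R n) (p - y)) = W n y.
Hypothesis WL : forall n, L2 mu (W n).
Hypothesis wL : L2 mu w.
Hypothesis We : forall n, (\int[mu]_y ((W n y - w y) ^+ 2)%:E <= (e n)%:E)%E.
Hypothesis e0 : e n @[n --> \oo] --> (0 : R).

Let pk_le d N p y : 0 < d -> `|y.1| <= N -> `|y.2| <= N ->
  pk d (p - y) <= (Num.sqrt (2 * pi / d) * expR (d^-1 * N ^+ 2)) ^+ 2 * g2 (d^-1 / 2) p.
Proof.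
move=> d0 y1 y2; rewrite pkE// expr2 /g2 [leRHS]mulrACA.
by apply: ler_pM; rewrite ?k1_ge0//; exact: k1_le.
Qed.

Let rect_integrable X Y (c : R) : ocitv X -> ocitv Y -> 0 <= c ->
  L1 mu (fun y => c * rect X Y y).
Proof.
move=> oX oY c0.
have mr := measurable_rect (ocitv_measurable oX) (ocitv_measurable oY).
apply: L1Z.
have [C C0 HC] := rect_le_g2 oX oY.
have gi : L1 mu (fun p => C * g2 1 p).
  by apply: L1Z; exact: integrable_g2.
apply: le_integrable gi => //; first exact/measurable_EFinP.
by move=> p _ /=; rewrite lee_fin !ger0_norm ?(mulr_ge0 C0 (g2_ge0 _ _)).
Qed.

Let pk_ge0 d p : 0 < d -> 0 <= pk d p.
Proof. by move=> d0; rewrite pkE// mulr_ge0 ?k1_ge0. Qed.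

(** Fubini's theorem moves the mollification from [u] to the indicator of the rectangle, where its
    limit is easy to control. *)
Let rect_W X Y n : ocitv X -> ocitv Y ->
  \int[mu]_y (rect X Y y * W n y) =
  \int[mu]_p (u p * (moll X (damp R n) p.1 * moll Y (damp R n) p.2)).
Proof.
move=> oX oY; set d := damp R n; have d0 : 0 < d := damp_gt0 R n.
have [N N0 XN] := rect_le oX oY.
have mr := measurable_rect (ocitv_measurable oX) (ocitv_measurable oY).
have mpk : measurable_fun setT (pk d) by apply: measurable_funM => //; exact: measurable_g2.
have msub : measurable_fun setT (fun z : plane R * plane R => z.2 - z.1).
  by apply/measurable_fun_pairP; split; apply: measurable_funB; apply: measurableT_comp.
pose f (z : plane R * plane R) := rect X Y z.1 * (u z.2 * pk d (z.2 - z.1)).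
have mf : measurable_fun setT f.
  apply: measurable_funM; first exact: (measurableT_comp mr).
  by apply: measurable_funM; [exact: (measurableT_comp mu_)|exact: (measurableT_comp mpk)].
pose c := Num.sqrt (2 * pi / d) * expR (d^-1 * N ^+ 2).
have d20 : 0 < d^-1 / 2 by rewrite divr_gt0 ?invr_gt0.
(* For [y] in the bounded rectangle, one centred Gaussian dominates all the translated kernels;
   integrability against centred Gaussians is what is known about [u]. *)
have upk y : rect X Y y != 0 -> forall p,
    `|u p * pk d (p - y)| <= c ^+ 2 * `|u p * g2 (d^-1 / 2) p|.
  move=> /XN[h1 h2] p; rewrite [leLHS]normrM (ger0_norm (pk_ge0 _ d0)).
  rewrite [in leRHS]normrM [leRHS]mulrCA (ger0_norm (g2_ge0 _ _)) ler_wpM2l//; exact: pk_le.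
have fi : L1 (mu \x mu)%E f.
  apply: (integrable_tensor (rect_integrable oX oY (sqr_ge0 c)) (ug d20) mf) => y p.
  rewrite /f /= normrM (ger0_norm (rect_ge0 _ _ _)).
  have [->|r0] := eqVneq (rect X Y y) 0; first by rewrite mul0r mulr0 normr0 mul0r.
  rewrite [in leRHS]normrM (ger0_norm (rect_ge0 _ _ _)) (ger0_norm (sqr_ge0 c)).
  by rewrite -[leRHS]mulrA [leRHS]mulrCA ler_wpM2l// upk.
transitivity (\int[mu]_y \int[mu]_p f (y, p)).
  apply: eq_Rintegral => y _; rewrite -uW /f /=.
  have [->|r0] := eqVneq (rect X Y y) 0.
    by rewrite mul0r /Rintegral integral0_eq// => p _; rewrite mul0r.
  rewrite RintegralZl//.
  have ui : L1 mu (fun p => c ^+ 2 * (u p * g2 (d^-1 / 2) p)).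
    by apply: L1Z; exact: ug.
  apply: le_integrable ui => //.
    apply/measurable_EFinP; apply: measurable_funM => //.
    by apply: (measurableT_comp mpk); exact: measurable_shift.
  by move=> p _ /=; rewrite lee_fin [leRHS]normrM (ger0_norm (sqr_ge0 c)) upk.
rewrite (Rfubini fi); apply: eq_Rintegral => p _; rewrite /f /= -rect_pk// -RintegralZl//.
  by apply: eq_Rintegral => y _; rewrite mulrCA.
have pd0 : 0 <= 2 * pi / d :> R by rewrite divr_ge0 ?mulr_ge0 ?pi_ge0// ltW.
apply: le_integrable (rect_integrable oX oY pd0) => //.
  apply/measurable_EFinP; apply: measurable_funM => //.
  by apply: (measurableT_comp mpk); exact: measurable_refl.
move=> y _ /=; rewrite lee_fin normrM [leRHS]normrM [leLHS]mulrC (ger0_norm (pk_ge0 (p - y) d0)).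
rewrite ler_wpM2r// (ger0_norm pd0) /pk ler_piMr//.
by rewrite g2_le1// invr_ge0 ltW.
Qed.

(** Tested on a rectangle, the mollifications [W n] tend to the integral of [w] by L^2 convergence,
    and to (2 pi)^2 times the integral of [u] by [rect_W] and dominated convergence. Rectangles
    separate functions by [ae_eq0_rectangles]. *)
Lemma ae_identification : {ae mu, forall p, (2 * pi) ^+ 2 * u p = w p}.
Proof.
have [mw _] := wL.
have ur X Y : ocitv X -> ocitv Y -> L1 mu (fun p => u p * rect X Y p).
  move=> oX oY; have mr := measurable_rect (ocitv_measurable oX) (ocitv_measurable oY).
  have [C C0 HC] := rect_le_g2 oX oY.
  have ui : L1 mu (fun p => C * (u p * g2 1 p)).
    by apply: L1Z; exact: ug.
  apply: le_integrable ui => //.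
    by apply/measurable_EFinP; exact: measurable_funM.
  move=> p _ /=; rewrite lee_fin [X in _ <= `|X|]mulrCA normrM [leRHS]normrM ler_wpM2l//.
  by rewrite !ger0_norm ?(mulr_ge0 C0 (g2_ge0 _ _)).
have wr X Y : ocitv X -> ocitv Y -> L1 mu (fun p => rect X Y p * w p).
  by move=> oX oY; apply: L2M_integrable => //; exact: rect_L2.
have lim1 X Y : ocitv X -> ocitv Y ->
    \int[mu]_y (rect X Y y * W n y) @[n --> \oo] --> \int[mu]_y (rect X Y y * w y).
  by move=> oX oY; apply: (cvg_RintegralM_L2 (rect_L2 oX oY) wL WL We e0).
have lim2 X Y : ocitv X -> ocitv Y ->
    \int[mu]_y (rect X Y y * W n y) @[n --> \oo] --> \int[mu]_p (u p * ((2 * pi) ^+ 2 * rect X Y p)).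
  move=> oX oY; under eq_fun do rewrite rect_W//.
  have [C1 C10 H1] := moll_le oX; have [C2 C20 H2] := moll_le oY.
  have [a1 [b1 cX]] := cvg_moll oX; have [a2 [b2 cY]] := cvg_moll oY.
  have mr := measurable_rect (ocitv_measurable oX) (ocitv_measurable oY).
  have mm n : measurable_fun setT (fun p : plane R => moll X (damp R n) p.1 * moll Y (damp R n) p.2).
    apply: measurable_funM.
      by apply: (measurableT_comp (measurable_moll _ (ocitv_measurable oX))).
    by apply: (measurableT_comp (measurable_moll _ (ocitv_measurable oY))).
  (* By [moll_le], all mollified indicators stay below the same Gaussian, against which [u] is
     integrable. *)
  apply: (@dominated_cvg_Rintegral _ _ R mu _ _ (fun p => C1 * C2 * `|u p * g2 4^-1 p|)).
  - by move=> n; apply: measurable_funM.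
  - by apply: measurable_funM => //; exact: measurable_funM.
  (* Convergence can fail only on the four lines that extend the sides of the rectangle, and these
     are null sets. *)
  - have null1 (c : R) : mu ([set c] `*` setT) = 0%E.
      transitivity (L [set c] * L (setT : set (measurableTypeR R)))%E.
        by apply: (@product_measure1E _ _ _ _ _ L L).
      by rewrite lebesgue_measure_set1 mul0e.
    have null2 (c : R) : mu (setT `*` [set c]) = 0%E.
      transitivity (L (setT : set (measurableTypeR R)) * L [set c])%E.
        by apply: (@product_measure1E _ _ _ _ _ L L).
      by rewrite lebesgue_measure_set1 mule0.
    have ae1 (c : R) : {ae mu, forall p : plane R, p.1 != c}.
      exists ([set c] `*` setT); split; [exact: measurableX|exact: null1|].
      by move=> p /= /negP; rewrite negbK => /eqP.
    have ae2 (c : R) : {ae mu, forall p : plane R, p.2 != c}.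
      exists (setT `*` [set c]); split; [exact: measurableX|exact: null2|].
      by move=> p /= /negP; rewrite negbK => /eqP.
    have ae1' : {ae mu, forall p : plane R, p.1 != a1 /\ p.1 != b1}.
      by apply: filterS2 (ae1 a1) (ae1 b1) => p; split.
    have ae2' : {ae mu, forall p : plane R, p.2 != a2 /\ p.2 != b2}.
      by apply: filterS2 (ae2 a2) (ae2 b2) => p; split.
    apply: filterS2 ae1' ae2' => p [h1 h2] [h3 h4].
    apply: cvgM; first exact: cvg_cst.
    have -> : (2 * pi) ^+ 2 * rect X Y p = (2 * pi * \1_X p.1) * (2 * pi * \1_Y p.2).
      by rewrite /rect expr2 mulrACA.
    by apply: cvgM; [exact: cX|exact: cY].
  - apply: L1Z; have i4 := ug (a := 4^-1) (ltac:(by [])).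
    exact: (integrable_abse i4).
  - move=> n p; have d01 : 0 < damp R n <= 1 by rewrite damp_gt0 damp_le1.
    have /andP[h1 h1'] := H1 _ p.1 d01; have /andP[h2 h2'] := H2 _ p.2 d01.
    rewrite [leLHS]normrM (ger0_norm (mulr_ge0 h1 h2)) [in leRHS]normrM.
    rewrite (ger0_norm (g2_ge0 _ _)) [leRHS]mulrCA ler_wpM2l// /g2 [leRHS]mulrACA.
    exact: ler_pM.
have zero X Y : ocitv X -> ocitv Y ->
    \int[mu]_p (u p * ((2 * pi) ^+ 2 * rect X Y p)) = \int[mu]_y (rect X Y y * w y).
  by move=> oX oY; rewrite -(cvg_lim _ (lim1 X Y oX oY))// (cvg_lim _ (lim2 X Y oX oY)).
have uri X Y : ocitv X -> ocitv Y ->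
    L1 mu (fun p => u p * ((2 * pi) ^+ 2 * rect X Y p)).
  move=> oX oY; rewrite (_ : _ \o _ = fun p => ((2 * pi) ^+ 2)%:E * (u p * rect X Y p)%:E)%E.
    by apply: integrableZl => //; exact: ur.
  by apply/funext => p /=; rewrite mulrCA.
have := @ae_eq0_rectangles R (fun p => (2 * pi) ^+ 2 * u p - w p) _ _.
rewrite -/mu; move=> H; have : {ae mu, forall p, (2 * pi) ^+ 2 * u p - w p = 0}.
  apply: H.
    by apply: measurable_funB => //; exact: measurable_funM.
  move=> X Y oX oY.
  have mXY : measurable (X `*` Y : set (plane R)) by apply: measurableX; exact: ocitv_measurable.
  have E : (EFin \o (fun p : plane R => (2 * pi) ^+ 2 * u p - w p)) \_ (X `*` Y) =
    fun p => ((u p * ((2 * pi) ^+ 2 * rect X Y p))%:E - (rect X Y p * w p)%:E)%E.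
    apply/funext => p; rewrite patchE rect01 indicE -EFinB.
    by case: (_ \in _) => /=; congr EFin; ring.
  split.
    apply/(integrable_mkcond _ mXY); rewrite E; apply: integrableB => //.
      exact: uri.
    exact: wr.
  rewrite integral_mkcond E integralB//; [|exact: uri|exact: wr].
  have i1 := integrable_fin_num measurableT (uri X Y oX oY).
  have i2 := integrable_fin_num measurableT (wr X Y oX oY).
  have := zero X Y oX oY; rewrite /Rintegral => Z.
  by rewrite -(fineK i1) -(fineK i2) /= Z subee.
by apply: filterS => p /eqP; rewrite subr_eq0 => /eqP.
Qed.

End identification.

(** * Powers of 1 + |x| *)

Section japanese.
Context (R : realType).
Local Notation L := (@lebesgue_measure R).
Implicit Types (s x : R).

(** The sign is such that [jap s] decays for [s > 0]; negative [s] gives the growing weights of the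
    norms. *)
Definition jap s x : R := (1 + `|x|) `^ (- s).

Lemma jap_ge0 s x : 0 <= jap s x. Proof. exact: powR_ge0. Qed.

Let pos1 x : 0 < 1 + `|x|. Proof. by rewrite ltr_wpDr. Qed.

Let continuous_powRr s x : 0 < x -> {for x, continuous (fun y : R => y `^ s)}.
Proof.
move=> x0; apply: differentiable_continuous; apply/derivable1_diffP.
by have [] := is_derive1_powR s x0.
Qed.

Lemma continuous_jap s : continuous (jap s).
Proof.
move=> x; apply: (@continuous_comp _ _ _ (fun x : R => 1 + `|x|) (fun y => y `^ (- s))).
  apply: cvgD; first exact: cvg_cst.
  exact: norm_continuous.
exact: continuous_powRr.
Qed.

Lemma measurable_jap s : measurable_fun setT (jap s).
Proof. exact: continuous_measurable_fun (@continuous_jap s). Qed.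

(** By symmetry the half-line suffices, and there the antiderivative [F] vanishes at infinity
    because [s > 1]. *)
Lemma integrable_jap s : 1 < s -> L1 L (jap s).
Proof.
move=> s1; have s10 : 0 < s - 1 by rewrite subr_gt0.
apply/integrableP; split; first by apply/measurable_EFinP; exact: measurable_jap.
under eq_integral do rewrite /= ger0_norm ?jap_ge0//.
rewrite ge0_symfun_integralT//; last 3 first.
- by move=> x; exact: jap_ge0.
- exact: continuous_jap.
- by move=> x; rewrite /jap /= normrN.
rewrite -set_itvcy.
pose F x : R := - (s - 1)^-1 * (1 + x) `^ (1 - s).
pose f x : R := (1 + x) `^ (- s).
have dF x : 0 < 1 + x -> is_derive x 1 F (f x).
  move=> x0.
  have h : is_derive x 1 (fun y : R => 1 + y) 1.
    have := is_deriveD (is_derive_cst (1 : R) x 1) (is_derive_id x 1).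
    by rewrite add0r.
  have h2 := is_derive1_comp (is_derive1_powR (1 - s) x0) h.
  have h3 := is_deriveZ (- (s - 1)^-1) h2.
  move: h3; rewrite /GRing.scale /= mulr1 => h3.
  apply: is_derive_eq h3 _.
  rewrite mulrA (_ : - (s - 1)^-1 * (1 - s) = 1) ?mul1r; last by field; rewrite gt_eqF.
  by rewrite /f; congr (_ `^ _); ring.
have cf x : 0 < 1 + x -> {for x, continuous f}.
  move=> x0; apply: (@continuous_comp _ _ _ (fun x : R => 1 + x) (fun y => y `^ (- s))).
    by apply: cvgD; [exact: cvg_cst|exact: cvg_id].
  exact: continuous_powRr.
have -> : (\int[L]_(x in `[0%R, +oo[) (jap s x)%:E = \int[L]_(x in `[0%R, +oo[) (f x)%:E)%E.
  by apply: eq_integral => x; rewrite inE /= in_itv/= andbT => x0; rewrite /jap ger0_norm.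
rewrite (@ge0_continuous_FTC2y _ f F 0 0)//.
- by rewrite -EFinB -EFinM ltry.
- by move=> x x0; exact: powR_ge0.
- apply/continuous_within_itvcyP; split.
    by move=> x; rewrite in_itv/= andbT => x0; exact: cf (ltr_wpDr (ltW x0) ltr01).
  by apply: cvg_at_right_filter; apply: cf; rewrite addr0.
- apply/cvgr0Pnorm_le => eps eps0; set c := (s - 1)^-1.
  have c0 : 0 < c by rewrite invr_gt0.
  near=> x.
  (* The threshold is the solution x of c x^(1 - s) = eps. *)
  have xX : (c / eps) `^ (s - 1)^-1 <= x by near: x; exact: nbhs_pinfty_ge.
  have x0 : 0 <= x by apply: le_trans xX; exact: powR_ge0.
  have x1 : 0 < 1 + x by rewrite ltr_wpDr.
  rewrite /F normrM normrN (gtr0_norm c0) ger0_norm ?powR_ge0// -[1 - s]opprB powRN.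
  rewrite ler_pdivrMr ?powR_gt0// mulrC -ler_pdivrMr//.
  have -> : c / eps = ((c / eps) `^ (s - 1)^-1) `^ (s - 1).
    by rewrite -powRrM mulVf ?gt_eqF// powRr1// ltW// divr_gt0.
  rewrite ge0_ler_powR ?(ltW s10)// ?nnegrE ?powR_ge0 ?(ltW x1)//.
  by rewrite (le_trans xX)// lerDr.
- by move=> x x0; have [] := dF x (ltr_wpDr (ltW x0) ltr01).
- apply: cvg_at_right_filter; apply: differentiable_continuous; apply/derivable1_diffP.
  by have [] := dF 0 (ltac:(by rewrite addr0)).
- move=> x; rewrite in_itv/= andbT => x0; rewrite derive1E.
  by have [_ ->] := dF x (ltr_wpDr (ltW x0) ltr01).
Unshelve. all: by end_near. Qed.

End japanese.

(** * Schwartz functions and modulated Gaussians *)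

Section schwartz.
Context (R : realType).
Local Notation mu := (@pm R).
Implicit Types (u v : plane R -> R) (p q y : plane R).

Import HBSimple.

(** Schwartz functions are given through partial derivatives, so separate continuity is what is
    immediate. Replacing the first coordinate by simple functions that tend to it gives measurable
    functions, finite unions of rectangles being involved, and continuity in that coordinate gives
    the limit. *)
Lemma measurable_caratheodory u :
  (forall t : R, continuous (fun x : R => u (x, t))) ->
  (forall x : R, continuous (fun t : R => u (x, t))) ->
  measurable_fun setT u.
Proof.
move=> c1 c2.
have mE : measurable_fun setT (EFin : measurableTypeR R -> \bar R).
  by apply/measurable_EFinP; exact: measurable_id.
have [g Hg] := approximation_sfun measurableT mE.
have gx (x : R) : g n x @[n --> \oo] --> x.
  have := Hg x I; move=> /fine_cvg; exact.
apply: (measurable_fun_cvg (h := fun n p => u (g n p.1, p.2))).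
- move=> n _ B mB; rewrite setTI.
  rewrite (_ : _ @^-1` B = \bigcup_(r in range (g n))
     ((g n @^-1` [set r]) `*` ((fun t : R => u (r, t)) @^-1` B))).
    apply: fin_bigcup_measurable; first exact: fimfunP.
    move=> r _; apply: measurableX.
      by rewrite -[X in measurable X]setTI; apply: measurable_funP.
    rewrite -[X in measurable X]setTI.
    have := continuous_measurable_fun (c2 r); apply => //.
  apply/seteqP; split => [[x t] /= Bx|[x t] [r _ [/= <-]]//].
  by exists (g n x) => //; exists x.
- move=> [x t] _ /=; exact: (cvg_comp _ _ (gx x) (c1 t x)).
Qed.

Lemma rschwartz_cont1 u : rschwartz u -> forall t : R, continuous (fun x : R => u (x, t)).
Proof.
move=> su t x; have [d _] := su [::].
by apply: differentiable_continuous; apply/derivable1_diffP; exact: (d false (x, t)).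
Qed.

Lemma rschwartz_cont2 u : rschwartz u -> forall x : R, continuous (fun t : R => u (x, t)).
Proof.
move=> su x t; have [d _] := su [::].
by apply: differentiable_continuous; apply/derivable1_diffP; exact: (d true (x, t)).
Qed.

Lemma rschwartz_measurable u : rschwartz u -> measurable_fun setT u.
Proof.
move=> su; apply: measurable_caratheodory;
  [exact: rschwartz_cont1|exact: rschwartz_cont2].
Qed.

Lemma rschwartz_bounded u : rschwartz u -> exists M, forall p, `|u p| <= M.
Proof.
move=> su; have [_ /(_ 0%N)[M HM]] := su [::].
by exists M => p; have := HM p; rewrite expr0 mul1r.
Qed.

(** Decay of order 4 is shared equally between the coordinates, which leaves the integrable order 2
    in each. *)
Lemma rschwartz_integrable u : rschwartz u -> L1 mu u.
Proof.
move=> su; have [_ /(_ 4)[M HM]] := su [::].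
have s2 : (1 : R) < 2 by rewrite ltr1n.
have ji : L1 mu (fun p : plane R => M * (jap 2 p.1 * jap 2 p.2)).
  apply: L1Z; apply: pm_integrable_prod; exact: integrable_jap.
apply: le_integrable ji => //.
  by apply/measurable_EFinP; exact: rschwartz_measurable.
move=> p _ /=; rewrite lee_fin.
have M0 : 0 <= M by apply: le_trans (HM (0 : plane R)); rewrite mulr_ge0 ?exprn_ge0 ?addr_ge0.
rewrite [leRHS]ger0_norm ?mulr_ge0 ?jap_ge0//.
have a0 : 0 < 1 + `|p.1| by rewrite ltr_wpDr.
have b0 : 0 < 1 + `|p.2| by rewrite ltr_wpDr.
have jE (x : R) : jap 2 x = ((1 + `|x|) ^+ 2)^-1 by rewrite /jap powRN powR_mulrn// addr_ge0.
rewrite !jE -invfM ler_pdivlMr ?mulr_gt0 ?exprn_gt0//.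
apply: le_trans (HM p); rewrite mulrC ler_wpM2r//.
rewrite (_ : 4 = (2 + 2)%N)// exprD ler_pM ?exprn_ge0 ?(ltW a0) ?(ltW b0)//.
  by rewrite ler_sqr ?nnegrE ?(ltW a0) ?addr_ge0// lerDl.
by rewrite ler_sqr ?nnegrE ?(ltW b0) ?addr_ge0// lerD2r lerDl.
Qed.

Lemma rschwartz_L2 u : rschwartz u -> L2 mu u.
Proof.
move=> su; have [M HM] := rschwartz_bounded su.
have mu_ := rschwartz_measurable su; split => //.
have ui := rschwartz_integrable su.
have M0 : 0 <= M by apply: le_trans (HM (0 : plane R)).
have gi : L1 mu (fun p => M * `|u p|).
  by apply: L1Z; exact: (integrable_abse ui).
apply: le_lt_trans (integrable_lty measurableT gi).
apply: ge0_le_integral => //.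
- by move=> p _; rewrite lee_fin sqr_ge0.
- exact: measurable_sqr.
- exact: measurable_int gi.
- move=> p _; rewrite lee_fin -[leLHS]real_normK ?num_real// expr2 ler_wpM2r//.
Qed.

Let shift_derivable (f : R -> R) (x c : R) :
  derivable (fun z => f (z + c)) x 1 = derivable f (x + c) 1.
Proof.
have E : (fun h : R => h^-1 *: (((fun z : R => f (z + c)) \o shift x) (h *: 1) - f (x + c))) =
    (fun h : R => h^-1 *: ((f \o shift (x + c)) (h *: 1) - f (x + c))).
  by apply/funext => h; rewrite /= addrA.
by rewrite /derivable E.
Qed.

Let shift_derive1 (f : R -> R) (x c : R) :
  derive1 (fun z => f (z + c)) x = derive1 f (x + c).
Proof.
have E : (fun h : R => h^-1 *: (f (h + x + c) - f (x + c))) =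
    (fun h : R => h^-1 *: (f (h + (x + c)) - f (x + c))).
  by apply/funext => h; rewrite addrA.
by rewrite /derive1 E.
Qed.

Let slice_shift b u a p :
  slice b (fun p => u (p + a)) p = fun z => slice b u (p + a) (z + Defs.coord b a).
Proof. by case: b. Qed.

Let iter_partial_shift w u a :
  iter_partial w (fun p => u (p + a)) = fun p => iter_partial w u (p + a).
Proof.
elim: w => //= b w IH; rewrite IH /partial; apply/funext => p.
by rewrite slice_shift shift_derive1; case: b.
Qed.

(** Derivatives commute with translations, and [1 + |p|] is at most [(1 + |a|) * (1 + |p + a|)],
    with [|.|] the sum of the absolute values of the coordinates. *)
Lemma rschwartz_shift u a : rschwartz u -> rschwartz (fun p => u (p + a)).
Proof.
move=> su w; rewrite iter_partial_shift; have [d b] := su w; split.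
  by move=> s p; rewrite slice_shift shift_derivable; have := d s (p + a); case: s.
move=> k; have [M HM] := b k.
exists ((1 + `|a.1| + `|a.2|) ^+ k * M) => p.
apply: le_trans (_ : (1 + `|a.1| + `|a.2|) ^+ k *
   ((1 + `|(p + a).1| + `|(p + a).2|) ^+ k * `|iter_partial w u (p + a)|) <= _); last first.
  by rewrite ler_wpM2l ?exprn_ge0 ?addr_ge0.
rewrite mulrA ler_wpM2r// -exprMn lerXn2r ?nnegrE ?mulr_ge0 ?addr_ge0//.
have h1 : `|p.1| <= `|p.1 + a.1| + `|a.1|.
  by rewrite -[X in `|X| <= _](addrK a.1) (le_trans (ler_normB _ _)).
have h2 : `|p.2| <= `|p.2 + a.2| + `|a.2|.
  by rewrite -[X in `|X| <= _](addrK a.2) (le_trans (ler_normB _ _)).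
have := normr_ge0 (p.1 + a.1); have := normr_ge0 (p.2 + a.2).
have := normr_ge0 a.1; have := normr_ge0 a.2.
by move: h1 h2 => /=; nra.
Qed.

(* A class stable under both partial derivatives: the phase [c] covers the
   sines, which are shifted cosines. *)
Inductive gpoly (e : R) y : (plane R -> R) -> Prop :=
| gpoly_cos i j c :
    gpoly e y (fun p => p.1 ^+ i * p.2 ^+ j * (g2 e p * cos (dot y p + c)))
| gpoly_add u v : gpoly e y u -> gpoly e y v -> gpoly e y (fun p => u p + v p)
| gpoly_scale c u : gpoly e y u -> gpoly e y (fun p => c * u p).

Let gauss_pow_bound e N : 0 < e -> exists M, forall x : R, (1 + `|x|) ^+ N * gauss e x <= M.
Proof.
(* Each factor [1 + |x|] is at most [(2 + c^-1) * expR (c * x ^+ 2)]. As [N * c <= e / 2], the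
   Gaussian compensates all [N] exponentials; [N.+1] keeps [c] positive for [N = 0]. *)
move=> e0; pose c := e / 2 / N.+1%:R.
have c0 : 0 < c by rewrite !divr_gt0.
exists ((2 + c^-1) ^+ N) => x.
have C0 : 0 <= 2 + c^-1 by rewrite addr_ge0// invr_ge0 ltW.
have h1 : 1 + `|x| <= (2 + c^-1) * expR (c * x ^+ 2).
  have h : 1 + c * x ^+ 2 <= expR (c * x ^+ 2) by exact: expR_ge1Dx.
  apply: le_trans (_ : (2 + c^-1) * (1 + c * x ^+ 2) <= _); last by rewrite ler_wpM2l.
  have -> : (2 + c^-1) * (1 + c * x ^+ 2) = 2 + 2 * (c * x ^+ 2) + c^-1 + x ^+ 2.
    by field; rewrite gt_eqF.
  have h2 : `|x| <= 1 + x ^+ 2.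
    rewrite -(real_normK (num_real x)); have := normr_ge0 x.
    by move: `|x| => z z0; nra.
  have h3 : 0 <= c * x ^+ 2 by rewrite mulr_ge0 ?sqr_ge0 ?ltW.
  have h4 : 0 <= c^-1 by rewrite invr_ge0 ltW.
  by lra.
apply: le_trans (_ : ((2 + c^-1) * expR (c * x ^+ 2)) ^+ N * gauss e x <= _).
  by rewrite ler_wpM2r ?gauss_ge0// lerXn2r ?nnegrE ?addr_ge0 ?mulr_ge0 ?expR_ge0.
rewrite exprMn -mulrA ler_piMr ?exprn_ge0// -expRM_natl /gauss -expRD -[leRHS]expR0 ler_expR.
rewrite subr_le0 -[_ *+ N]mulr_natl mulrA ler_wpM2r ?sqr_ge0//.
rewrite /c mulrCA ler_piMr ?divr_ge0 ?(ltW e0)//.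
by rewrite mulr1 ler_pdivrMr// mul1r ler_nat.
Qed.

Let g2_pow_bound e N : 0 < e ->
  exists M, forall p, (1 + `|p.1| + `|p.2|) ^+ N * g2 e p <= M.
Proof.
move=> e0; have [M HM] := gauss_pow_bound N e0; exists (M * M) => p.
apply: le_trans (_ : ((1 + `|p.1|) ^+ N * gauss e p.1) * ((1 + `|p.2|) ^+ N * gauss e p.2) <= _).
  rewrite mulrACA -exprMn /g2 ler_wpM2r ?mulr_ge0 ?gauss_ge0// lerXn2r ?nnegrE ?addr_ge0 ?mulr_ge0 ?addr_ge0//.
  by have := normr_ge0 p.1; have := normr_ge0 p.2; nra.
by rewrite ler_pM ?mulr_ge0 ?gauss_ge0 ?exprn_ge0 ?addr_ge0.
Qed.

Let mono_le e i j p (t : R) : `|t| <= 1 ->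
  `|p.1 ^+ i * p.2 ^+ j * (g2 e p * t)| <= (1 + `|p.1| + `|p.2|) ^+ (i + j) * g2 e p.
Proof.
move=> t1; rewrite normrM [`|g2 e p * t|]normrM (ger0_norm (g2_ge0 _ _)) normrM !normrX exprD.
apply: ler_pM; rewrite ?(mulr_ge0 (g2_ge0 _ _) (normr_ge0 _)) ?(mulr_ge0 (exprn_ge0 _ (normr_ge0 _)) (exprn_ge0 _ (normr_ge0 _)))//.
  by rewrite ler_pM ?exprn_ge0// lerXn2r ?nnegrE ?addr_ge0//;
    have := normr_ge0 p.2; have := normr_ge0 p.1; lra.
by rewrite ler_piMr ?g2_ge0.
Qed.

Lemma gpoly_decay e y u : 0 < e -> gpoly e y u ->
  forall k : nat, exists M : R, forall p, (1 + `|p.1| + `|p.2|) ^+ k * `|u p| <= M.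
Proof.
move=> e0; elim=> [i j b|{}u v _ IHu _ IHv|c {}u _ IHu] k.
- have [M HM] := g2_pow_bound (k + (i + j)) e0; exists M => p.
  apply: le_trans (HM p); rewrite exprD -[leRHS]mulrA ler_wpM2l ?exprn_ge0 ?addr_ge0//.
  by apply: mono_le; exact: norm_cos_le1.
- have [M HM] := IHu k; have [N HN] := IHv k; exists (M + N) => p.
  by rewrite (le_trans _ (lerD (HM p) (HN p)))// -mulrDr ler_wpM2l ?exprn_ge0 ?addr_ge0 ?ler_normD.
- have [M HM] := IHu k; exists (`|c| * M) => p.
  by rewrite normrM mulrCA ler_wpM2l.
Qed.

Let is_derive_phase (a c x : R) : is_derive x 1 (fun z : R => a * z + c) a.
Proof.
have h := is_deriveD (is_deriveZ a (is_derive_id x (1 : R))) (is_derive_cst c x (1 : R)).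
move: h; rewrite addr0 /GRing.scale /= mulr1 => h; exact: h.
Qed.

Let is_derive_pow i (x : R) : is_derive x 1 (fun z : R => z ^+ i) (i%:R * x ^+ i.-1).
Proof.
have h := is_deriveX i (is_derive_id x (1 : R)).
move: h; rewrite /GRing.scale /= mulr1 mulr_natl => h.
rewrite (_ : (fun z => _) = (id : R -> R) ^+ i); first exact: h.
by apply/funext => z; elim: i {h} => //= i IH; rewrite !exprS IH.
Qed.

(** The derivative of the cosine is written as a cosine with phase advanced by pi / 2. For [i = 0]
    the coefficient [i%:R] cancels the term with exponent [i.-1]. *)
Let dcos k i e (a c x : R) : is_derive x 1
  (fun z : R => k * (z ^+ i * (gauss e z * cos (a * z + c))))
  (i%:R * (k * (x ^+ i.-1 * (gauss e x * cos (a * x + c))))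
   + (- e) * (k * (x ^+ i.+1 * (gauss e x * cos (a * x + c))))
   + a * (k * (x ^+ i * (gauss e x * cos (a * x + c + pi / 2))))).
Proof.
have h1 := is_derive_pow i x; have h2 := is_derive_gauss e x.
have h3 := is_derive1_comp (is_derive_cos _) (is_derive_phase a c x).
have h := is_deriveZ k (is_deriveM h1 (is_deriveM h2 h3)).
apply: is_derive_eq h _; rewrite /GRing.scale /= exprS cosDpihalf.
rewrite -[(gauss e * _) x]/(gauss e x * cos (a * x + c)).
by move: (x ^+ i.-1) (x ^+ i) (gauss e x) (cos _) (sin _) => ? ? ? ? ?; ring.
Qed.

Let gpoly_cos1 e y i j c c' : gpoly e y (fun p =>
  p.2 ^+ j * gauss e p.2 * (p.1 ^+ i * (gauss e p.1 * cos (y.1 * p.1 + (y.2 * p.2 + c) + c')))).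
Proof.
have := gpoly_cos e y i j (c + c'); congr gpoly.
by apply/funext => p; rewrite /g2 /dot !addrA; ring.
Qed.

Let gpoly_cos2 e y i j c c' : gpoly e y (fun p =>
  p.1 ^+ i * gauss e p.1 * (p.2 ^+ j * (gauss e p.2 * cos (y.2 * p.2 + (y.1 * p.1 + c) + c')))).
Proof.
have := gpoly_cos e y i j (c + c'); congr gpoly.
by apply/funext => p; rewrite /g2 /dot [y.2 * _ + (_ + _)]addrA [y.2 * _ + _]addrC !addrA; ring.
Qed.

Lemma gpoly_derive e y u : gpoly e y u -> forall b : bool,
  exists2 du, gpoly e y du & forall p, is_derive (Defs.coord b p) 1 (slice b u p) (du p).
Proof.
elim=> [i j c|{}u v _ IHu _ IHv|c {}u _ IHu] b.
- case: b.
  + have G := gpoly_add (gpoly_add (gpoly_scale j%:R (gpoly_cos2 e y i j.-1 c 0))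
      (gpoly_scale (- e) (gpoly_cos2 e y i j.+1 c 0)))
      (gpoly_scale y.2 (gpoly_cos2 e y i j c (pi / 2))).
    eexists; first exact: G.
    move=> p /=; rewrite !addr0; have := dcos (p.1 ^+ i * gauss e p.1) j e y.2 (y.1 * p.1 + c) p.2.
    congr (is_derive _ _ _ _); apply/funext => z.
    by rewrite /slice /g2 /dot /= addrA [y.2 * _ + _]addrC; ring.
  + have G := gpoly_add (gpoly_add (gpoly_scale i%:R (gpoly_cos1 e y i.-1 j c 0))
      (gpoly_scale (- e) (gpoly_cos1 e y i.+1 j c 0)))
      (gpoly_scale y.1 (gpoly_cos1 e y i j c (pi / 2))).
    eexists; first exact: G.
    move=> p /=; rewrite !addr0; have := dcos (p.2 ^+ j * gauss e p.2) i e y.1 (y.2 * p.2 + c) p.1.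
    congr (is_derive _ _ _ _); apply/funext => z.
    by rewrite /slice /g2 /dot /= addrA; ring.
- have [du Du du_] := IHu b; have [dv Dv dv_] := IHv b.
  exists (fun p => du p + dv p); first exact: gpoly_add.
  move=> p; have := is_deriveD (du_ p) (dv_ p).
  by rewrite (_ : _ + _ = slice b (fun p => u p + v p) p)//; case: b {IHu IHv du_ dv_}.
- have [du Du du_] := IHu b.
  exists (fun p => c * du p); first exact: gpoly_scale.
  move=> p; have := is_deriveZ c (du_ p).
  by rewrite (_ : _ \*: _ = slice b (fun p => c * u p) p)//; case: b {IHu du_}.
Qed.

Lemma rschwartz_gpoly e y u : 0 < e -> gpoly e y u -> rschwartz u.
Proof.
move=> e0 gu w.
suff gw : gpoly e y (iter_partial w u).
  split; last exact: (gpoly_decay e0 gw).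
  by move=> b p; have [du _ /(_ p)[]] := gpoly_derive gw b.
elim: w => //= b w IH; have [du gdu ddu] := gpoly_derive IH b.
rewrite (_ : partial b _ = du)//; apply/funext => p.
by rewrite /partial derive1E; have [_ ->] := ddu p.
Qed.

Lemma rschwartz_gcos e y : 0 < e -> rschwartz (fun p => g2 e p * cos (dot y p)).
Proof.
move=> e0; apply: (rschwartz_gpoly (y := y) e0).
by have := gpoly_cos e y 0 0 0; congr gpoly; apply/funext => p; rewrite !expr0 !mul1r addr0.
Qed.

Lemma rschwartz_gsin e y : 0 < e -> rschwartz (fun p => g2 e p * sin (dot y p)).
Proof.
move=> e0; apply: (rschwartz_gpoly (y := y) e0).
have := gpoly_cos e y 0 0 (- (pi / 2)); congr gpoly; apply/funext => p.
by rewrite !expr0 !mul1r cosBpihalf.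
Qed.

End schwartz.

(** * Fourier pairs in real and imaginary parts *)

Section real_pair.
Context (R : realType).
Local Notation mu := (@pm R).
Implicit Types (A B a u : plane R -> R) (p q r y : plane R) (f F phi : plane R -> R[i]).

Lemma ReM (x y : R[i]) : complex.Re (x * y) =
  complex.Re x * complex.Re y - complex.Im x * complex.Im y.
Proof. by case: x => a b; case: y. Qed.

Lemma ImM (x y : R[i]) : complex.Im (x * y) =
  complex.Re x * complex.Im y + complex.Im x * complex.Re y.
Proof. by case: x => a b; case: y. Qed.

Lemma sqr_normc (x : R[i]) : complex.Re `|x| ^+ 2 = complex.Re x ^+ 2 + complex.Im x ^+ 2.
Proof. by case: x => a b /=; rewrite sqr_sqrtr// addr_ge0 ?sqr_ge0. Qed.

Lemma integrable_lin (x y : R) A B :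
  L1 mu A -> L1 mu B ->
  L1 mu (fun p => x * A p + y * B p).
Proof.
move=> iA iB.
by apply: L1D; exact: L1Z.
Qed.

Lemma Rintegral_lin (x y : R) A B :
  L1 mu A -> L1 mu B ->
  \int[mu]_p (x * A p + y * B p) = x * \int[mu]_p A p + y * \int[mu]_p B p.
Proof.
move=> iA iB; rewrite RintegralD//.
- by rewrite !RintegralZl.
- by apply: L1Z.
- by apply: L1Z.
Qed.

(** Fubini's theorem and the symmetry of [dot], for the cosine and the sine at once. *)
Let kernel_duality (k : R -> R) a B : measurable_fun setT k -> (forall x, `|k x| <= 1) ->
  L1 mu a -> L1 mu B ->
  \int[mu]_y (a y * \int[mu]_q (B q * k (dot y q))) =
  \int[mu]_q (B q * \int[mu]_y (a y * k (dot q y))).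
Proof.
move=> mk k1 ia iB; have ma := L1_measurable ia; have mB := L1_measurable iB.
have mkd y : measurable_fun setT (fun q => k (dot y q)).
  exact: (measurableT_comp mk (measurable_dotr y)).
have i : L1 (mu \x mu)%E (fun z : plane R * plane R => a z.1 * (B z.2 * k (dot z.1 z.2))).
  apply: integrable_tensor ia iB _ _ => [|y q] /=.
    apply: measurable_funM; first exact: (measurableT_comp ma).
    apply: measurable_funM; first exact: (measurableT_comp mB).
    exact: (measurableT_comp mk (@measurable_dot R)).
  by rewrite !normrM ler_wpM2l// ler_piMr.
transitivity (\int[mu]_y \int[mu]_q (a y * (B q * k (dot y q)))).
  by apply: eq_Rintegral => y _; rewrite RintegralZl//; exact: integrable_mul_bounded.
rewrite (Rfubini i) /=; apply: eq_Rintegral => q _.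
under eq_Rintegral => y _ do rewrite mulrCA dotC.
by rewrite RintegralZl//; exact: integrable_mul_bounded.
Qed.

Lemma cos_tr_duality a B : L1 mu a -> L1 mu B ->
  \int[mu]_y (a y * cos_tr B y) = \int[mu]_q (B q * cos_tr a q).
Proof. by apply: kernel_duality; [exact: measurable_cos|exact: norm_cos_le1]. Qed.

Lemma sin_tr_duality a B : L1 mu a -> L1 mu B ->
  \int[mu]_y (a y * sin_tr B y) = \int[mu]_q (B q * sin_tr a q).
Proof. by apply: kernel_duality; [exact: measurable_sin|exact: norm_sin_le1]. Qed.

Lemma L2_tr a : L1 mu a -> L2 mu a ->
  L2 mu (cos_tr a) /\ L2 mu (sin_tr a).
Proof.
move=> ia aL.
have mc := measurable_cos_tr ia; have ms := measurable_sin_tr ia.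
have lt : (\int[mu]_y (cos_tr a y ^+ 2 + sin_tr a y ^+ 2)%:E < +oo)%E.
  apply: (le_lt_trans (plancherel_le ia)).
  by rewrite -(fineK (L2_fin aL)) -EFinM ltry.
split; split => //; apply: le_lt_trans lt; apply: ge0_le_integral => //.
- by move=> x _; rewrite lee_fin sqr_ge0.
- exact: measurable_sqr.
- by apply/measurable_EFinP; apply: measurable_funD; apply: measurable_funX.
- by move=> x _; rewrite lee_fin lerDl sqr_ge0.
- by move=> x _; rewrite lee_fin sqr_ge0.
- exact: measurable_sqr.
- by apply/measurable_EFinP; apply: measurable_funD; apply: measurable_funX.
- by move=> x _; rewrite lee_fin lerDr sqr_ge0.
Qed.

Lemma rschwartz0 : rschwartz (fun=> 0 : R).
Proof.
have E w : iter_partial w (fun=> 0 : R) = fun=> 0.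
  elim: w => //= b w ->; apply/funext => p; rewrite /partial derive1E.
  by rewrite (_ : slice _ _ _ = cst 0) ?derive_cst//; case: b.
move=> w; rewrite E; split.
  by move=> b p; rewrite (_ : slice _ _ _ = cst 0) ?derivable_cst//; case: b.
by move=> k; exists 0 => p; rewrite normr0 mulr0.
Qed.

(* Testing against real functions is enough, by complex linearity. *)
Definition real_pair (g1 g2 G1 G2 : plane R -> R) : Prop :=
  [/\ measurable_fun setT g1 /\ measurable_fun setT g2,
      forall u, rschwartz u -> L1 mu (fun p => g1 p * u p) /\
        L1 mu (fun p => g2 p * u p) &
      forall u, rschwartz u ->
        \int[mu]_p (g1 p * cos_tr u p + g2 p * sin_tr u p) = \int[mu]_q (G1 q * u q) /\
        \int[mu]_p (g2 p * cos_tr u p - g1 p * sin_tr u p) = \int[mu]_q (G2 q * u q)].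

Lemma Re_fourier_integral phi : schwartz phi -> forall q,
  complex.Re (fourier_integral phi q) =
  cos_tr (fun p => complex.Re (phi p)) q + sin_tr (fun p => complex.Im (phi p)) q.
Proof.
move=> [s1 s2] q; rewrite /fourier_integral /cintegral /= plane_measureE.
have i1 := integrable_cdot (rschwartz_integrable s1) q.
have i2 := integrable_sdot (rschwartz_integrable s2) q.
rewrite /cos_tr /sin_tr -RintegralD//; apply: eq_Rintegral => p _.
by rewrite ReM /= cosN sinN mulrN opprK /dot ![q.1 * _]mulrC ![q.2 * _]mulrC.
Qed.

Lemma Im_fourier_integral phi : schwartz phi -> forall q,
  complex.Im (fourier_integral phi q) =
  cos_tr (fun p => complex.Im (phi p)) q - sin_tr (fun p => complex.Re (phi p)) q.
Proof.
move=> [s1 s2] q; rewrite /fourier_integral /cintegral /= plane_measureE.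
have i1 := integrable_cdot (rschwartz_integrable s2) q.
have i2 := integrable_sdot (rschwartz_integrable s1) q.
rewrite /cos_tr /sin_tr -RintegralB//; apply: eq_Rintegral => p _.
by rewrite ImM /= cosN sinN mulrN addrC /dot ![q.1 * _]mulrC ![q.2 * _]mulrC.
Qed.

Lemma tempered_real f : tempered f -> forall u, rschwartz u ->
  L1 mu (fun p => complex.Re (f p) * u p) /\
  L1 mu (fun p => complex.Im (f p) * u p).
Proof.
move=> [_ tf] u su.
have [] := tf (fun p => Complex (u p) 0) (conj su rschwartz0).
rewrite plane_measureE => h1 h2; split; [move: h1|move: h2]; congr integrable;
  by apply/funext => p; rewrite /= (ReM, ImM) /= mulr0 ?subr0 ?add0r.
Qed.

(** The transform of a real [u] is [cos_tr u - i sin_tr u], and the integrands of [real_pair] are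
    the real and imaginary parts of its product with [f]. *)
Lemma is_fourier_real f F : is_fourier f F ->
  real_pair (fun p => complex.Re (f p)) (fun p => complex.Im (f p))
            (fun p => complex.Re (F p)) (fun p => complex.Im (F p)).
Proof.
move=> [tf tF fF]; split; first by case: tf.
  exact: tempered_real.
move=> u su.
have sc : schwartz (fun p => Complex (u p) 0) by split => //; exact: rschwartz0.
have z1 q : cos_tr (fun=> 0 : R) q = 0.
  rewrite /cos_tr -[RHS](mul0r (fine (mu setT))) -Rintegral_cst//.
  by apply: eq_Rintegral => p _; rewrite mul0r.
have z2 q : sin_tr (fun=> 0 : R) q = 0.
  rewrite /sin_tr -[RHS](mul0r (fine (mu setT))) -Rintegral_cst//.
  by apply: eq_Rintegral => p _; rewrite mul0r.
have := fF _ sc; rewrite /cintegral plane_measureE => -[h1 h2]; split.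
  transitivity (\int[mu]_q complex.Re (F q * Complex (u q) 0)); last first.
    by apply: eq_Rintegral => q _; rewrite ReM /= mulr0 subr0.
  rewrite -h1; apply: eq_Rintegral => p _.
  by rewrite ReM Re_fourier_integral// Im_fourier_integral//= z1 z2 addr0 sub0r mulrN opprK.
transitivity (\int[mu]_q complex.Im (F q * Complex (u q) 0)); last first.
  by apply: eq_Rintegral => q _; rewrite ImM /= mulr0 add0r.
rewrite -h2; apply: eq_Rintegral => p _.
by rewrite ImM Re_fourier_integral// Im_fourier_integral//= z1 z2 addr0 sub0r mulrN addrC.
Qed.

Lemma real_tempered f : cmeasurable f ->
  (forall u, rschwartz u ->
    L1 mu (fun p => complex.Re (f p) * u p) /\
    L1 mu (fun p => complex.Im (f p) * u p)) -> tempered f.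
Proof.
move=> mf fi; split => // phi [s1 s2].
have [i11 i21] := fi _ s1; have [i12 i22] := fi _ s2.
split; rewrite plane_measureE.
  have := integrable_lin 1 (-1) i11 i22; congr integrable.
  by apply/funext => p; rewrite /= ReM mul1r mulN1r.
have := integrable_lin 1 1 i12 i21; congr integrable.
by apply/funext => p; rewrite /= ImM !mul1r.
Qed.

(** For phi = u + i v, the identities for u and v are recombined linearly; the four integrability
    conditions allow the integrals of sums to be split. *)
Lemma real_is_fourier f F : tempered f -> tempered F ->
  real_pair (fun p => complex.Re (f p)) (fun p => complex.Im (f p))
            (fun p => complex.Re (F p)) (fun p => complex.Im (F p)) ->
  (forall u, rschwartz u ->
    [/\ L1 mu (fun p => complex.Re (f p) * cos_tr u p),
        L1 mu (fun p => complex.Im (f p) * cos_tr u p),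
        L1 mu (fun p => complex.Re (f p) * sin_tr u p) &
        L1 mu (fun p => complex.Im (f p) * sin_tr u p)]) ->
  is_fourier f F.
Proof.
move=> tf tF [_ _ fF] fi; split => // phi [s1 s2].
have sc : schwartz phi by [].
have [a1 a2] := fF _ s1; have [b1 b2] := fF _ s2.
have [iF11 iF21] := tempered_real tF s1; have [iF12 iF22] := tempered_real tF s2.
have [i1 i2 i3 i4] := fi _ s1; have [j1 j2 j3 j4] := fi _ s2.
have i14 := integrable_lin 1 1 i1 i4; have i23 := integrable_lin 1 (-1) i2 i3.
have j14 := integrable_lin 1 1 j1 j4; have j23 := integrable_lin 1 (-1) j2 j3.
have k1 := Rintegral_lin 1 (-1) i14 j23; have k2 := Rintegral_lin 1 1 j14 i23.
have l1 := Rintegral_lin 1 (-1) iF11 iF22; have l2 := Rintegral_lin 1 1 iF12 iF21.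
rewrite /cintegral plane_measureE; congr Complex.
  transitivity (1 * \int[mu]_q (complex.Re (F q) * complex.Re (phi q)) +
     -1 * \int[mu]_q (complex.Im (F q) * complex.Im (phi q))); last first.
    by rewrite -l1; apply: eq_Rintegral => q _; rewrite ReM mul1r mulN1r.
  rewrite -a1 -b2.
  transitivity (1 * \int[mu]_p (1 * (complex.Re (f p) * cos_tr (fun p => complex.Re (phi p)) p) +
     1 * (complex.Im (f p) * sin_tr (fun p => complex.Re (phi p)) p)) +
   -1 * \int[mu]_p (1 * (complex.Im (f p) * cos_tr (fun p => complex.Im (phi p)) p) +
     -1 * (complex.Re (f p) * sin_tr (fun p => complex.Im (phi p)) p))).
    rewrite -k1; apply: eq_Rintegral => q _.
    by rewrite ReM Re_fourier_integral// Im_fourier_integral//; ring.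
  by congr (_ * _ + _ * _); apply: eq_Rintegral => q _; rewrite !mul1r ?mulN1r.
transitivity (1 * \int[mu]_q (complex.Re (F q) * complex.Im (phi q)) +
     1 * \int[mu]_q (complex.Im (F q) * complex.Re (phi q))); last first.
  by rewrite -l2; apply: eq_Rintegral => q _; rewrite ImM !mul1r.
rewrite -b1 -a2.
transitivity (1 * \int[mu]_p (1 * (complex.Re (f p) * cos_tr (fun p => complex.Im (phi p)) p) +
     1 * (complex.Im (f p) * sin_tr (fun p => complex.Im (phi p)) p)) +
   1 * \int[mu]_p (1 * (complex.Im (f p) * cos_tr (fun p => complex.Re (phi p)) p) +
     -1 * (complex.Re (f p) * sin_tr (fun p => complex.Re (phi p)) p))).
  rewrite -k2; apply: eq_Rintegral => q _.
  by rewrite ImM Re_fourier_integral// Im_fourier_integral//; ring.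
by congr (_ * _ + _ * _); apply: eq_Rintegral => q _; rewrite !mul1r ?mulN1r.
Qed.

End real_pair.

(** * Square integrability of a function with square integrable transform *)

Section pair_L2.
Context (R : realType).
Local Notation mu := (@pm R).
Implicit Types (A B a u : plane R -> R) (p q r y : plane R) (e : R).

(** A modulated Gaussian has two translated Gaussians as its transform. Product-to-sum formulas give
    this and the three variants that follow. *)
Lemma g2_coscos e y p : 0 < e -> cos_tr (fun q => g2 e q * cos (dot y q)) p =
  2^-1 * pk e (p - y) + 2^-1 * pk e (p + y).
Proof.
move=> e0; have ig := integrable_g2 e0.
rewrite /pk -!g2_cos// -Rintegral_lin; try exact: integrable_cdot.
apply: eq_Rintegral => q _; rewrite ![dot _ q]dotC dotBr dotDr cosB cosD.
by move: (g2 e q) (cos _) (sin _) (cos _) (sin _) => a b c d f; field.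
Qed.

Lemma g2_sinsin e y p : 0 < e -> sin_tr (fun q => g2 e q * sin (dot y q)) p =
  2^-1 * pk e (p - y) + - 2^-1 * pk e (p + y).
Proof.
move=> e0; have ig := integrable_g2 e0.
rewrite /pk -!g2_cos// -Rintegral_lin; try exact: integrable_cdot.
apply: eq_Rintegral => q _; rewrite ![dot _ q]dotC dotBr dotDr cosB cosD.
by move: (g2 e q) (cos _) (sin _) (cos _) (sin _) => a b c d f; field.
Qed.

Lemma g2_cossin e y p : 0 < e -> sin_tr (fun q => g2 e q * cos (dot y q)) p = 0.
Proof.
move=> e0; have ig := integrable_g2 e0.
transitivity (2^-1 * sin_tr (g2 e) (p - y) + 2^-1 * sin_tr (g2 e) (p + y)); last first.
  by rewrite /sin_tr !g2_sin// !mulr0 addr0.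
rewrite /sin_tr -Rintegral_lin; try exact: integrable_sdot.
apply: eq_Rintegral => q _; rewrite ![dot _ q]dotC dotBr dotDr sinB sinD.
by move: (g2 e q) (cos _) (sin _) (cos _) (sin _) => a b c d f; field.
Qed.

Lemma g2_sincos e y p : 0 < e -> cos_tr (fun q => g2 e q * sin (dot y q)) p = 0.
Proof.
move=> e0; have ig := integrable_g2 e0.
transitivity (2^-1 * sin_tr (g2 e) (p + y) + - 2^-1 * sin_tr (g2 e) (p - y)); last first.
  by rewrite /sin_tr !g2_sin// !mulr0 addr0.
rewrite /sin_tr -Rintegral_lin; try exact: integrable_sdot.
apply: eq_Rintegral => q _; rewrite ![dot _ q]dotC dotBr dotDr sinB sinD.
by move: (g2 e q) (cos _) (sin _) (cos _) (sin _) => a b c d f; field.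
Qed.

Lemma rschwartz_g2 e : 0 < e -> rschwartz (g2 e : plane R -> R).
Proof.
move=> e0; have := rschwartz_gcos (0 : plane R) e0; congr rschwartz.
by apply/funext => p; rewrite /dot /= !mul0r addr0 cos0 mulr1.
Qed.

Variables g1 g2' G1 G2 : plane R -> R.
Hypothesis gG : real_pair g1 g2' G1 G2.
Hypotheses (G1L : L2 mu G1) (G2L : L2 mu G2).

Let integrable_pk_ e y : 0 < e ->
  L1 mu (fun p => g1 p * pk e (p + y)) /\
  L1 mu (fun p => g2' p * pk e (p + y)).
Proof.
move=> e0; have e0' : 0 < e^-1 by rewrite invr_gt0.
have [_ gi _] := gG.
have [i1 i2] := gi _ (rschwartz_shift y (rschwartz_g2 e0')).
split.
  have := integrable_lin (2 * pi / e) 0 i1 i1; congr integrable.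
  by apply/funext => p; rewrite /= /pk mul0r addr0 mulrCA.
have := integrable_lin (2 * pi / e) 0 i2 i2; congr integrable.
by apply/funext => p; rewrite /= /pk mul0r addr0 mulrCA.
Qed.

(** The test functions are [g2 e] times the cosine and the sine of [dot y]. Their transforms contain
    kernels centred at [y] and at [- y], and the combination taken here cancels those at [- y]. *)
Lemma pair_pk n y : \int[mu]_p (g1 p * pk (damp R n) (p - y)) = ifour G1 G2 n y /\
  \int[mu]_p (g2' p * pk (damp R n) (p - y)) = ifour G2 (fun q => - G1 q) n y.
Proof.
have e0 := damp_gt0 R n; set e := damp R n in e0 *.
have [i1 i2] := integrable_pk_ (- y) e0; have [j1 j2] := integrable_pk_ y e0.
have [_ _ gF] := gG.
have [c1 c2] := gF _ (rschwartz_gcos y e0); have [s1 s2] := gF _ (rschwartz_gsin y e0).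
have E1 : 2^-1 * \int[mu]_p (g1 p * pk e (p - y)) + 2^-1 * \int[mu]_p (g1 p * pk e (p + y))
   = cos_tr (fun q => G1 q * g2 e q) y.
  rewrite -Rintegral_lin// /cos_tr; under [RHS]eq_Rintegral do rewrite -mulrA.
  rewrite -c1; apply: eq_Rintegral => p _; rewrite g2_coscos// g2_cossin//.
  by rewrite mulr0 addr0 mulrDr ![g1 p * (2^-1 * _)]mulrCA.
have E2 : - 2^-1 * \int[mu]_p (g1 p * pk e (p - y)) + 2^-1 * \int[mu]_p (g1 p * pk e (p + y))
   = sin_tr (fun q => G2 q * g2 e q) y.
  rewrite -Rintegral_lin// /sin_tr; under [RHS]eq_Rintegral do rewrite -mulrA.
  rewrite -s2; apply: eq_Rintegral => p _; rewrite g2_sinsin// g2_sincos//.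
  by rewrite mulr0 sub0r; move: (pk _ _) (pk _ _) => ? ?; ring.
have E3 : 2^-1 * \int[mu]_p (g2' p * pk e (p - y)) + 2^-1 * \int[mu]_p (g2' p * pk e (p + y))
   = cos_tr (fun q => G2 q * g2 e q) y.
  rewrite -Rintegral_lin// /cos_tr; under [RHS]eq_Rintegral do rewrite -mulrA.
  rewrite -c2; apply: eq_Rintegral => p _; rewrite g2_coscos// g2_cossin//.
  by rewrite mulr0 subr0 mulrDr ![g2' p * (2^-1 * _)]mulrCA.
have E4 : 2^-1 * \int[mu]_p (g2' p * pk e (p - y)) + - 2^-1 * \int[mu]_p (g2' p * pk e (p + y))
   = sin_tr (fun q => G1 q * g2 e q) y.
  rewrite -Rintegral_lin// /sin_tr; under [RHS]eq_Rintegral do rewrite -mulrA.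
  rewrite -s1; apply: eq_Rintegral => p _; rewrite g2_sinsin// g2_sincos//.
  by rewrite mulr0 add0r; move: (pk _ _) (pk _ _) => ? ?; ring.
have E5 : sin_tr (fun q => - G1 q * g2 e q) y = - sin_tr (fun q => G1 q * g2 e q) y.
  rewrite /sin_tr -[RHS]mulN1r -RintegralZl//; last first.
    exact: (integrable_sdot (integrable_damped n G1L)).
  by apply: eq_Rintegral => q _; rewrite mulN1r -!mulNr.
split; rewrite /ifour -/e; [rewrite -E1 -E2|rewrite E5 -E3 -E4];
  by move: (\int[mu]_p _) (\int[mu]_p _) => s t; field.
Qed.

Let integrable_g2_ e : 0 < e ->
  L1 mu (fun p => g1 p * g2 e p) /\
  L1 mu (fun p => g2' p * g2 e p).
Proof. by move=> e0; have [_ gi _] := gG; exact: gi (rschwartz_g2 e0). Qed.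

Let kap : R := (2 * pi) ^+ 2.

(** The mollifications of [u] are damped Fourier integrals by assumption, so they have an L^2 limit;
    [ae_identification] shows that this limit is [kap * u]. *)
Let recover (u A B : plane R -> R) : L2 mu A -> L2 mu B -> measurable_fun setT u ->
  (forall e, 0 < e -> L1 mu (fun p => u p * g2 e p)) ->
  (forall n y, \int[mu]_p (u p * pk (damp R n) (p - y)) = ifour A B n y) ->
  L2 mu u /\ exists2 e : nat -> R, e n @[n --> \oo] --> (0 : R) &
    forall n, (\int[mu]_y ((ifour A B n y - kap * u y) ^+ 2)%:E <= (e n)%:E)%E.
Proof.
move=> AL BL mu_ ui uW.
have [w [e [wL e0 we]]] := fourier_L2_limit AL BL.
have WL := L2_ifour AL BL.
have ae := ae_identification mu_ ui uW WL wL we e0.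
have k0 : kap != 0 by rewrite expf_neq0// mulf_neq0// gt_eqF// pi_gt0.
split.
  apply: (L2_ae (f := fun p => kap^-1 * w p)) => //; first exact: L2Z.
  by apply: filterS ae => p <-; rewrite mulKf.
exists e => // n.
have [mw _] := wL; have mW := measurable_ifour AL BL n.
rewrite (_ : (\int[mu]_y _ = \int[mu]_y ((ifour A B n y - w y) ^+ 2)%:E)%E)//.
apply: ae_eq_integral => //.
- apply/measurable_EFinP; apply: measurable_funX; apply: measurable_funB => //.
  exact: measurable_funM.
- by apply: measurable_sqr; exact: measurable_funB.
- by apply: filterS ae => p pE _; rewrite pE.
Qed.

Lemma pair_recover1 : L2 mu g1 /\ exists2 e : nat -> R, e n @[n --> \oo] --> (0 : R) &
    forall n, (\int[mu]_y ((ifour G1 G2 n y - kap * g1 y) ^+ 2)%:E <= (e n)%:E)%E.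
Proof.
have [[mg _] _ _] := gG; apply: recover => //.
  by move=> e e0; have [] := integrable_g2_ e0.
by move=> n y; have [] := pair_pk n y.
Qed.

Lemma pair_recover2 : L2 mu g2' /\ exists2 e : nat -> R, e n @[n --> \oo] --> (0 : R) &
    forall n, (\int[mu]_y ((ifour G2 (fun q => - G1 q) n y - kap * g2' y) ^+ 2)%:E
      <= (e n)%:E)%E.
Proof.
have [[_ mg] _ _] := gG; apply: recover => //; first exact: L2N.
  by move=> e e0; have [] := integrable_g2_ e0.
by move=> n y; have [] := pair_pk n y.
Qed.

End pair_L2.

(** * Convolutions of square integrable functions, and Parseval's identity *)

Section convolution.
Context (R : realType).
Local Notation mu := (@pm R).
Implicit Types (A B a u v X : plane R -> R) (p q r y : plane R).

Lemma measurable_plane_sub :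
  measurable_fun setT (fun z : plane R * plane R => z.1 - z.2 : plane R).
Proof.
rewrite (_ : (fun _ => _) = fun z : plane R * plane R =>
   (z.1.1 - z.2.1, z.1.2 - z.2.2) : plane R); last by apply/funext => -[[? ?] [? ?]].
by apply/measurable_fun_pairP; split => /=; apply: measurable_funB; apply: measurableT_comp => //;
  apply: measurableT_comp.
Qed.

Lemma L2_shift A y : L2 mu A -> L2 mu (fun p => A (p + y)).
Proof.
move=> [mA Al]; have mA' := measurableT_comp mA (measurable_shift y); split => //.
rewrite (ge0_integral_shift y (f := fun p => (A p ^+ 2)%:E)) //.
  exact: measurable_sqr.
by move=> p; rewrite lee_fin sqr_ge0.
Qed.

Lemma L2_refl_eq A y : measurable_fun setT A ->
  (\int[mu]_p (A (y - p)%R ^+ 2)%:E = \int[mu]_p (A p ^+ 2)%:E)%E.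
Proof.
move=> mA; rewrite (ge0_integral_refl y (f := fun p => (A p ^+ 2)%:E)) //.
  exact: measurable_sqr.
by move=> p; rewrite lee_fin sqr_ge0.
Qed.

Lemma L2_refl A y : L2 mu A -> L2 mu (fun p => A (y - p)).
Proof.
move=> [mA Al]; have mA' := measurableT_comp mA (measurable_refl y); split => //.
by rewrite L2_refl_eq.
Qed.

Definition conv A B r : R := \int[mu]_q (A (r - q) * B q).

Lemma measurable_conv A B : measurable_fun setT A -> measurable_fun setT B ->
  measurable_fun setT (conv A B).
Proof.
move=> mA mB; apply: (measurable_Rintegral_param mu
  (f := fun z : plane R * plane R => A (z.1 - z.2) * B z.2)).
apply: measurable_funM; last exact: (measurableT_comp mB).
exact: (measurableT_comp mA measurable_plane_sub).
Qed.

(** [|x * y| <= x ^+ 2 + y ^+ 2] and invariance under reflection give a bound by the two squared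
    norms, which do not depend on [r]. *)
Lemma integral_norm_conv A B : L2 mu A -> L2 mu B ->
  exists2 M : R, 0 <= M & forall r, (\int[mu]_q (`|A (r - q)%R * B q|)%:E <= M%:E)%E.
Proof.
move=> AL BL; have [mA _] := AL; have [mB _] := BL.
exists (fine (\int[mu]_p (A p ^+ 2)%:E) + fine (\int[mu]_p (B p ^+ 2)%:E)).
  by rewrite addr_ge0// fine_ge0// sqr_integral_ge0.
move=> r; rewrite EFinD !fineK; [|exact: L2_fin..].
rewrite -(L2_refl_eq r mA) -ge0_integralD//.
- have mA' := measurableT_comp mA (measurable_refl r).
  apply: ge0_le_integral => //.
  + apply/measurable_EFinP; apply: measurableT_comp => //; exact: measurable_funM.
  + by apply/measurable_EFinP; apply: measurable_funD; apply: measurable_funX.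
  + move=> q _; rewrite lee_fin normrM.
    rewrite -[A _ ^+ 2]real_normK ?num_real// -[B _ ^+ 2]real_normK ?num_real//.
    by move: `|_| `|_| (normr_ge0 (A (r - q))) (normr_ge0 (B q)) => x y; nra.
- by move=> p _; rewrite lee_fin sqr_ge0.
- apply/measurable_EFinP; apply: measurable_funX; exact: measurableT_comp mA (measurable_refl r).
- by move=> p _; rewrite lee_fin sqr_ge0.
- exact: measurable_sqr.
Qed.

Lemma norm_conv A B : L2 mu A -> L2 mu B ->
  exists2 M : R, 0 <= M & forall r, `|conv A B r| <= M.
Proof.
move=> AL BL; have [M M0 HM] := integral_norm_conv AL BL; exists M => // r.
have i : L1 mu (fun q => A (r - q) * B q).
  by apply: L2M_integrable => //; exact: L2_refl.
apply: (le_trans (le_normr_Rintegral measurableT i)).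
rewrite -lee_fin fineK; first exact: HM.
by have := integrable_fin_num measurableT (integrable_abse i).
Qed.

Lemma integrable_conv A B u : L2 mu A -> L2 mu B -> L1 mu u ->
  L1 mu (fun r => conv A B r * u r).
Proof.
move=> AL BL ui; have [mA _] := AL; have [mB _] := BL.
have mu_ := L1_measurable ui.
have [M M0 HM] := norm_conv AL BL.
have gi : L1 mu (fun r => M * u r).
  by have := integrable_lin M 0 ui ui; congr integrable; apply/funext => r; rewrite /= mul0r addr0.
apply: le_integrable gi => //.
  by apply/measurable_EFinP; apply: measurable_funM => //; exact: measurable_conv.
by move=> r _ /=; rewrite lee_fin !normrM (ger0_norm M0) ler_wpM2r.
Qed.

(** Fubini's theorem and the substitution [r = p + q]. Absolute convergence holds because the
    convolution of the absolute values is bounded and [u] is integrable. *)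
Lemma conv_pairing A B u : L2 mu A -> L2 mu B -> L2 mu u ->
  L1 mu u ->
  \int[mu]_q (B q * \int[mu]_p (A p * u (p + q))) = \int[mu]_r (conv A B r * u r).
Proof.
move=> AL BL uL ui; have [mA _] := AL; have [mB _] := BL; have [mu_ _] := uL.
have mK : measurable_fun setT (fun z : plane R * plane R => A (z.1 - z.2) * B z.2 * u z.1).
  apply: measurable_funM; last exact: (measurableT_comp mu_).
  apply: measurable_funM; last exact: (measurableT_comp mB).
  exact: (measurableT_comp mA measurable_plane_sub).
have [M M0 HM] := integral_norm_conv AL BL.
have mAB r : measurable_fun setT (fun q => A (r - q) * B q).
  by apply: measurable_funM => //; exact: measurableT_comp mA (measurable_refl r).
have iK : L1 (mu \x mu)%E (fun z : plane R * plane R => A (z.1 - z.2) * B z.2 * u z.1).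
  apply/integrable12ltyP; first exact/measurable_EFinP.
  apply: (@le_lt_trans _ _ (\int[mu]_r (M * `|u r|)%:E)%E).
    apply: ge0_le_integral => //.
    - by move=> r _; apply: integral_ge0.
    - apply: (measurable_fun_fubini_tonelli_F
        (abse \o (EFin \o (fun z : plane R * plane R => A (z.1 - z.2) * B z.2 * u z.1)))) => //.
      by apply: measurableT_comp => //; exact/measurable_EFinP.
      by move=> z; exact: abse_ge0.
    - by apply/measurable_EFinP; apply: measurable_funM => //; exact: measurableT_comp.
    - move=> r _ /=.
      under eq_integral => q _ do rewrite normrM mulrC.
      rewrite ge0_integralZ_EFin//; last exact: measurableT_comp.
      by rewrite [leRHS]EFinM muleC; apply: lee_pmul => //; apply: integral_ge0.
  rewrite ge0_integralZ_EFin//; last exact: measurableT_comp.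
  have /integrableP[_ h] := ui.
  by apply: lte_mul_pinfty.
transitivity (\int[mu]_q \int[mu]_r (A (r - q) * B q * u r)); last first.
  rewrite -(Rfubini iK); apply: eq_Rintegral => r _; rewrite /conv /=.
  have iAB : L1 mu (fun q => A (r - q) * B q).
    by apply: L2M_integrable => //; exact: L2_refl.
  by rewrite [RHS]mulrC -RintegralZl//; apply: eq_Rintegral => q _; rewrite [RHS]mulrC.
apply: eq_Rintegral => q _.
have iAu : L1 mu (fun p => A p * u (p + q)).
  by apply: L2M_integrable => //; exact: L2_shift.
rewrite -RintegralZl// -[RHS](Rintegral_shift q); last first.
  apply: measurable_funM => //; apply: measurable_funM => //.
  exact: measurableT_comp mA (measurable_shift (- q)).
by apply: eq_Rintegral => p _; rewrite addrK mulrCA mulrA.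
Qed.

Let kap : R := (2 * pi) ^+ 2.

(** Parseval's identity for [X]: duality moves the damped transform onto [X], then the damping goes
    away, on the left by L^2 convergence and on the right by dominated convergence, since [A], [B]
    and the transforms of [X] are in L^2. *)
Lemma ifour_pairing_limit X A B v (e : nat -> R) :
  L1 mu X -> L2 mu X -> L2 mu A -> L2 mu B -> L2 mu v ->
  e n @[n --> \oo] --> (0 : R) ->
  (forall n, (\int[mu]_y ((ifour A B n y - kap * v y) ^+ 2)%:E <= (e n)%:E)%E) ->
  kap * \int[mu]_y (X y * v y) = \int[mu]_q (A q * cos_tr X q) - \int[mu]_q (B q * sin_tr X q).
Proof.
move=> iX XL AL BL vL e0 he.
have kvL : L2 mu (fun y => kap * v y) by exact: L2Z.
have [cL sL] := L2_tr iX XL.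
have lim := cvg_RintegralM_L2 XL kvL (L2_ifour AL BL) he e0.
have -> : kap * \int[mu]_y (X y * v y) = \int[mu]_y (X y * (kap * v y)).
  rewrite -RintegralZl//; last exact: L2M_integrable.
  by apply: eq_Rintegral => y _; rewrite mulrCA.
have E n : \int[mu]_y (X y * ifour A B n y) =
    \int[mu]_q ((A q * cos_tr X q) * g2 (damp R n) q) -
    \int[mu]_q ((B q * sin_tr X q) * g2 (damp R n) q).
  have iA := integrable_damped n AL; have iB := integrable_damped n BL.
  have [cA _] := L2_tr iA (L2_damped n AL); have [_ sB] := L2_tr iB (L2_damped n BL).
  transitivity (\int[mu]_y (X y * cos_tr (fun q => A q * g2 (damp R n) q) y) -
      \int[mu]_y (X y * sin_tr (fun q => B q * g2 (damp R n) q) y)).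
    rewrite -(RintegralB measurableT (L2M_integrable XL cA) (L2M_integrable XL sB)).
    by apply: eq_Rintegral => y _; rewrite -mulrBr.
  rewrite cos_tr_duality// sin_tr_duality//.
  by congr (_ - _); apply: eq_Rintegral => q _; rewrite mulrAC.
have lim1 D : L1 mu D ->
    \int[mu]_q (D q * g2 (damp R n) q) @[n --> \oo] --> \int[mu]_q D q.
  move=> iD; have mD := L1_measurable iD.
  apply: (@dominated_cvg_Rintegral _ _ R mu _ _ (fun q => `|D q|)) => //.
  - by move=> n; apply: measurable_funM => //; exact: measurable_g2.
  - apply: aeW => q; have H : D q * g2 (damp R n) q @[n --> \oo] --> (D q * 1 : R).
      by apply: cvgM; [exact: cvg_cst|exact: cvg_g2_damp].
    by rewrite mulr1 in H.
  - exact: (integrable_abse iD).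
  - move=> n q; rewrite normrM ler_piMr// ger0_norm ?g2_ge0//.
    by rewrite g2_le1// ltW// damp_gt0.
apply: (cvg_unique _ lim) => //.
rewrite (_ : (fun n => _) = (fun n => \int[mu]_q ((A q * cos_tr X q) * g2 (damp R n) q) -
    \int[mu]_q ((B q * sin_tr X q) * g2 (damp R n) q))); last exact/funext.
apply: cvgB.
  exact: (lim1 (fun q => A q * cos_tr X q) (L2M_integrable AL cL)).
exact: (lim1 (fun q => B q * sin_tr X q) (L2M_integrable BL sL)).
Qed.

End convolution.

(** * Pairing a product with the transform of a test function *)

Section product.
Context (R : realType).
Local Notation mu := (@pm R).
Implicit Types (u : plane R -> R) (p q r y : plane R).
Variables g1 g2' G1 G2 h1 h2 H1 H2 : plane R -> R.
Hypotheses (gG : real_pair g1 g2' G1 G2) (hH : real_pair h1 h2 H1 H2).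
Hypotheses (G1L : L2 mu G1) (G2L : L2 mu G2) (H1L : L2 mu H1) (H2L : L2 mu H2).

Let kap : R := (2 * pi) ^+ 2.

Lemma RintegralNM (A B : plane R -> R) : L1 mu (fun q => A q * B q) ->
  \int[mu]_q (- A q * B q) = - \int[mu]_q (A q * B q).
Proof.
move=> iAB; rewrite -[RHS]mulN1r -(RintegralZl _ measurableT iAB).
by apply: eq_Rintegral => q _; rewrite mulN1r mulNr.
Qed.

(** Translating [u] multiplies its transform by a phase; this is the real part of that rule, and
    [sin_tr_shift] the imaginary part. *)
Lemma cos_tr_shift u q y : L1 mu u ->
  cos_tr (fun p => u (p + q)) y = cos_tr u y * cos (dot y q) + sin_tr u y * sin (dot y q).
Proof.
move=> iu; have ic := integrable_cdot iu y; have is_ := integrable_sdot iu y.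
have mu_ := L1_measurable iu.
rewrite ![_ * _ (dot y q)]mulrC -Rintegral_lin//.
rewrite /cos_tr -[RHS](Rintegral_shift q); last first.
  apply: measurable_funD; apply: measurable_funM => //; apply: measurable_funM => //;
  [exact: measurable_cdot|exact: measurable_sdot].
apply: eq_Rintegral => p _.
rewrite -[in LHS](addrK q p) [in LHS]dotBr cosB subrK.
by move: (u _) (cos _) (sin _) (cos _) (sin _) => a b c d e; ring.
Qed.

Lemma sin_tr_shift u q y : L1 mu u ->
  sin_tr (fun p => u (p + q)) y = sin_tr u y * cos (dot y q) + (- cos_tr u y) * sin (dot y q).
Proof.
move=> iu; have ic := integrable_cdot iu y; have is_ := integrable_sdot iu y.
have mu_ := L1_measurable iu.
rewrite mulNr -mulrN ![_ * _ (dot y q)]mulrC ![cos_tr u y * _]mulrC -Rintegral_lin//.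
rewrite /sin_tr -[RHS](Rintegral_shift q); last first.
  apply: measurable_funD; apply: measurable_funM => //; apply: measurable_funM => //;
  [exact: measurable_sdot|exact: measurable_cdot].
apply: eq_Rintegral => p _.
rewrite -[in LHS](addrK q p) [in LHS]dotBr sinB subrK.
by move: (u _) (cos _) (sin _) (cos _) (sin _) => a b c d e; ring.
Qed.

Section test.
Variable u : plane R -> R.
Hypothesis su : rschwartz u.

Let iu := rschwartz_integrable su.
Let uL := rschwartz_L2 su.
(** With [a2], the real and imaginary parts of [g] times the transform of [u]. *)
Let a1 y := g1 y * cos_tr u y + g2' y * sin_tr u y.
Let a2 y := g2' y * cos_tr u y - g1 y * sin_tr u y.

Let gL : L2 mu g1 /\ L2 mu g2'.
Proof. by have [? _] := pair_recover1 gG G1L G2L; have [? _] := pair_recover2 gG G1L G2L. Qed.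

Let Lc : L2 mu (cos_tr u) /\ L2 mu (sin_tr u). Proof. exact: L2_tr. Qed.

Let mul_L2 g : L2 mu g -> L2 mu (fun y => g y * cos_tr u y) /\ L2 mu (fun y => g y * sin_tr u y).
Proof.
move=> gL_; have [[mc _] [ms _]] := Lc.
by split; apply: (L2Mb (c := normL1 u) gL_) => // y; [exact: norm_cos_tr|exact: norm_sin_tr].
Qed.

Let a1L : L2 mu a1.
Proof.
have [/mul_L2[h _] /mul_L2[_ h']] := gL; exact: (L2D h h').
Qed.

Let a2L : L2 mu a2.
Proof.
have [/mul_L2[_ h] /mul_L2[h' _]] := gL; exact: (L2D h' (L2N h)).
Qed.

Let ia1 : L1 mu a1.
Proof.
have [gL1 gL2] := gL; have [cL sL] := Lc.
have := integrable_lin 1 1 (L2M_integrable gL1 cL) (L2M_integrable gL2 sL).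
by congr integrable; apply/funext => y; rewrite /= !mul1r.
Qed.

Let ia2 : L1 mu a2.
Proof.
have [gL1 gL2] := gL; have [cL sL] := Lc.
have := integrable_lin 1 (-1) (L2M_integrable gL2 cL) (L2M_integrable gL1 sL).
by congr integrable; apply/funext => y; rewrite /= mul1r mulN1r.
Qed.

(** Multiplying the transform of [u] by e^(i q.y) gives the transform of [u] translated by [q],
    against which [g] pairs by definition. *)
Let modulation q :
  cos_tr a1 q - sin_tr a2 q = \int[mu]_p (G1 p * u (p + q)) /\
  sin_tr a1 q + cos_tr a2 q = \int[mu]_p (G2 p * u (p + q)).
Proof.
have [_ _ gF] := gG; have [<- <-] := gF _ (rschwartz_shift q su).
have c1 := integrable_cdot ia1 q; have s1 := integrable_sdot ia1 q.
have c2 := integrable_cdot ia2 q; have s2 := integrable_sdot ia2 q.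
split.
  have -> : cos_tr a1 q - sin_tr a2 q = \int[mu]_y (a1 y * cos (dot q y) - a2 y * sin (dot q y)).
    by rewrite (RintegralB measurableT c1 s2).
  apply: eq_Rintegral => y _; rewrite cos_tr_shift// sin_tr_shift// !(dotC q).
  by rewrite /a1 /a2; move: (cos_tr u y) (sin_tr u y) (cos _) (sin _) => c d e f; ring.
have -> : sin_tr a1 q + cos_tr a2 q = \int[mu]_y (a1 y * sin (dot q y) + a2 y * cos (dot q y)).
  by rewrite (RintegralD measurableT s1 c2).
apply: eq_Rintegral => y _; rewrite cos_tr_shift// sin_tr_shift// !(dotC q).
by rewrite /a1 /a2; move: (cos_tr u y) (sin_tr u y) (cos _) (sin _) => c d e f; ring.
Qed.

Let tr_L2 : (L2 mu (cos_tr a1) /\ L2 mu (sin_tr a1)) /\ (L2 mu (cos_tr a2) /\ L2 mu (sin_tr a2)).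
Proof. by split; exact: L2_tr. Qed.

(** The left side has the shape that [ifour_pairing_limit] produces. Leaving [A] and [B] free lets
    one computation serve both the real and the imaginary part. *)
Let expand (A B : plane R -> R) : L2 mu A -> L2 mu B ->
  (\int[mu]_q (A q * cos_tr a1 q) - \int[mu]_q (B q * sin_tr a1 q)) -
  (\int[mu]_q (B q * cos_tr a2 q) - \int[mu]_q (- A q * sin_tr a2 q)) =
  \int[mu]_r (conv G1 A r * u r) - \int[mu]_r (conv G2 B r * u r).
Proof.
move=> AL BL; have [[c1 s1] [c2 s2]] := tr_L2.
have iA1 := L2M_integrable AL c1; have iA2 := L2M_integrable AL s2.
have iB1 := L2M_integrable BL s1; have iB2 := L2M_integrable BL c2.
rewrite -(conv_pairing G1L AL uL iu) -(conv_pairing G2L BL uL iu).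
rewrite (RintegralNM iA2).
have -> : \int[mu]_q (A q * \int[mu]_p (G1 p * u (p + q))) =
    \int[mu]_q (A q * cos_tr a1 q) - \int[mu]_q (A q * sin_tr a2 q).
  rewrite -(RintegralB measurableT iA1 iA2).
  by apply: eq_Rintegral => q _; have [<- _] := modulation q; rewrite mulrBr.
have -> : \int[mu]_q (B q * \int[mu]_p (G2 p * u (p + q))) =
    \int[mu]_q (B q * sin_tr a1 q) + \int[mu]_q (B q * cos_tr a2 q).
  rewrite -(RintegralD measurableT iB1 iB2).
  by apply: eq_Rintegral => q _; have [_ <-] := modulation q; rewrite mulrDr.
by move: (\int[mu]_q _) (\int[mu]_q _) (\int[mu]_q _) (\int[mu]_q _) => *; ring.
Qed.

(** Real and imaginary parts of the identity between [kap] times the pairing of g h with the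
    transform of [u] and the pairing of the convolution of G and H with [u]. *)
Lemma product_pairing :
  kap * \int[mu]_y (a1 y * h1 y) - kap * \int[mu]_y (a2 y * h2 y) =
    \int[mu]_r (conv G1 H1 r * u r) - \int[mu]_r (conv G2 H2 r * u r) /\
  kap * \int[mu]_y (a1 y * h2 y) + kap * \int[mu]_y (a2 y * h1 y) =
    \int[mu]_r (conv G1 H2 r * u r) + \int[mu]_r (conv G2 H1 r * u r).
Proof.
have [h1L [e e0 he]] := pair_recover1 hH H1L H2L.
have [h2L [e' e0' he']] := pair_recover2 hH H1L H2L.
have N1L : L2 mu (fun q => - H1 q) by exact: L2N.
rewrite (ifour_pairing_limit ia1 a1L H1L H2L h1L e0 he).
rewrite (ifour_pairing_limit ia2 a2L H2L N1L h2L e0' he').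
rewrite (ifour_pairing_limit ia1 a1L H2L N1L h2L e0' he').
rewrite (ifour_pairing_limit ia2 a2L H1L H2L h1L e0 he).
split; first exact: expand.
have := expand H2L N1L.
have [_ [cL sL]] := tr_L2.
rewrite (RintegralNM (L2M_integrable H1L cL)) (RintegralNM (L2M_integrable H2L sL)).
rewrite -opprD opprK => ->; congr (_ + _).
have E r : conv G2 (fun q => - H1 q) r = - conv G2 H1 r.
  rewrite /conv -[RHS]mulN1r -RintegralZl//.
    by apply: eq_Rintegral => q _; rewrite mulN1r mulrN.
  by apply: L2M_integrable => //; exact: L2_refl.
have [M M0 HM] := integral_norm_conv G2L H1L.
have mc : measurable_fun setT (conv G2 H1).
  by apply: measurable_conv; [case: G2L|case: H1L].
have ic : L1 mu (fun r => conv G2 H1 r * u r).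
  exact: integrable_conv.
have -> : \int[mu]_r (conv G2 (fun q => - H1 q) r * u r) = \int[mu]_r (- conv G2 H1 r * u r).
  by apply: eq_Rintegral => r _; rewrite E.
by rewrite (RintegralNM ic) opprK.
Qed.

End test.

End product.

(** * The Fourier transform of a product *)

Section fourier_product.
Context (R : realType).
Local Notation mu := (@pm R).
Implicit Types (u v : plane R -> R) (p q r y : plane R).
Variables g h G H : plane R -> R[i].
Hypotheses (gG : is_fourier g G) (hH : is_fourier h H).

Let g1 p := complex.Re (g p).
Let gi p := complex.Im (g p).
Let h1 p := complex.Re (h p).
Let hi p := complex.Im (h p).
Let G1 p := complex.Re (G p).
Let Gi p := complex.Im (G p).
Let H1 p := complex.Re (H p).
Let Hi p := complex.Im (H p).

Hypotheses (G1L : L2 mu G1) (GiL : L2 mu Gi) (H1L : L2 mu H1) (HiL : L2 mu Hi).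

Let kap : R := (2 * pi) ^+ 2.

Definition conv_fourier r : R[i] :=
  Complex (kap^-1 * (conv G1 H1 r - conv Gi Hi r)) (kap^-1 * (conv G1 Hi r + conv Gi H1 r)).

Let rg : real_pair g1 gi G1 Gi. Proof. exact: is_fourier_real. Qed.
Let rh : real_pair h1 hi H1 Hi. Proof. exact: is_fourier_real. Qed.

Let g1L : L2 mu g1. Proof. by have [] := pair_recover1 rg G1L GiL. Qed.
Let giL : L2 mu gi. Proof. by have [] := pair_recover2 rg G1L GiL. Qed.
Let h1L : L2 mu h1. Proof. by have [] := pair_recover1 rh H1L HiL. Qed.
Let hiL : L2 mu hi. Proof. by have [] := pair_recover2 rh H1L HiL. Qed.

Let integrable3 (a b v : plane R -> R) (M : R) : L2 mu a -> L2 mu b -> measurable_fun setT v ->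
  (forall p, `|v p| <= M) -> L1 mu (fun p => a p * v p * b p).
Proof. by move=> aL bL mv vM; exact: L2M_integrable (L2Mb aL mv vM) bL. Qed.

Let integrable_gh v (M : R) : measurable_fun setT v -> (forall p, `|v p| <= M) ->
  L1 mu (fun p => complex.Re (g p * h p) * v p) /\
  L1 mu (fun p => complex.Im (g p * h p) * v p).
Proof.
move=> mv vM; split.
  have := integrable_lin 1 (-1) (integrable3 g1L h1L mv vM) (integrable3 giL hiL mv vM).
  by congr integrable; apply/funext => p; rewrite /= ReM /g1 /gi /h1 /hi; congr EFin; ring.
have := integrable_lin 1 1 (integrable3 g1L hiL mv vM) (integrable3 giL h1L mv vM).
by congr integrable; apply/funext => p; rewrite /= ImM /g1 /gi /h1 /hi; congr EFin; ring.
Qed.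

Let tempered_gh : tempered (fun p => g p * h p).
Proof.
apply: real_tempered.
  have [m1 _] := g1L; have [m2 _] := giL; have [m3 _] := h1L; have [m4 _] := hiL.
  split.
    rewrite (_ : (fun _ => _) = fun p => g1 p * h1 p - gi p * hi p).
      by apply: measurable_funB; apply: measurable_funM.
    by apply/funext => p; rewrite ReM.
  rewrite (_ : (fun _ => _) = fun p => g1 p * hi p + gi p * h1 p).
    by apply: measurable_funD; apply: measurable_funM.
  by apply/funext => p; rewrite ImM.
move=> u su; have [M HM] := rschwartz_bounded su.
exact: integrable_gh (rschwartz_measurable su) HM.
Qed.

Let tempered_conv : tempered conv_fourier.
Proof.
have [m1 _] := G1L; have [m2 _] := GiL; have [m3 _] := H1L; have [m4 _] := HiL.
apply: real_tempered.
  split => /=; apply: measurable_funM => //.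
    by apply: measurable_funB; exact: measurable_conv.
  by apply: measurable_funD; exact: measurable_conv.
move=> u su; have iu := rschwartz_integrable su; split.
  have := integrable_lin kap^-1 (- kap^-1) (integrable_conv G1L H1L iu) (integrable_conv GiL HiL iu).
  by congr integrable; apply/funext => r /=; congr EFin; ring.
have := integrable_lin kap^-1 kap^-1 (integrable_conv G1L HiL iu) (integrable_conv GiL H1L iu).
by congr integrable; apply/funext => r /=; congr EFin; ring.
Qed.

(** As [g] and [h] are in L^2, their product is integrable against the bounded functions [cos_tr u]
    and [sin_tr u], which makes [product_pairing] an identity between convergent integrals. *)
Lemma is_fourier_product : is_fourier (fun p => g p * h p) conv_fourier.
Proof.
apply: real_is_fourier => //; last first.
  move=> u su; have iu := rschwartz_integrable su.
  have [i1 i2] := integrable_gh (measurable_cos_tr iu) (norm_cos_tr iu).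
  by have [i3 i4] := integrable_gh (measurable_sin_tr iu) (norm_sin_tr iu).
split; first by case: tempered_gh => -[].
  exact: tempered_real tempered_gh.
move=> u su; have iu := rschwartz_integrable su.
have [E1 E2] := product_pairing rg rh G1L GiL H1L HiL su.
have k0 : kap != 0 by rewrite expf_neq0// mulf_neq0// gt_eqF// pi_gt0.
have [cL sL] := L2_tr iu (rschwartz_L2 su); have [mc _] := cL; have [ms _] := sL.
have cb := norm_cos_tr iu; have sb := norm_sin_tr iu.
have gcL : L2 mu (fun y => g1 y * cos_tr u y) by exact: L2Mb g1L mc cb.
have gsL : L2 mu (fun y => gi y * sin_tr u y) by exact: L2Mb giL ms sb.
have gcL' : L2 mu (fun y => gi y * cos_tr u y) by exact: L2Mb giL mc cb.
have gsL' : L2 mu (fun y => g1 y * sin_tr u y) by exact: L2Mb g1L ms sb.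
have a1L := L2D gcL gsL; have a2L := L2D gcL' (L2N gsL').
have i11 := L2M_integrable a1L h1L; have i22 := L2M_integrable a2L hiL.
have i12 := L2M_integrable a1L hiL; have i21 := L2M_integrable a2L h1L.
have c11 := integrable_conv G1L H1L iu; have cii := integrable_conv GiL HiL iu.
have c1i := integrable_conv G1L HiL iu; have ci1 := integrable_conv GiL H1L iu.
split.
  transitivity (kap^-1 * (\int[mu]_r (conv G1 H1 r * u r) - \int[mu]_r (conv Gi Hi r * u r))).
    rewrite -E1 -mulrBr mulKf// -(RintegralB measurableT i11 i22).
    apply: eq_Rintegral => y _; rewrite ReM ImM -/(g1 y) -/(gi y) -/(h1 y) -/(hi y).
    by move: (cos_tr u y) (sin_tr u y) => c d; ring.
  rewrite mulrBr -mulNr -(Rintegral_lin _ _ c11 cii); apply: eq_Rintegral => r _.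
  by rewrite /= mulNr !mulrA -mulrBl -mulrBr.
transitivity (kap^-1 * (\int[mu]_r (conv G1 Hi r * u r) + \int[mu]_r (conv Gi H1 r * u r))).
  rewrite -E2 -mulrDr mulKf// -(RintegralD measurableT i12 i21).
  apply: eq_Rintegral => y _; rewrite ReM ImM -/(g1 y) -/(gi y) -/(h1 y) -/(hi y).
  by move: (cos_tr u y) (sin_tr u y) => c d; ring.
rewrite mulrDr -(Rintegral_lin _ _ c1i ci1); apply: eq_Rintegral => r _.
by rewrite /= !mulrA -mulrDl -mulrDr.
Qed.

End fourier_product.

(** * Weighted convolution estimate and kernel bound *)

Section bilinear.
Context (R : realType).
Local Notation L := (@lebesgue_measure R).
Local Notation mu := (@pm R).
Implicit Types (A B : plane R -> R) (p q r y : plane R).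

(** For a fixed first coordinate, the second one is only translated by [c] and possibly reflected,
    so the shear disappears. This is why the shape of the curves tau = - xi^2 and tau = xi^3 does
    not enter the bound. *)
Lemma integral_sheared (f k c : R -> R) (s : R) : `|s| = 1 ->
  measurable_fun setT (f : measurableTypeR R -> R) ->
  measurable_fun setT (k : measurableTypeR R -> R) ->
  measurable_fun setT (c : measurableTypeR R -> measurableTypeR R) ->
  (forall x, 0 <= f x) -> (forall x, 0 <= k x) ->
  (\int[mu]_q (f q.1 * k (s * q.2 + c q.1))%:E =
   (\int[L]_x (f x)%:E) * \int[L]_x (k x)%:E)%E.
Proof.
move=> s1 mf mk mc f0 k0.
have s0 : s != 0 by rewrite -normr_gt0 s1.
have mF : measurable_fun setT (fun q : plane R => (f q.1 * k (s * q.2 + c q.1))%:E).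
  apply/measurable_EFinP; apply: measurable_funM; first exact: (measurableT_comp mf).
  apply: (measurableT_comp mk); apply: measurable_funD.
    by apply: measurable_funM.
  exact: (measurableT_comp mc).
rewrite (fubini_tonelli1 (fun q : plane R => (f q.1 * k (s * q.2 + c q.1))%:E))//; last first.
  by move=> q; rewrite lee_fin mulr_ge0.
have mkE : measurable_fun setT (fun x : measurableTypeR R => (k x)%:E) by exact/measurable_EFinP.
transitivity (\int[L]_x ((f x)%:E * \int[L]_x (k x)%:E))%E.
  apply: eq_integral => x _; rewrite /fubini_F /=.
  rewrite ge0_integralZ_EFin//; last first.
    by apply: (measurableT_comp mk); apply: measurable_funD => //; apply: measurable_funM.
  congr (_ * _)%E.
  rewrite [RHS](ge0_integral_affine (c x) s0 mkE); last by move=> z; rewrite lee_fin.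
  by rewrite s1 mul1e.
rewrite ge0_integralZr//.
- exact/measurable_EFinP.
- by move=> x _; rewrite lee_fin.
- by apply: integral_ge0 => x _; rewrite lee_fin.
Qed.

(** Integrating in [r] first, translation invariance separates the factors. *)
Lemma integral_conv_tensor (f k : plane R -> \bar R) :
  measurable_fun setT f -> measurable_fun setT k ->
  (forall p, 0 <= f p)%E -> (forall p, 0 <= k p)%E ->
  (\int[mu]_r \int[mu]_q (f (r - q)%R * k q) = (\int[mu]_p f p) * \int[mu]_p k p)%E.
Proof.
move=> mf mk f0 k0.
have mF : measurable_fun setT (fun z : plane R * plane R => (f (z.1 - z.2)%R * k z.2)%E).
  apply: emeasurable_funM; last exact: (measurableT_comp mk).
  exact: (measurableT_comp mf (@measurable_plane_sub R)).
have F0 (z : plane R * plane R) : (0 <= f (z.1 - z.2)%R * k z.2)%E by rewrite mule_ge0.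
have := fubini_tonelli (m1 := mu) (m2 := mu) _ mF F0 => /= ->.
transitivity (\int[mu]_q ((\int[mu]_p f p) * k q))%E.
  apply: eq_integral => q _.
  have mfq : measurable_fun setT (fun r => f (r - q)%R).
    exact: measurableT_comp mf (measurable_shift (- q)).
  by rewrite ge0_integralZr// (ge0_integral_shift (- q) mf f0).
by rewrite ge0_integralZl// integral_ge0.
Qed.

(** [j1] and [j2] are the reciprocals of the weights [v1] and [v2], and [s] is the output weight.
    After [v1 * j1] and [v2 * j2] are inserted, Cauchy-Schwarz splits off the kernel; what remains
    is a convolution of squares, integrated by [integral_conv_tensor]. *)
Lemma weighted_conv_le A B (v1 v2 j1 j2 s : plane R -> R) (K : R) :
  L2 mu A -> L2 mu B -> (forall p, 0 <= A p) -> (forall p, 0 <= B p) ->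
  measurable_fun setT v1 -> measurable_fun setT v2 -> measurable_fun setT s ->
  measurable_fun setT j1 -> measurable_fun setT j2 ->
  (forall p, v1 p * j1 p = 1) -> (forall p, v2 p * j2 p = 1) -> 0 <= K ->
  (forall r, \int[mu]_q (s r ^+ 2 * (j1 (r - q) * j2 q) ^+ 2)%:E <= K%:E)%E ->
  (\int[mu]_r (s r ^+ 2 * conv A B r ^+ 2)%:E <=
   K%:E * (\int[mu]_p ((v1 p * A p) ^+ 2)%:E * \int[mu]_p ((v2 p * B p) ^+ 2)%:E))%E.
Proof.
move=> AL BL A0 B0 m1 m2 ms n1 n2 vj1 vj2 K0 HK.
have [mA _] := AL; have [mB _] := BL.
have mE (v D : plane R -> R) : measurable_fun setT v -> measurable_fun setT D ->
    measurable_fun setT (fun p => ((v p * D p) ^+ 2)%:E).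
  by move=> mv mD; apply/measurable_EFinP; apply: measurable_funX; exact: measurable_funM.
have nn (D : plane R -> R) p : (0 <= (D p ^+ 2)%:E)%E by rewrite lee_fin sqr_ge0.
rewrite -integral_conv_tensor//; [|exact: mE..|by move=> p; rewrite lee_fin sqr_ge0
  |by move=> p; rewrite lee_fin sqr_ge0].
have mG : measurable_fun setT (fun z : plane R * plane R =>
    (((v1 (z.1 - z.2)%R * A (z.1 - z.2)%R) ^+ 2)%:E * ((v2 z.2 * B z.2) ^+ 2)%:E)%E).
  apply: emeasurable_funM; last exact: (measurableT_comp (mE _ _ m2 mB)).
  exact: (measurableT_comp (mE _ _ m1 mA) (@measurable_plane_sub R)).
have G0 (z : plane R * plane R) :
    (0 <= ((v1 (z.1 - z.2)%R * A (z.1 - z.2)%R) ^+ 2)%:E * ((v2 z.2 * B z.2) ^+ 2)%:E)%E.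
  by rewrite -EFinM lee_fin mulr_ge0 ?sqr_ge0.
rewrite -ge0_integralZl//; first last.
- by move=> r _; apply: integral_ge0 => q _; exact: (G0 (r, q)).
- exact: (measurable_fun_fubini_tonelli_F _ mG G0).
apply: ge0_le_integral => //.
- by move=> r _; rewrite lee_fin mulr_ge0 ?sqr_ge0.
- apply/measurable_EFinP; apply: measurable_funM; apply: measurable_funX => //.
  exact: measurable_conv.
- apply: emeasurable_funM; first exact: measurable_cst.
  exact: (measurable_fun_fubini_tonelli_F _ mG G0).
move=> r _.
have mv : measurable_fun setT (fun q => (j1 (r - q) * j2 q)).
  by apply: measurable_funM => //; exact: measurableT_comp n1 (measurable_refl r).
have mg : measurable_fun setT (fun q => (v1 (r - q) * A (r - q)) * (v2 q * B q)).
  apply: measurable_funM; last exact: measurable_funM.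
  apply: measurable_funM; first exact: measurableT_comp m1 (measurable_refl r).
  exact: measurableT_comp mA (measurable_refl r).
have cE : (conv A B r)%:E = (\int[mu]_q (`|(j1 (r - q) * j2 q) *
    ((v1 (r - q) * A (r - q)) * (v2 q * B q))|)%:E)%E.
  rewrite /conv fineK; last first.
    by apply: integrable_fin_num => //; apply: L2M_integrable => //; exact: L2_refl.
  apply: eq_integral => q _.
  rewrite [in RHS](_ : _ * _ = (v1 (r - q) * j1 (r - q)) * (v2 q * j2 q) * (A (r - q) * B q)).
    by rewrite vj1 vj2 !mul1r ger0_norm ?mulr_ge0.
  by ring.
have := cauchy_schwarz mu mv mg; rewrite -cE => CS.
rewrite EFinM -[(conv A B r ^+ 2)%:E]/((conv A B r)%:E ^+ 2)%E.
apply: (@le_trans _ _ ((s r ^+ 2)%:E * (\int[mu]_q ((j1 (r - q) * j2 q) ^+ 2)%:E *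
  \int[mu]_q ((v1 (r - q) * A (r - q) * (v2 q * B q)) ^+ 2)%:E))%E).
  by rewrite lee_wpmul2l// lee_fin sqr_ge0.
rewrite muleA -ge0_integralZ_EFin ?sqr_ge0//; [|exact: measurable_funX|by move=> q; exact: sqr_ge0].
rewrite [X in (_ * X <= _)%E](_ : _ = (\int[mu]_q (((v1 (r - q)%R * A (r - q)%R) ^+ 2)%:E *
   ((v2 q * B q) ^+ 2)%:E))%E); last by apply: eq_integral => q _; rewrite exprMn EFinM.
by rewrite lee_wpmul2r// integral_ge0// => q _; exact: (G0 (r, q)).
Qed.

Lemma jap_sqr s (x : R) : jap s x ^+ 2 = jap (2 * s) x.
Proof. by rewrite /jap -powR_mulrn ?powR_ge0// -powRrM mulNr mulrC. Qed.

Let one_plus_gt0 (x : R) : 0 < 1 + `|x|. Proof. by rewrite ltr_wpDr. Qed.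

Let jap1E (x : R) : jap 1 x = (1 + `|x|)^-1.
Proof. by rewrite /jap powR_inv1// ltW. Qed.

Lemma japM_powR s (x : R) : (1 + `|x|) `^ s * jap s x = 1.
Proof. by rewrite /jap powRN mulfV// gt_eqF// powR_gt0. Qed.

Lemma jap_triangle (x y : R) :
  (1 + `|x + y|) ^+ 2 * (jap 1 x * jap 1 y) ^+ 2 <= 2 * (jap 2 y + jap 2 x).
Proof.
rewrite exprMn !jap_sqr mulr1.
have E (z : R) : jap 2 z = ((1 + `|z|) ^+ 2)^-1 by have := jap_sqr 1 z; rewrite mulr1 jap1E exprVn => ->.
rewrite !E.
have := one_plus_gt0 x; have := one_plus_gt0 y; have := ler_normD x y.
have := normr_ge0 (x + y); have := normr_ge0 x; have := normr_ge0 y.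
move: `|x| `|y| `|x + y| => a b c a0 b0 c0 cab b1 a1.
rewrite -invfM ler_pdivrMr ?mulr_gt0 ?exprn_gt0//.
have -> : 2 * (((1 + b) ^+ 2)^-1 + ((1 + a) ^+ 2)^-1) * ((1 + a) ^+ 2 * (1 + b) ^+ 2) =
   2 * ((1 + b) ^+ 2 + (1 + a) ^+ 2) by field; rewrite !gt_eqF.
have h : 1 + c <= (1 + a) + (1 + b) by lra.
apply: (@le_trans _ _ (((1 + a) + (1 + b)) ^+ 2)).
  by rewrite ler_sqr ?nnegrE ?addr_ge0.
by have := sqr_ge0 (a - b); nra.
Qed.

(** Each of the four terms retains one factor in a spatial frequency and one in a modulation, the
    shape that [integral_sheared] integrates. *)
Lemma kernel_le (b x y s t : R) :
  (1 + `|x + y|) ^+ 2 * ((jap 1 x * jap b s) * (jap 1 y * jap b t)) ^+ 2 <=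
  (jap 2 y * jap (4 * b) s + jap 2 y * jap (4 * b) t) +
  (jap 2 x * jap (4 * b) s + jap 2 x * jap (4 * b) t).
Proof.
have -> : ((jap 1 x * jap b s) * (jap 1 y * jap b t)) ^+ 2 =
  (jap 1 x * jap 1 y) ^+ 2 * (jap b s * jap b t) ^+ 2 by ring.
rewrite mulrA.
apply: (@le_trans _ _ (2 * (jap 2 y + jap 2 x) *
   (2^-1 * (jap (4 * b) s + jap (4 * b) t)))).
  apply: ler_pM; rewrite ?(mulr_ge0 (sqr_ge0 _) (sqr_ge0 _)) ?sqr_ge0//.
    exact: jap_triangle.
  rewrite exprMn !jap_sqr (_ : 4 * b = 2 * (2 * b)); last by ring.
  rewrite -![jap (2 * (2 * b)) _]jap_sqr.
  by have := sqr_ge0 (jap (2 * b) s - jap (2 * b) t);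
    move: (jap _ _) (jap _ _) => u v; nra.
by move: (jap _ _) (jap _ _) (jap _ _) (jap _ _) => u v w z; rewrite le_eqVlt;
  apply/orP; left; apply/eqP; field.
Qed.

Let ge0_integralD_EFin (f k : plane R -> R) :
  measurable_fun setT f -> measurable_fun setT k ->
  (forall q, 0 <= f q) -> (forall q, 0 <= k q) ->
  (\int[mu]_q (f q + k q)%:E = \int[mu]_q (f q)%:E + \int[mu]_q (k q)%:E)%E.
Proof.
move=> mf mk f0 k0; under eq_integral do rewrite EFinD.
by rewrite ge0_integralD//; [move=> q _; rewrite lee_fin|exact/measurable_EFinP
  |move=> q _; rewrite lee_fin|exact/measurable_EFinP].
Qed.

(** The condition on [b] makes [jap (4 * b)] integrable. The bound involves only the integrals of
    [jap 2] and [jap (4 * b)], and is therefore uniform in [r]. *)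
Lemma kernel_bound (b : R) (c1 c2 : R -> R) : 4^-1 < b ->
  measurable_fun setT (c1 : measurableTypeR R -> measurableTypeR R) ->
  measurable_fun setT (c2 : measurableTypeR R -> measurableTypeR R) ->
  exists2 K : R, 0 <= K & forall r, (\int[mu]_q ((1 + `|r.1|) ^+ 2 *
    ((jap 1 (r - q).1 * jap b ((r - q).2 + c1 (r - q).1)) *
     (jap 1 q.1 * jap b (q.2 + c2 q.1))) ^+ 2)%:E <= K%:E)%E.
Proof.
move=> b4 mc1 mc2.
have h2 : (1 : R) < 2 by rewrite ltr1n.
have h4 : 1 < 4 * b by lra.
have i2 := integrable_jap h2; have i4 := integrable_jap h4.
have j0 s (x : R) : 0 <= jap s x by exact: jap_ge0.
pose J (s : R) : \bar R := (\int[L]_x (jap s x)%:E)%E.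
have Jfin (s : R) : 1 < s -> exists2 x : R, 0 <= x & J s = x%:E.
  move=> s1; exists (fine (J s)); first by rewrite fine_ge0// integral_ge0// => x _; rewrite lee_fin.
  by rewrite fineK// integrable_fin_num//; exact: integrable_jap.
have [x2 x20 E2] := Jfin _ h2; have [x4 x40 E4] := Jfin _ h4.
exists (4 * x2 * x4); first by rewrite (mulr_ge0 (mulr_ge0 _ x20) x40).
move=> r.
(* The terms of [kernel_le] in sheared form: the modulation of [r - q] has slope -1 in [q.2], that
   of [q] has slope 1. Each integral is [J 2 * J (4 * b)], whence the factor 4 in the bound. *)
pose t1 q : R := jap 2 q.1 * jap (4 * b) (-1 * q.2 + (r.2 + c1 (r.1 - q.1))).
pose t2 q : R := jap 2 q.1 * jap (4 * b) (1 * q.2 + c2 q.1).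
pose t3 q : R := jap 2 (r.1 - q.1) * jap (4 * b) (-1 * q.2 + (r.2 + c1 (r.1 - q.1))).
pose t4 q : R := jap 2 (r.1 - q.1) * jap (4 * b) (1 * q.2 + c2 q.1).
have mr : measurable_fun setT (fun x : measurableTypeR R => r.1 - x : measurableTypeR R).
  exact: measurable_funB.
have mr1 : measurable_fun setT (fun x : measurableTypeR R => r.2 + c1 (r.1 - x) : measurableTypeR R).
  by apply: measurable_funD => //; exact: (measurableT_comp mc1 mr).
have mj s : measurable_fun setT (jap s : measurableTypeR R -> R) by exact: measurable_jap.
have mjr s : measurable_fun setT (fun x : measurableTypeR R => jap s (r.1 - x)).
  exact: (measurableT_comp (mj s) mr).
have Jr : (\int[L]_x (jap 2 (r.1 - x))%R%:E = J 2%R)%E.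
  have n1 : (-1 : R) != 0 by rewrite oppr_eq0 oner_eq0.
  have mjE : measurable_fun setT (fun x : measurableTypeR R => (jap 2 x)%:E) by exact/measurable_EFinP.
  rewrite /J [RHS](ge0_integral_affine r.1 n1 mjE); last by move=> x; rewrite lee_fin.
  by rewrite normrN1 mul1e; apply: eq_integral => x _; rewrite mulN1r addrC.
have I1 : (\int[mu]_q (t1 q)%:E = J 2%R * J (4 * b)%R)%E.
  exact: (integral_sheared (normrN1 R) (mj 2) (mj (4 * b)) mr1 (j0 2) (j0 (4 * b))).
have I2 : (\int[mu]_q (t2 q)%:E = J 2%R * J (4 * b)%R)%E.
  exact: (integral_sheared (normr1 R) (mj 2) (mj (4 * b)) mc2 (j0 2) (j0 (4 * b))).
have I3 : (\int[mu]_q (t3 q)%:E = J 2%R * J (4 * b)%R)%E.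
  rewrite -Jr.
  exact: (integral_sheared (normrN1 R) (mjr 2) (mj (4 * b)) mr1 (fun=> j0 2 _) (j0 (4 * b))).
have I4 : (\int[mu]_q (t4 q)%:E = J 2%R * J (4 * b)%R)%E.
  rewrite -Jr.
  exact: (integral_sheared (normr1 R) (mjr 2) (mj (4 * b)) mc2 (fun=> j0 2 _) (j0 (4 * b))).
have m1 : measurable_fun setT (fun q : plane R => q.1 : measurableTypeR R).
  exact: measurable_fst.
have m2 : measurable_fun setT (fun q : plane R => q.2 : measurableTypeR R).
  exact: measurable_snd.
have mp1 : measurable_fun setT (fun q : plane R => -1 * q.2 + (r.2 + c1 (r.1 - q.1)) : measurableTypeR R).
  by apply: measurable_funD; [exact: measurable_funM|exact: (measurableT_comp mr1 m1)].
have mp2 : measurable_fun setT (fun q : plane R => 1 * q.2 + c2 q.1 : measurableTypeR R).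
  by apply: measurable_funD; [exact: measurable_funM|exact: (measurableT_comp mc2 m1)].
have mj1 s : measurable_fun setT (fun q : plane R => jap s q.1) by exact: (measurableT_comp (mj s) m1).
have mjr1 s : measurable_fun setT (fun q : plane R => jap s (r.1 - q.1)).
  exact: (measurableT_comp (mjr s) m1).
have mt1 : measurable_fun setT t1.
  exact: measurable_funM (mj1 2) (measurableT_comp (mj (4 * b)) mp1).
have mt2 : measurable_fun setT t2.
  exact: measurable_funM (mj1 2) (measurableT_comp (mj (4 * b)) mp2).
have mt3 : measurable_fun setT t3.
  exact: measurable_funM (mjr1 2) (measurableT_comp (mj (4 * b)) mp1).
have mt4 : measurable_fun setT t4.
  exact: measurable_funM (mjr1 2) (measurableT_comp (mj (4 * b)) mp2).
have p1 q : 0 <= t1 q by rewrite mulr_ge0.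
have p2 q : 0 <= t2 q by rewrite mulr_ge0.
have p3 q : 0 <= t3 q by rewrite mulr_ge0.
have p4 q : 0 <= t4 q by rewrite mulr_ge0.
have P (f : plane R -> R) : measurable_fun setT f -> measurable_fun setT (EFin \o f).
  by move=> mf; exact/measurable_EFinP.
apply: (@le_trans _ _ (\int[mu]_q ((t1 q + t2 q) + (t3 q + t4 q))%:E)%E); last first.
  have m12 : measurable_fun setT (fun q => t1 q + t2 q) by exact: (measurable_funD mt1 mt2).
  have m34 : measurable_fun setT (fun q => t3 q + t4 q) by exact: (measurable_funD mt3 mt4).
  rewrite (ge0_integralD_EFin m12 m34 (fun q => addr_ge0 (p1 q) (p2 q))
    (fun q => addr_ge0 (p3 q) (p4 q))).
  rewrite (ge0_integralD_EFin mt1 mt2 p1 p2) (ge0_integralD_EFin mt3 mt4 p3 p4).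
  rewrite I1 I2 I3 I4 E2 E4 -!EFinM -!EFinD lee_fin.
  by rewrite le_eqVlt; apply/orP; left; apply/eqP; ring.
apply: ge0_le_integral; first exact: measurableT.
- by move=> q _; rewrite lee_fin (mulr_ge0 (sqr_ge0 _) (sqr_ge0 _)).
- apply: P; apply: (measurable_funM (measurable_cst _)); apply: measurable_funX; apply: measurable_funM.
    apply: measurable_funM; first exact: mjr1.
    apply: (measurableT_comp (mj b)); apply: measurable_funD.
      exact: measurable_funB.
    exact: (measurableT_comp mc1 (measurableT_comp mr m1)).
  apply: measurable_funM; first exact: mj1.
  exact: (measurableT_comp (mj b) (measurable_funD m2 (measurableT_comp mc2 m1))).
- by apply: P; apply: measurable_funD; exact: measurable_funD.
move=> q _; rewrite lee_fin /t1 /t2 /t3 /t4 mul1r mulN1r.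
have := kernel_le b (r.1 - q.1) q.1 ((r - q).2 + c1 (r.1 - q.1)) (q.2 + c2 q.1).
by rewrite subrK [- q.2 + (r.2 + _)]addrA [- q.2 + r.2]addrC.
Qed.

End bilinear.

(** * Squared Bourgain norms *)

Section norms.
Context (R : realType).
Local Notation mu := (@pm R).
Implicit Types (A B : plane R -> R) (G H F : plane R -> R[i]) (p q r : plane R).

(** The modulation, which vanishes on the curve tau = - c(xi). *)
Definition sheared (c : R -> R) q : R := q.2 + c q.1.
(** The index -1 stands for the Sobolev exponent 1, since [jap] decays for positive indices. *)
Definition weight (b : R) (c : R -> R) q : R := jap (-1) q.1 * jap (- b) (sheared c q).

Lemma weight_sqr b c q :
  (1 + `|q.1|) `^ (2 * 1) * (1 + `|sheared c q|) `^ (2 * b) = weight b c q ^+ 2.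
Proof. by rewrite /weight exprMn !jap_sqr /jap !mulrN !opprK. Qed.

Lemma weightV b c q : weight b c q * (jap 1 q.1 * jap b (sheared c q)) = 1.
Proof.
have E (s x : R) : jap (- s) x * jap s x = 1 by rewrite -[RHS](japM_powR s x) {1}/jap opprK.
by rewrite mulrACA !E mulr1.
Qed.

Lemma weight_ge1 (b : R) c q : 0 <= b -> 1 <= weight b c q.
Proof.
move=> b0; have E (s x : R) : 0 <= s -> 1 <= jap (- s) x.
  move=> s0; rewrite /jap opprK -[leLHS](powRr0 (1 + `|x|)).
  by apply: ler_powR => //; rewrite lerDl.
by rewrite -[leLHS]mulr1 ler_pM ?E.
Qed.

(** The square of [weighted_norm] for the Sobolev exponent 1; estimates are made on squares and
    roots are taken at the very end. *)
Definition energy (b : R) (c : R -> R) F : \bar R :=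
  (\int[mu]_q (weight b c q ^+ 2 * (complex.Re (F q) ^+ 2 + complex.Im (F q) ^+ 2))%:E)%E.

Lemma weighted_normE b c F :
  weighted_norm (sheared c) b 1 F = sqrte (energy b c F).
Proof.
rewrite /weighted_norm plane_measureE; congr sqrte; apply: eq_integral => q _.
by rewrite sqr_normc weight_sqr.
Qed.

Lemma energy_ge0 b c F : (0 <= energy b c F)%E.
Proof.
apply: integral_ge0 => q _.
by rewrite lee_fin mulr_ge0 ?sqr_ge0 ?addr_ge0 ?sqr_ge0.
Qed.

Variable c : R -> R.
Hypothesis mc : measurable_fun setT (c : measurableTypeR R -> measurableTypeR R).

Lemma measurable_sheared : measurable_fun setT (fun q => sheared c q : measurableTypeR R).
Proof.
apply: measurable_funD; first exact: measurable_snd.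
by apply: (measurableT_comp mc); exact: measurable_fst.
Qed.

Lemma measurable_jap_sheared s b :
  measurable_fun setT (fun q : plane R => jap s q.1 * jap b (sheared c q)).
Proof.
apply: measurable_funM; last exact: (measurableT_comp (@measurable_jap R b) measurable_sheared).
by apply: (measurableT_comp (@measurable_jap R s)); exact: measurable_fst.
Qed.

Lemma measurable_energy b F : cmeasurable F -> measurable_fun setT
  (fun q => (weight b c q ^+ 2 * (complex.Re (F q) ^+ 2 + complex.Im (F q) ^+ 2))%:E).
Proof.
move=> [m1 m2]; apply/measurable_EFinP; apply: measurable_funM.
  by apply: measurable_funX; exact: measurable_jap_sheared.
by apply: measurable_funD; apply: measurable_funX.
Qed.

Lemma energy_L2 b F : 0 <= b -> cmeasurable F -> (energy b c F < +oo)%E ->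
  L2 mu (fun p => complex.Re (F p)) /\ L2 mu (fun p => complex.Im (F p)).
Proof.
move=> b0 mF; have mE := measurable_energy b mF; have [m1 m2] := mF.
have w1 q : 1 <= weight b c q ^+ 2 by rewrite exprn_ege1// weight_ge1.
have key (f : plane R -> R) : measurable_fun setT f -> (energy b c F < +oo)%E ->
    (forall q, f q ^+ 2 <= complex.Re (F q) ^+ 2 + complex.Im (F q) ^+ 2) -> L2 mu f.
  move=> mf lt fF; split => //; apply: le_lt_trans lt.
  apply: ge0_le_integral; first exact: measurableT.
  - by move=> q _; rewrite lee_fin sqr_ge0.
  - exact: measurable_sqr.
  - exact: mE.
  - move=> q _; rewrite lee_fin (le_trans (fF q))// ler_peMl//.
    by rewrite addr_ge0 ?sqr_ge0.
move=> lt; split; apply: key => // q; [rewrite lerDl|rewrite lerDr]; exact: sqr_ge0.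
Qed.

(** Replaces the modulus in bounds for complex products: the real and imaginary parts of a product
    are at most the product of these values. The price is a factor 2 in each energy. *)
Definition l1norm F q : R := `|complex.Re (F q)| + `|complex.Im (F q)|.

Lemma l1norm_ge0 F q : 0 <= l1norm F q. Proof. by rewrite addr_ge0. Qed.

Lemma L2_l1norm F : L2 mu (fun p => complex.Re (F p)) -> L2 mu (fun p => complex.Im (F p)) ->
  L2 mu (l1norm F).
Proof.
have key (f : plane R -> R) : L2 mu f -> L2 mu (fun q => `|f q|).
  move=> fL; have [mf _] := fL; apply: (L2_le (c := 1) _ fL); first exact: measurableT_comp.
  by move=> q; rewrite mul1r real_normK ?num_real.
by move=> F1 F2; apply: L2D; exact: key.
Qed.

Lemma energy_l1norm b F : cmeasurable F ->
  (\int[mu]_p ((weight b c p * l1norm F p) ^+ 2)%:E <= 2%:E * energy b c F)%E.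
Proof.
move=> mF; have mE := measurable_energy b mF; have [m1 m2] := mF.
rewrite -ge0_integralZl//; last first.
  by move=> q _; rewrite lee_fin mulr_ge0 ?sqr_ge0 ?addr_ge0 ?sqr_ge0.
apply: ge0_le_integral; first exact: measurableT.
- by move=> q _; rewrite lee_fin sqr_ge0.
- apply/measurable_EFinP; apply: measurable_funX; apply: measurable_funM.
    exact: measurable_jap_sheared.
  by apply: measurable_funD; exact: measurableT_comp.
- by apply: emeasurable_funM => //; exact: measurable_cst.
move=> q _; rewrite -EFinM lee_fin exprMn [leRHS]mulrCA ler_wpM2l ?sqr_ge0//.
rewrite /l1norm -[complex.Re _ ^+ 2]real_normK ?num_real//.
rewrite -[complex.Im _ ^+ 2]real_normK ?num_real//.
by have := sqr_ge0 (`|complex.Re (F q)| - `|complex.Im (F q)|); move: `|_| `|_| => x y; nra.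
Qed.

End norms.

(** * The bilinear estimate *)

Section bilinear_energy.
Context (R : realType).
Local Notation mu := (@pm R).
Implicit Types (G H : plane R -> R[i]) (r q : plane R).

Let kap : R := (2 * pi) ^+ 2.

Lemma conv_diff_le (G1 G2 H1 H2 A B : plane R -> R) r :
  L2 mu G1 -> L2 mu G2 -> L2 mu H1 -> L2 mu H2 -> L2 mu A -> L2 mu B ->
  (forall p q, `|G1 p * H1 q + G2 p * H2 q| <= A p * B q) ->
  `|conv G1 H1 r + conv G2 H2 r| <= conv A B r.
Proof.
move=> G1L G2L H1L H2L AL BL le.
have i1 := L2M_integrable (L2_refl r G1L) H1L.
have i2 := L2M_integrable (L2_refl r G2L) H2L.
have i := L2M_integrable (L2_refl r AL) BL.
have i12 : L1 mu (fun q => G1 (r - q) * H1 q + G2 (r - q) * H2 q).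
  by have := integrable_lin 1 1 i1 i2; congr integrable; apply/funext => q; rewrite /= !mul1r.
rewrite /conv -(RintegralD measurableT i1 i2).
apply: (le_trans (le_normr_Rintegral measurableT i12)).
by apply: le_Rintegral => //; exact: (integrable_abse i12).
Qed.

Lemma conv_fourier_energy a b (c1 c2 c : R -> R) : 4^-1 < b -> 0 < a ->
  measurable_fun setT (c1 : measurableTypeR R -> measurableTypeR R) ->
  measurable_fun setT (c2 : measurableTypeR R -> measurableTypeR R) ->
  measurable_fun setT (c : measurableTypeR R -> measurableTypeR R) ->
  exists2 K : R, 0 <= K & forall G H, cmeasurable G -> cmeasurable H ->
    (energy b c1 G < +oo)%E -> (energy b c2 H < +oo)%E ->
    (energy (- a) c (conv_fourier G H) <= K%:E * (energy b c1 G * energy b c2 H))%E.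
Proof.
move=> b4 a0 mc1 mc2 mc.
have b0 : 0 <= b by lra.
have [K K0 HK] := kernel_bound b4 mc1 mc2.
have kg0 : 0 <= kap^-1 by rewrite invr_ge0 sqr_ge0.
(* The 2 accounts for the real and imaginary parts, the square of [kap^-1] for the normalization of
   [conv_fourier], and the 4 for passing twice from [l1norm] to the energy. *)
exists (2 * kap^-1 ^+ 2 * (4 * K)); first by rewrite !mulr_ge0// sqr_ge0.
move=> G H mG mH eG eH.
have [G1L G2L] := energy_L2 mc1 b0 mG eG; have [H1L H2L] := energy_L2 mc2 b0 mH eH.
have AL := L2_l1norm G1L G2L; have BL := L2_l1norm H1L H2L.
set A := l1norm G in AL; set B := l1norm H in BL.
have [mA _] := AL; have [mB _] := BL.
have mcv : measurable_fun setT (conv A B) by exact: measurable_conv.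
have ms : measurable_fun setT (fun r : plane R => 1 + `|r.1|).
  by apply: measurable_funD => //; apply: measurableT_comp => //; exact: measurable_fst.
have main := weighted_conv_le AL BL (l1norm_ge0 G) (l1norm_ge0 H)
  (measurable_jap_sheared mc1 _ _) (measurable_jap_sheared mc2 _ _) ms
  (measurable_jap_sheared mc1 _ _) (measurable_jap_sheared mc2 _ _)
  (weightV b c1) (weightV b c2) K0 HK.
have F1 r : `|complex.Re (conv_fourier G H r)| <= kap^-1 * conv A B r.
  rewrite /= normrM (ger0_norm kg0) ler_wpM2l//.
  have N2L := L2N G2L.
  have <- : conv (fun p => complex.Re (G p)) (fun p => complex.Re (H p)) r +
     conv (fun p => - complex.Im (G p)) (fun p => complex.Im (H p)) r =
     conv (fun p => complex.Re (G p)) (fun p => complex.Re (H p)) r -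
     conv (fun p => complex.Im (G p)) (fun p => complex.Im (H p)) r.
    by rewrite {2}/conv (RintegralNM (L2M_integrable (L2_refl r G2L) H2L)).
  apply: conv_diff_le => // p q; rewrite mulNr (le_trans (ler_normB _ _))// !normrM /A /B /l1norm.
  by rewrite mulrDl !mulrDr; have := mulr_ge0 (normr_ge0 (complex.Re (G p))) (normr_ge0 (complex.Im (H q)));
    have := mulr_ge0 (normr_ge0 (complex.Im (G p))) (normr_ge0 (complex.Re (H q))); lra.
have F2 r : `|complex.Im (conv_fourier G H r)| <= kap^-1 * conv A B r.
  rewrite /= normrM (ger0_norm kg0) ler_wpM2l//.
  apply: conv_diff_le => // p q; rewrite (le_trans (ler_normD _ _))// !normrM /A /B /l1norm.
  by rewrite mulrDl !mulrDr; have := mulr_ge0 (normr_ge0 (complex.Re (G p))) (normr_ge0 (complex.Re (H q)));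
    have := mulr_ge0 (normr_ge0 (complex.Im (G p))) (normr_ge0 (complex.Im (H q))); lra.
have mF : cmeasurable (conv_fourier G H).
  have [? _] := G1L; have [? _] := G2L; have [? _] := H1L; have [? _] := H2L.
  split => /=; apply: (measurable_funM (measurable_cst _)).
    by apply: measurable_funB; exact: measurable_conv.
  by apply: measurable_funD; exact: measurable_conv.
have k20 : 0 <= 2 * kap^-1 ^+ 2 by rewrite mulr_ge0 ?sqr_ge0.
apply: (@le_trans _ _ ((2 * kap^-1 ^+ 2)%:E *
   \int[mu]_r ((1 + `|r.1|) ^+ 2 * conv A B r ^+ 2)%:E)%E).
  rewrite -ge0_integralZ_EFin//; last first.
  - by move=> r; rewrite mulr_ge0 ?sqr_ge0.
  - by apply: measurable_funM; exact: measurable_funX.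
  apply: ge0_le_integral; first exact: measurableT.
  - by move=> q _; rewrite lee_fin (mulr_ge0 (sqr_ge0 _) (addr_ge0 (sqr_ge0 _) (sqr_ge0 _))).
  - exact: measurable_energy.
  - apply/measurable_EFinP; apply: (measurable_funM (measurable_cst _)).
    by apply: measurable_funM; exact: measurable_funX.
  move=> r _; rewrite lee_fin [leRHS]mulrCA; apply: ler_pM; rewrite ?sqr_ge0 ?addr_ge0 ?sqr_ge0//.
    rewrite /weight exprMn -[leRHS]mulr1; apply: ler_pM; rewrite ?sqr_ge0//.
      by rewrite /jap opprK powRr1// addr_ge0.
    rewrite opprK jap_sqr /jap powRN invf_le1 ?powR_gt0 ?ltr_wpDr//.
    rewrite -[leLHS](powRr0 (1 + `|sheared c r|)); apply: ler_powR; first by rewrite lerDl.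
    by rewrite mulr_ge0// ltW.
  have cv0 : 0 <= kap^-1 * conv A B r := le_trans (normr_ge0 _) (F1 r).
  have sq (x : R) : `|x| <= kap^-1 * conv A B r -> x ^+ 2 <= kap^-1 ^+ 2 * conv A B r ^+ 2.
    by move=> h; rewrite -exprMn -[leLHS]real_normK ?num_real// ler_sqr ?nnegrE.
  rewrite -mulrA mulr_natl mulr2n; exact: lerD (sq _ (F1 r)) (sq _ (F2 r)).
rewrite [in leRHS]EFinM -[leRHS]muleA; apply: lee_wpmul2l; first by rewrite lee_fin.
apply: (le_trans main); rewrite [(4 * K)%R]mulrC [in leRHS]EFinM -[leRHS]muleA.
apply: lee_wpmul2l; first by rewrite lee_fin.
have e1 := energy_l1norm mc1 b mG; have e2 := energy_l1norm mc2 b mH.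
rewrite (_ : (4 : R)%:E = 2%:E * 2%:E)%E; last by rewrite -EFinM -natrM.
rewrite muleACA; apply: lee_pmul; [| |exact: e1|exact: e2];
  by apply: integral_ge0 => q _; rewrite lee_fin sqr_ge0.
Qed.

(** Norms are infima over the possible transforms; near-minimizers reduce the estimate to individual
    transforms of finite norm. *)
Lemma le_ereal_inf_mul (S1 S2 : set (\bar R)) (C : R) (N : \bar R) : 0 <= C ->
  (forall x, S1 x -> 0 <= x)%E -> (forall x, S2 x -> 0 <= x)%E ->
  (ereal_inf S1 < +oo)%E -> (ereal_inf S2 < +oo)%E ->
  (forall x y, S1 x -> S2 y -> x < +oo -> y < +oo -> N <= C%:E * x * y)%E ->
  (N <= C%:E * ereal_inf S1 * ereal_inf S2)%E.
Proof.
move=> C0 S10 S20 S1oo S2oo H.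
have p1 : (0 <= ereal_inf S1)%E by exact/le_ereal_inf_tmp.
have p2 : (0 <= ereal_inf S2)%E by exact/le_ereal_inf_tmp.
have f1 : ereal_inf S1 \is a fin_num by rewrite ge0_fin_numE.
have f2 : ereal_inf S2 \is a fin_num by rewrite ge0_fin_numE.
set x := fine (ereal_inf S1); set y := fine (ereal_inf S2).
have x0 : 0 <= x by exact: fine_ge0.
have y0 : 0 <= y by exact: fine_ge0.
rewrite -(fineK f1) -(fineK f2) -/x -/y -!EFinM.
have bound (e : R) : 0 < e -> (N <= (C * (x + e) * (y + e))%:E)%E.
  move=> e0; have [u Su hu] := lb_ereal_inf_adherent e0 f1.
  have [v Sv hv] := lb_ereal_inf_adherent e0 f2.
  have u0 := S10 _ Su; have v0 := S20 _ Sv.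
  rewrite -(fineK f1) -/x -EFinD in hu; rewrite -(fineK f2) -/y -EFinD in hv.
  have uoo : (u < +oo)%E by apply: lt_trans hu _; rewrite ltry.
  have voo : (v < +oo)%E by apply: lt_trans hv _; rewrite ltry.
  apply: (le_trans (H _ _ Su Sv uoo voo)).
  have fu : u \is a fin_num by rewrite ge0_fin_numE.
  have fv : v \is a fin_num by rewrite ge0_fin_numE.
  rewrite -(fineK fu) -(fineK fv) -!EFinM lee_fin.
  rewrite -(fineK fu) lte_fin in hu; rewrite -(fineK fv) lte_fin in hv.
  have fu0 : 0 <= fine u by exact: fine_ge0.
  have fv0 : 0 <= fine v by exact: fine_ge0.
  by rewrite ler_pM ?mulr_ge0 ?ler_wpM2l// ltW.
apply/lee_addgt0Pr => e e0.
(* As [d <= 1], the product [C * (x + d) * (y + d)] exceeds [C * x * y] by at most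
   [d * C * (x + y + 1)], which is at most [e]; the [+ 1] in the denominator keeps it positive. *)
pose d := Num.min 1 (e / (C * (x + y + 1) + 1)).
have D0 : 0 < C * (x + y + 1) + 1 by rewrite ltr_wpDl// mulr_ge0// !addr_ge0.
have d0 : 0 < d by rewrite lt_min ltr01 divr_gt0.
have d1 : d <= 1 by rewrite ge_min lexx.
have d2 : d * (C * (x + y + 1) + 1) <= e by rewrite -ler_pdivlMr// ge_min lexx orbT.
apply: (le_trans (bound d d0)); rewrite -EFinD lee_fin.
have h1 : d * d <= d by rewrite ler_piMl// ltW.
have h2 : C * (d * d) <= C * d by rewrite ler_wpM2l.
nra.
Qed.

End bilinear_energy.

Theorem lemma3p2 (R : realType) (a b : R)
    (ha : 4^-1 < a < 2^-1) (hb : 4^-1 < b < 2^-1) (hab : 1 < a + 2 * b) :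
  exists C : R, forall g h : plane R -> R[i],
    X_space b 1 g -> Y_space b 1 h ->
    (X_norm (- a) 1 (fun p => (g p * h p)%R)
       <= C%:E * X_norm b 1 g * Y_norm b 1 h)%E.
Proof.
have [a4 _] := andP ha; have [b4 _] := andP hb.
have a0 : 0 < a by lra.
have b0 : 0 <= b by lra.
(* The modulations tau + xi^2 and tau - xi^3 of the two norms. *)
pose cX (x : R) := x ^+ 2; pose cY (x : R) := - x ^+ 3.
have mX : measurable_fun setT (cX : measurableTypeR R -> measurableTypeR R).
  exact: measurable_funX.
have mY : measurable_fun setT (cY : measurableTypeR R -> measurableTypeR R).
  by apply: measurableT_comp => //; exact: measurable_funX.
have [K K0 HK] := conv_fourier_energy b4 a0 mX mY mX.
(* [K] bounds energies, which are squares of norms. *)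
exists (Num.sqrt K) => g h gX hY.
have nn omega (f : plane R -> R[i]) x :
    [set weighted_norm omega b 1 F | F in is_fourier f] x -> (0 <= x)%E.
  by move=> [F _ <-]; exact: sqrte_ge0.
apply: (@le_ereal_inf_mul R [set weighted_norm (sheared cX) b 1 F | F in is_fourier g]
  [set weighted_norm (sheared cY) b 1 F | F in is_fourier h] _ _ (sqrtr_ge0 K)
  (nn _ _) (nn _ _) gX hY).
move=> _ _ [G gG <-] [H hH <-].
have [_ [mG _] _] := gG; have [_ [mH _] _] := hH.
rewrite (weighted_normE b cX G) (weighted_normE b cY H) => eG eH.
have fin c F : (sqrte (energy b c F) < +oo)%E -> (energy b c F < +oo)%E.
  by rewrite -!ge0_fin_numE ?sqrte_ge0 ?energy_ge0// sqrte_fin_num// energy_ge0.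
have [G1L G2L] := energy_L2 mX b0 mG (fin _ _ eG).
have [H1L H2L] := energy_L2 mY b0 mH (fin _ _ eH).
have FP := is_fourier_product gG hH G1L G2L H1L H2L.
(* The norm of the product is an infimum, so the one transform [conv_fourier G H] bounds it from
   above. *)
apply: (@le_trans _ _ (weighted_norm (sheared cX) (- a) 1 (conv_fourier G H))).
  by apply: ereal_inf_lbound; exists (conv_fourier G H).
rewrite weighted_normE.
have := HK G H mG mH (fin _ _ eG) (fin _ _ eH).
rewrite -lee_sqrt ?mule_ge0 ?energy_ge0// sqrteM ?lee_fin// sqrteM ?energy_ge0//.
by rewrite muleA.
Qed.
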